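(* Let $(M_p)_{p\in\mathbb{N}}$ be a sequence of positive real numbers with $M_0=1$ satisfying $(M.1)$ $M_p^2\le M_{p-1}M_{p+1}$ for $p\ge 1$; $(M.2)'$ there are $A,H>0$ with $M_{p+1}\le AH^pM_p$ for all $p\in\mathbb{N}$; $(M.3)'$ $\sum_{p=1}^\infty M_{p-1}/M_p<\infty$; and let $M$ be its associated function. Let $\Lambda$ be a lattice in $\mathbb{R}^d$ with dual lattice $\Lambda^*$, let $U$ be an open convex neighborhood of the origin in $\mathbb{R}^d$ such that $U\cap\Lambda^*=\{0\}$, let $\Omega\subseteq\mathbb{R}^d$ be open, and let $f\in{\mathcal{D}^{(M_p)}}'(\Omega)$. Then the Roumieu wave front set $WF_{\{M_p\}}(f)$ (respectively, the Beurling wave front set $WF_{(M_p)}(f)$) coincides with the complement in $\Omega\times(\mathbb{R}^d\setminus\{0\})$ of the set of all points $(x_0,\xi_0)$ for which there exist an open conic neighborhood $\Gamma$ of $\xi_0$ and $\varphi\in\mathcal{D}^{(M_p)}(\Omega\cap(x_0+U))$ with $\varphi\equiv1$ in a neighborhood of $x_0$ such that for some $r>0$ (respectively, for every $r>0$) $$\sup_{\mu\in\Gamma\cap\Lambda}|\widehat{\varphi f}(\mu)|\,e^{M(r\mu)}<\infty.$$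
   Context: A lattice $\Lambda$ in $\mathbb{R}^d$ is a discrete subgroup spanning the real vector space $\mathbb{R}^d$; its dual lattice is $\Lambda^*=\{\mu^*\in\mathbb{R}^d:\ \mu\cdot\mu^*\in\mathbb{Z}\ \forall\mu\in\Lambda\}$. An open conic neighborhood of $\xi_0\neq0$ is an open subset of $\mathbb{R}^d\setminus\{0\}$ containing $\xi_0$ and invariant under multiplication by positive scalars. The associated function is $M(t)=\sup_{p\in\mathbb{N}}\log(t^p/M_p)$ for $t>0$, and $M(r\mu)$ means $M(r|\mu|)$. Fourier transform: $\widehat\varphi(\xi)=\int_{\mathbb{R}^d}\varphi(x)e^{-2\pi i\xi\cdot x}\,dx$; for a compactly supported ultradistribution $g$, $\widehat g(\xi)=\langle g(x),e^{-2\pi i\xi\cdot x}\rangle$. Spaces: for $K$ compact in $\Omega$ and $h>0$, $\mathcal{E}^{\{M_p\},h}(K)$ is the space of $\varphi\in C^\infty(\Omega)$ with $\sup_{x\in K,\alpha\in\mathbb{N}^d}|\varphi^{(\alpha)}(x)|/(h^{|\alpha|}M_{|\alpha|})<\infty$, and $\mathcal{D}^{\{M_p\},h}_K$ is its subspace of functions with support in $K$. Then $\mathcal{D}^{(M_p)}(\Omega)=\varinjlim_{K\Subset\Omega}\varprojlim_{h\to0^+}\mathcal{D}^{\{M_p\},h}_K$ and $\mathcal{E}^{(M_p)}(\Omega)=\varprojlim_{K\Subset\Omega}\varprojlim_{h\to0^+}\mathcal{E}^{\{M_p\},h}(K)$; their duals are ${\mathcal{D}^{(M_p)}}'(\Omega)$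 (ultradistributions) and ${\mathcal{E}^{(M_p)}}'(\Omega)$ (compactly supported ultradistributions). Wave front sets: $f\in{\mathcal{D}^{(M_p)}}'(\Omega)$ is $\{M_p\}$-microlocally regular at $(x_0,\xi_0)\in\Omega\times(\mathbb{R}^d\setminus\{0\})$ if there are an open conic neighborhood $\Gamma$ of $\xi_0$, an open neighborhood $V$ of $x_0$ and a bounded sequence $(f_p)_{p\in\mathbb{N}}$ in ${\mathcal{E}^{(M_p)}}'(\Omega)$ with $f_p=f$ on $V$ for all $p$, such that for some $A,C>0$ $$\sup_{\xi\in\Gamma}|\widehat{f_p}(\xi)||\xi|^p<AC^pM_p,\qquad\forall p\in\mathbb{N}.$$ It is $(M_p)$-microlocally regular at $(x_0,\xi_0)$ if the same holds with the last estimate valid for every $C>0$ and some $A=A_C>0$. $WF_{\{M_p\}}(f)$ (resp. $WF_{(M_p)}(f)$) is the set of $(x_0,\xi_0)\in\Omega\times(\mathbb{R}^d\setminus\{0\})$ at which $f$ is not $\{M_p\}$- (resp. $(M_p)$-) microlocally regular. *)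

(* Defs.v *)
From HB Require Import structures.
From mathcomp Require Import all_boot all_order all_algebra.
From mathcomp Require Import all_classical all_reals all_analysis.
From mathcomp.real_closed Require Import complex.

Set Implicit Arguments.
Unset Strict Implicit.
Unset Printing Implicit Defensive.

Import Order.TTheory GRing.Theory Num.Theory.
Import numFieldNormedType.Exports.

Local Open Scope classical_set_scope.
Local Open Scope ring_scope.

Section Euclidean.
Variables (R : realType) (d : nat).
Implicit Types (x y xi : 'rV[R]_d) (G L U : set 'rV[R]_d).

Definition dot x y : R := \sum_(i < d) x 0 i * y 0 i.

(* The library norm of 'rV[R]_d is the sup norm; it induces the usual topology,
   but the estimates in frequency use the Euclidean length. *)
Definition enorm x : R := Num.sqrt (dot x x).

Definition lattice L : Prop :=
  [/\ L 0, (forall x y, L x -> L y -> L (x - y)), L `<=` isolated L &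
      forall v, exists2 s : seq 'rV[R]_d,
        (forall x, x \in s -> L x) & v \in span s].

Definition dual_lattice L : set 'rV[R]_d :=
  [set y | forall x, L x -> dot x y \is a Num.int].

Definition conic_nbhd xi G : Prop :=
  [/\ open G, G xi, G `<=` [set~ 0] &
      forall t x, 0 < t -> G x -> G (t *: x)].

End Euclidean.

Section TestFunctions.
Variables (R : realType) (d : nat) (M : nat -> R).
Local Notation E := 'rV[R]_d.
Implicit Types (phi psi : E -> R[i]) (Omega K : set E) (h : R).

(* R[i] carries no structure of normed module over R in the library, hence
   continuity and derivatives are taken on real and imaginary parts. *)
Definition repart phi : E -> R := fun x => complex.Re (phi x).
Definition impart phi : E -> R := fun x => complex.Im (phi x).

Definition pderiv (i : 'I_d) phi : E -> R[i] := fun x =>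
  Complex ('D_(delta_mx 0 i) (repart phi) x) ('D_(delta_mx 0 i) (impart phi) x).

Definition pderivs (s : seq 'I_d) phi : E -> R[i] := foldr pderiv phi s.

Definition mabs (al : {ffun 'I_d -> nat}) : nat := (\sum_(i < d) al i)%N.

Definition mderiv (al : {ffun 'I_d -> nat}) phi : E -> R[i] :=
  pderivs (flatten [seq nseq (al i) i | i <- enum 'I_d]) phi.

(* A function on the open set Omega is encoded by any function on the whole
   space; its values outside Omega are irrelevant. *)
Definition smooth_on Omega phi : Prop :=
  forall (s : seq 'I_d) x, Omega x ->
    [/\ {for x, continuous (repart (pderivs s phi))},
        {for x, continuous (impart (pderivs s phi))} &
        forall i : 'I_d,
          derivable (repart (pderivs s phi)) x (delta_mx 0 i) /\
          derivable (impart (pderivs s phi)) x (delta_mx 0 i)].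

Definition cabs (z : R[i]) : R := Normc.normc z.

Definition ultranorm K h phi : \bar R :=
  ereal_sup [set (cabs (mderiv a.2 phi a.1) / (h ^+ mabs a.2 * M (mabs a.2)))%:E
            | a in K `*` [set: {ffun 'I_d -> nat}]].

Definition compact_in K Omega : Prop := compact K /\ K `<=` Omega.

Definition csupport phi : set E := closure [set x | phi x != 0].

Definition E_Kh Omega K h : set (E -> R[i]) :=
  [set phi | smooth_on Omega phi /\ (ultranorm K h phi < +oo)%E].

(* Functions with compact support in Omega are encoded by their extension
   by zero. *)
Definition D_Kh Omega K h : set (E -> R[i]) :=
  [set phi | E_Kh Omega K h phi /\ csupport phi `<=` K].

Definition D_K Omega K : set (E -> R[i]) :=
  [set phi | forall h, 0 < h -> D_Kh Omega K h phi].

Definition D_space Omega : set (E -> R[i]) :=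
  [set phi | exists2 K, compact_in K Omega & D_K Omega K phi].

Definition E_space Omega : set (E -> R[i]) :=
  [set phi | forall K h, compact_in K Omega -> 0 < h -> E_Kh Omega K h phi].

(* D_K and E_space carry projective limit
   topologies of directed families of seminorms; D_space carries the locally
   convex inductive limit topology, a base at 0 of which is given by the
   absolutely convex sets meeting each D_K in a neighbourhood of 0. *)
Definition D_K_nbhs0 Omega K (W : set (E -> R[i])) : Prop :=
  exists h delta : R, [/\ 0 < h, 0 < delta &
    forall phi, D_K Omega K phi -> (ultranorm K h phi < delta%:E)%E -> W phi].

Definition absolutely_convex (W : set (E -> R[i])) : Prop :=
  forall phi psi (a b : R[i]), W phi -> W psi -> cabs a + cabs b <= 1 ->
    W (fun x => a * phi x + b * psi x).

Definition D_nbhs0 Omega (W : set (E -> R[i])) : Prop :=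
  exists W0 : set (E -> R[i]),
    [/\ W0 `<=` D_space Omega, W0 `<=` W, absolutely_convex W0 &
        forall K, compact_in K Omega -> D_K_nbhs0 Omega K W0].

Definition E_nbhs0 Omega (W : set (E -> R[i])) : Prop :=
  exists K (h delta : R), [/\ compact_in K Omega, 0 < h, 0 < delta &
    forall phi, E_space Omega phi -> (ultranorm K h phi < delta%:E)%E -> W phi].

Definition E_bounded Omega (B : set (E -> R[i])) : Prop :=
  B `<=` E_space Omega /\
  forall K h, compact_in K Omega -> 0 < h ->
    (ereal_sup [set ultranorm K h phi | phi in B] < +oo)%E.

End TestFunctions.

Section Ultradistributions.
Variables (R : realType) (d : nat) (M : nat -> R).
Local Notation E := 'rV[R]_d.
Implicit Types (phi psi : E -> R[i]) (f g : (E -> R[i]) -> R[i]).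
Implicit Types (Omega V : set E).

Definition linear_on (S : set (E -> R[i])) f : Prop :=
  forall (a : R[i]) phi psi, S phi -> S psi ->
    f (fun x => a * phi x + psi x) = a * f phi + f psi.

(* Functionals are total, but only their values on the test space
   matter. *)
Definition D_dual Omega f : Prop :=
  linear_on (D_space M Omega) f /\
  forall e : R, 0 < e -> D_nbhs0 M Omega [set phi | cabs (f phi) < e].

Definition E_dual Omega f : Prop :=
  linear_on (E_space M Omega) f /\
  forall e : R, 0 < e -> E_nbhs0 M Omega [set phi | cabs (f phi) < e].

(* Boundedness refers to the strong dual topology. *)
Definition E_dual_bounded_seq Omega (g : nat -> (E -> R[i]) -> R[i]) : Prop :=
  (forall p, E_dual Omega (g p)) /\
  forall B, E_bounded M Omega B ->
    exists c : R, forall p phi, B phi -> cabs (g p phi) <= c.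

Definition agree_on V f g : Prop :=
  forall phi, D_space M V phi -> f phi = g phi.

Definition mul_ultradist phi f : (E -> R[i]) -> R[i] :=
  fun psi => f (fun x => phi x * psi x).

(* e^{- 2 i pi (xi . x)}, by Euler's formula *)
Definition echar (xi x : E) : R[i] :=
  Complex (cos (2 * pi * dot xi x)) (- sin (2 * pi * dot xi x)).

Definition fourier g (xi : E) : R[i] := g (echar xi).

Definition associated_function (t : R) : \bar R :=
  ereal_sup [set (ln (t ^+ p / M p))%:E | p in [set: nat]].

Definition decay_estimate (G : set E) (g : nat -> (E -> R[i]) -> R[i])
    (A C : R) : Prop :=
  forall p : nat,
    (ereal_sup [set (cabs (fourier (g p) xi) * enorm xi ^+ p)%:E | xi in G]
      < (A * C ^+ p * M p)%:E)%E.

Definition Roumieu_regular Omega f (x0 xi0 : E) : Prop :=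
  exists (G V : set E) (g : nat -> (E -> R[i]) -> R[i]),
    [/\ conic_nbhd xi0 G, [/\ open V, V x0 & V `<=` Omega],
        E_dual_bounded_seq Omega g, (forall p, agree_on V (g p) f) &
        exists A C : R, [/\ 0 < A, 0 < C & decay_estimate G g A C]].

Definition Beurling_regular Omega f (x0 xi0 : E) : Prop :=
  exists (G V : set E) (g : nat -> (E -> R[i]) -> R[i]),
    [/\ conic_nbhd xi0 G, [/\ open V, V x0 & V `<=` Omega],
        E_dual_bounded_seq Omega g, (forall p, agree_on V (g p) f) &
        forall C : R, 0 < C -> exists2 A : R, 0 < A & decay_estimate G g A C].

Definition Roumieu_WF Omega f : set (E * E) :=
  [set z | (Omega `*` [set~ 0]) z /\ ~ Roumieu_regular Omega f z.1 z.2].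

Definition Beurling_WF Omega f : set (E * E) :=
  [set z | (Omega `*` [set~ 0]) z /\ ~ Beurling_regular Omega f z.1 z.2].

Definition cutoff_at (W : set E) (x0 : E) phi : Prop :=
  D_space M W phi /\ \forall x \near x0, phi x = 1.

Definition lattice_decay (L G : set E) g (r : R) : Prop :=
  (ereal_sup [set (cabs (fourier g mu))%:E *
                  expeR (associated_function (r * enorm mu))
             | mu in G `&` L] < +oo)%E.

End Ultradistributions.

(* Main.v *)
Require Import Defs.
From HB Require Import structures.
From mathcomp Require Import all_boot all_order all_algebra.
From mathcomp Require Import all_classical all_reals all_analysis.
From mathcomp.real_closed Require Import complex.
From mathcomp Require Import ring lra zify.

Set Implicit Arguments.
Unset Strict Implicit.
Unset Printing Implicit Defensive.

Import Order.TTheory GRing.Theory Num.Theory.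
Import numFieldNormedType.Exports.

Local Open Scope classical_set_scope.
Local Open Scope ring_scope.

(* Both conditions say that the Fourier transform of a localization of [f] decays in
   a cone: along the whole cone, or only at lattice points.  They are compared by
   multiplying a functional [F] with compactly supported action by a bump [chi] at
   [x0] that lives in a small box of the coordinates given by a basis [B] of a
   lattice.  On the set carrying [F] the bump coincides with its periodization along
   the dual lattice (for the given lattice because of the hypothesis on [U], for a
   sufficiently fine auxiliary lattice because that set is bounded).  Hence
   [F (e_xi chi)] is the sum, over the lattice points [zeta] seen from [xi], of
   [F (e_zeta)] times the Fourier coefficient of [chi] at [xi - zeta].  For [zeta] near
   [xi] one uses the decay of [F (e_zeta)] in the cone; the other [zeta] are harmless
   because the coefficients of [chi] beat the growth of [F (e_zeta)].

   The product of the derivatives of [chi] with those of the exponentials must be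
   controlled without the stability condition [(M.2)].  To this end [chi] is built
   from a smaller sequence [halfM M], with [halfM M (p + q) <= M p * M q], which is
   still non-quasianalytic. *)

(** * Log-convex sequences *)

Section Weights.
Variable R : realType.

(** Two quantifiers shape the estimates. In the definition of regularity the functional [g p] may
    change with the power [p], whereas the lattice condition concerns the single product [phi f].
    Boundedness in the strong dual provides one compact set and one seminorm dominating all [g p];
    conversely a constant sequence [chi f] witnesses regularity. Moreover [F] is continuous for some
    [h] only, possibly small, so the expansion must converge in every seminorm and the bump must
    satisfy its bounds for every [h].

    For a frequency [eta] of the bump that is not small compared with [xi], both [xi] and
    [zeta = xi - eta] are at most a constant times [eta]. The factor [|xi| ^ p] and the derivatives
    of order [q] of [e_zeta] then cost a power [p + q] of [eta], which [halfM] distributes as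
    [M p * M q]: one factor is the wanted bound, the other the seminorm of [e_zeta].

    The outcome is one transfer turning the constant [C] of a decay estimate into a multiple of
    [max (2 * C) h'] with [h'] free. The choice [h' = 2 * C] settles the Roumieu and Beurling cases
    alike. *)

Lemma prod_bounded (x : nat -> R) (n0 : nat) :
  (forall i, 0 <= x i) -> (forall i, (n0 <= i)%N -> x i <= 1) ->
  exists2 B, 0 < B & forall k, \prod_(i < k) x i <= B.
Proof.
move=> x0 x1.
exists (\prod_(i < n0) (1 + x i)).
  by apply: prodr_gt0 => i _; rewrite ltr_pwDl.
move=> k.
have aux n m : \prod_(i < n) x i <= \prod_(i < n + m) (1 + x i).
  rewrite big_split_ord/= -[leLHS]mulr1; apply: ler_pM => //.
  - exact: prodr_ge0.
  - by apply: ler_prod => i _; rewrite x0/= lerDr.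
  - elim/big_rec : _ => // i y _ y1.
    by apply: mulr_ege1 => //; rewrite lerDl.
have [kn|nk] := leqP k n0; first by rewrite -(subnKC kn).
rewrite -(subnKC (ltnW nk)) big_split_ord/= -[leRHS]mulr1; apply: ler_pM.
- exact: prodr_ge0.
- exact: prodr_ge0.
- by have := aux n0 0%N; rewrite addn0.
- rewrite -[leRHS](expr1n _ (k - n0)) -[in X in _ <= _ ^+ X](card_ord (k - n0)).
  rewrite -prodr_const; apply: ler_prod => i _; rewrite x0/= x1//.
  exact: leq_addr.
Qed.

(** A convergent series of positive terms absorbs some weights tending to infinity. These weights
    later yield derivative bounds of the bump for every [h] instead of for one. *)
Lemma slow_weights (b : nat -> R) (S : R) :
  (forall i, 0 < b i) -> (forall n, \sum_(i < n) b i <= S) ->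
  exists r : nat -> R, [/\ forall i, 0 < r i,
    (exists T, forall n, \sum_(i < n) b i * r i <= T) &
    forall K, exists n0, forall i, (n0 <= i)%N -> K <= r i].
Proof.
move=> b0 bS.
pose A := [set x | exists n, x = \sum_(i < n) b i].
have supA : has_sup A.
  split; first by exists (\sum_(i < 0) b i); exists 0%N.
  by exists S => _ [n ->].
pose t n := sup A - \sum_(i < n) b i.
have tS n : t n = t n.+1 + b n by rewrite /t big_ord_recr/=; ring.
have t_ge0 n : 0 <= t n.
  by rewrite subr_ge0; apply: ub_le_sup; [exact: supA.2|exists n].
have t0 n : 0 < t n by rewrite tS ltr_wpDl.
have tle n k : t (n + k)%N <= t n.
  elim: k => [|k IH]; first by rewrite addn0.
  by apply: le_trans IH; rewrite addnS [leRHS]tS lerDl ltW.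
pose q n := Num.sqrt (t n).
have q0 n : 0 < q n by rewrite sqrtr_gt0.
have q2 n : q n ^+ 2 = t n by rewrite sqr_sqrtr.
(* One over the square root of the tail of the series; the weighted sum telescopes. *)
exists (fun n => (q n)^-1); split.
- by move=> i; rewrite invr_gt0.
- exists (2 * q 0%N) => n.
  suff : \sum_(i < n) b i * (q i)^-1 <= 2 * (q 0%N - q n).
    move=> /le_trans; apply; rewrite ler_pM2l// lerBlDr lerDl ltW//.
  elim: n => [|n IH]; first by rewrite big_ord0 subrr mulr0.
  rewrite big_ord_recr/= (_ : 2 * (q 0%N - q n.+1) =
    2 * (q 0%N - q n) + 2 * (q n - q n.+1)); last by ring.
  apply: lerD => //.
  rewrite ler_pdivrMr// (_ : b n = q n ^+ 2 - q n.+1 ^+ 2); last first.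
    by rewrite !q2 tS; ring.
  by have := sqr_ge0 (q n - q n.+1); lra.
- move=> K; pose K' := 1 + `|K|.
  have K'0 : 0 < K' by rewrite ltr_pwDl.
  have e0 : 0 < K'^-1 ^+ 2 by rewrite exprn_gt0// invr_gt0.
  have [e [n ->] en] := sup_adherent e0 supA.
  exists n => i ni.
  apply: (@le_trans _ _ K'); first by rewrite /K' ler_wpDl// ler_norm.
  rewrite -[leLHS]invrK lef_pV2 ?posrE ?invr_gt0//.
  rewrite -(ler_pXn2r (n := 2)) ?nnegrE// ?ltW ?invr_gt0// q2.
  rewrite -(subnKC ni); apply: (le_lt_trans (tle _ _)).
  by rewrite /t ltrBlDr addrC -ltrBlDr.
Qed.

End Weights.

Section LogConvex.
Variables (R : realType) (M : nat -> R).
Hypothesis M_gt0 : forall p, 0 < M p.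
Hypothesis M_0 : M 0%N = 1.
Hypothesis M_1 : forall p, (1 <= p)%N -> M p ^+ 2 <= M p.-1 * M p.+1.

Definition quot (p : nat) : R := M p.+1 / M p.

Lemma quot_gt0 p : 0 < quot p.
Proof. by rewrite divr_gt0. Qed.

Lemma quot_homo p q : (p <= q)%N -> quot p <= quot q.
Proof.
move=> /subnKC <-; elim: (q - p)%N => [|k IH]; first by rewrite addn0.
apply: (le_trans IH); rewrite addnS /quot ler_pdivrMr// mulrAC ler_pdivlMr//.
by have := M_1 (ltn0Sn (p + k)); rewrite expr2 [in X in _ <= X -> _]mulrC.
Qed.

Lemma M_prod k : M k = \prod_(i < k) quot i.
Proof.
elim: k => [|k IH]; first by rewrite big_ord0.
by rewrite big_ord_recr/= -IH /quot mulrC divfK// gt_eqF.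
Qed.

Lemma M_superM p q : M p * M q <= M (p + q).
Proof.
elim: q => [|q IH]; first by rewrite M_0 mulr1 addn0.
have E k : M k.+1 = M k * quot k by rewrite /quot mulrC divfK// gt_eqF.
rewrite addnS !E mulrA; apply: ler_pM => //.
- by rewrite mulr_ge0 ?ltW.
- exact/ltW/quot_gt0.
- by apply: quot_homo; exact: leq_addl.
Qed.

Lemma M_superM_prod (I : finType) (al : I -> nat) :
  \prod_i M (al i) <= M (\sum_i al i)%N.
Proof.
suff [] : 0 <= \prod_i M (al i) /\ \prod_i M (al i) <= M (\sum_i al i)%N.
  by [].
apply: (big_ind2 (fun x n => 0 <= x /\ x <= M n)) => [|x1 x2 y1 y2 [x10 x1x2] [y10 y1y2]|i _].
- by rewrite M_0.
- split; first exact: mulr_ge0.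
  by apply: le_trans (M_superM _ _); exact: ler_pM.
- by rewrite lexx ltW.
Qed.

(* The quotients of [halfM] are those of [M], each taken twice, so [halfM] is
   still non-quasianalytic; its associated function is twice that of [M]. *)
Definition halfM (k : nat) : R := \prod_(i < k) quot i./2.

Lemma halfM_gt0 k : 0 < halfM k.
Proof. by apply: prodr_gt0 => i _; exact: quot_gt0. Qed.

(** Take each quotient of [M] twice: [M p * M q] multiplies [p + q] of these numbers, and
    [halfM (p + q)] the [p + q] smallest. The induction peels the top quotient off the factor of
    larger index. *)
Lemma halfM_le p q : halfM (p + q) <= M p * M q.
Proof.
move: {2}(p + q)%N (erefl (p + q)%N) => k; elim: k p q => [|k IH] p q.
  move=> /eqP; rewrite addn_eq0 => /andP[/eqP-> /eqP->].
  by rewrite M_0 mulr1 addn0 /halfM big_ord0.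
wlog qp : p q / (q <= p)%N.
  move=> H; have [/H|/ltnW/H] := leqP q p; first exact.
  by rewrite addnC (mulrC (M q)); exact.
case: p qp => [|p] qp; first by rewrite add0n => q0; rewrite q0 in qp.
rewrite addSn => -[pqk]; have := IH _ _ pqk.
have E j : M j.+1 = M j * quot j by rewrite /quot mulrC divfK// gt_eqF.
rewrite E mulrAC {2}/halfM big_ord_recr/= -/(halfM _) => H.
apply: ler_pM => //.
- exact/ltW/halfM_gt0.
- exact/ltW/quot_gt0.
- apply: quot_homo; lia.
Qed.

Lemma halfM_le_M k : halfM k <= M k.
Proof. by have := halfM_le k 0; rewrite addn0 M_0 mulr1. Qed.

Hypothesis M_3' : (\sum_(1 <= p <oo) (M p.-1 / M p)%:E < +oo)%E.

Lemma quotV_summable : exists S, forall n, \sum_(i < n) (quot i)^-1 <= S.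
Proof.
have := M_3'; set s := (\sum_(1 <= p <oo) _)%E => s_fin.
have nn p : (0 <= (M p.-1 / M p)%:E)%E by rewrite lee_fin divr_ge0// ltW.
have s0 : (0 <= s)%E by exact: nneseries_ge0.
exists (fine s) => n; rewrite -lee_fin fineK ?ge0_fin_numE//.
rewrite -sumEFin /s.
have := @nneseries_lim_ge R (fun p => (M p.-1 / M p)%:E) xpredT 1%N n.+1
  (fun k _ _ => nn k).
apply: le_trans; rewrite big_add1/= big_mkord.
by apply: lee_sum => i _; rewrite /quot invf_div.
Qed.

Lemma quot_infty K : exists n0, forall i, (n0 <= i)%N -> K <= quot i.
Proof.
have [S HS] := quotV_summable.
pose n0 := Num.bound (`|S| * `|K|).
exists n0.+1 => i ni; rewrite leNgt; apply/negP => Ki.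
have K0 : 0 < K by exact: lt_trans (quot_gt0 _) Ki.
suff : S < \sum_(j < n0.+1) (quot j)^-1 by rewrite ltNge HS.
apply: (@lt_le_trans _ _ (n0.+1%:R / K)).
  rewrite ltr_pdivlMr//; apply: (@le_lt_trans _ _ (`|S| * `|K|)).
    by rewrite -normrM ler_norm.
  by apply: (lt_trans (archi_boundP _)) => //; rewrite ltr_nat.
have -> : n0.+1%:R / K = \sum_(j < n0.+1) K^-1.
  by rewrite sumr_const card_ord mulr_natl.
apply: ler_sum => j _; rewrite lef_pV2 ?posrE ?quot_gt0//.
apply: ltW; apply: le_lt_trans Ki; apply: quot_homo.
by apply: leq_trans ni; exact: ltnW.
Qed.

(** The quotients of [M] tend to infinity, so geometric growth stays below [M]; this puts the
    exponentials into [E_space]. *)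
Lemma pow_le_M t : 0 <= t -> exists2 B, 0 < B & forall k, t ^+ k <= B * M k.
Proof.
move=> t0; have [n0 Hn0] := quot_infty t.
have [B B0 HB] := @prod_bounded R (fun i => t / quot i) n0
  (fun i => divr_ge0 t0 (ltW (quot_gt0 i)))
  (fun i ni => ltac:(by rewrite ler_pdivrMr ?quot_gt0// mul1r Hn0)).
exists B => // k; move: (HB k).
rewrite big_split/= prodfV -M_prod prodr_const card_ord.
by rewrite ler_pdivrMr.
Qed.

(** The numbers [a i] are the lengths of the intervals over which the bump is averaged, and each
    derivative costs a factor [2 / a i]. Two steps are extra, so that the estimate of order [k]
    leaves room for two more derivatives. *)
Lemma bump_steps s : 0 < s -> exists a : nat -> R, [/\ forall i, 0 < a i,
  forall n, \sum_(i < n) a i <= s &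
  forall h, 0 < h -> exists2 B, 0 < B &
    forall k, \prod_(i < k.+2) (2 / a i) <= B * h ^+ k * halfM k].
Proof.
move=> s0; have [S HS] := quotV_summable.
have b0 i : 0 < (quot i./2)^-1 by rewrite invr_gt0 quot_gt0.
have bS n : \sum_(i < n) (quot i./2)^-1 <= 2 * S.
  have E k : \sum_(i < k.*2) (quot i./2)^-1 = 2 * \sum_(i < k) (quot i)^-1.
    elim: k => [|k IH]; first by rewrite !big_ord0 mulr0.
    by rewrite doubleS !big_ord_recr/= IH /= uphalf_double doubleK; ring.
  apply: (@le_trans _ _ (\sum_(i < n.*2) (quot i./2)^-1)).
    rewrite -addnn big_split_ord/= lerDl sumr_ge0// => i _; exact: ltW.
  by rewrite E ler_pM2l.
have [r [r0 [T HT] rK]] := slow_weights b0 bS.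
pose tau := s / 2 / (1 + `|T|).
have tau0 : 0 < tau by rewrite !divr_gt0// ltr_pwDl.
(* The budget [s] is split into [s / 4] for each extra step and [s / 2] for all others, which fixes
   [tau]. The number [2 / a i.+2] is [h * quot i./2] times [2 / (tau * r i * h)], and the latter is
   eventually at most 1. *)
pose a i := if i is i'.+2 then tau * ((quot i'./2)^-1 * r i') else s / 4.
exists a; split.
- case=> [|[|i]] /=; rewrite ?divr_gt0//.
  by rewrite mulr_gt0// mulr_gt0.
- have pos i : 0 < a i.
    case: i => [|[|i]] /=; rewrite ?divr_gt0//.
    by rewrite mulr_gt0// mulr_gt0.
  move=> n; apply: (@le_trans _ _ (\sum_(i < n.+2) a i)).
    rewrite 2!big_ord_recr/= -addrA lerDl.
    by apply: addr_ge0; apply: ltW; [exact: (pos n)|exact: (pos n.+1)].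
  rewrite 2!big_ord_recl/= -mulr_sumr.
  have : tau * \sum_(i < n) ((quot i./2)^-1 * r i) <= s / 2.
    rewrite /tau mulrAC ler_pdivrMr ?ltr_pwDl//.
    rewrite ler_pM2l ?divr_gt0//; apply: (le_trans (HT n)).
    by rewrite ler_wpDl// ler_norm.
  lra.
- move=> h h0.
  have [n0 Hn0] := rK (2 / (tau * h)).
  have [B B0 HB] := @prod_bounded R (fun i => 2 / (tau * r i * h)) n0
    (fun i => divr_ge0 (ler0n _ 2) (ltW (mulr_gt0 (mulr_gt0 tau0 (r0 i)) h0)))
    (fun i ni => ltac:(by rewrite ler_pdivrMr ?mulr_gt0// mul1r mulrAC mulrC
       -ler_pdivrMr ?mulr_gt0// Hn0)).
  exists ((8 / s) ^+ 2 * B) => [|k]; first by rewrite mulr_gt0// exprn_gt0// divr_gt0.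
  rewrite 2!big_ord_recl/=.
  have -> : \prod_(i < k) (2 / (tau * ((quot i./2)^-1 * r i))) =
      halfM k * h ^+ k * \prod_(i < k) (2 / (tau * r i * h)).
    rewrite /halfM -[X in h ^+ X](card_ord k) -prodr_const -!big_split/=.
    apply: eq_bigr => i _; field.
    by rewrite !gt_eqF ?quot_gt0.
  have -> : 2 / (s / 4) = 8 / s by field; rewrite gt_eqF.
  have := HB k; set P := \prod_(_ < _) _ => HP.
  rewrite (_ : 8 / s * _ = (8 / s) ^+ 2 * (halfM k * h ^+ k) * P); last by ring.
  rewrite (_ : _ * halfM k = (8 / s) ^+ 2 * (halfM k * h ^+ k) * B); last by ring.
  rewrite ler_pM2l//; apply: mulr_gt0; first by rewrite exprn_gt0 ?divr_gt0.
  by rewrite mulr_gt0 ?exprn_gt0 ?halfM_gt0.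
Qed.

End LogConvex.

(** * Compactly supported ultradifferentiable functions of one variable *)

Section RealDerivative.
Variable R : realType.
Implicit Types f g : R -> R.

Definition has_der f df := forall x : R, is_derive x 1 f (df x).

Lemma has_der_ext f g df dg :
  f =1 g -> df =1 dg -> has_der f df -> has_der g dg.
Proof. by move=> /funext <- /funext <-. Qed.

Lemma has_derD f g df dg : has_der f df -> has_der g dg ->
  has_der (fun x => f x + g x) (fun x => df x + dg x).
Proof. by move=> Hf Hg x; exact: is_deriveD. Qed.

Lemma has_derB f g df dg : has_der f df -> has_der g dg ->
  has_der (fun x => f x - g x) (fun x => df x - dg x).
Proof. by move=> Hf Hg x; exact: is_deriveB. Qed.

Lemma has_derM f g df dg : has_der f df -> has_der g dg ->
  has_der (fun x => f x * g x) (fun x => df x * g x + f x * dg x).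
Proof.
move=> Hf Hg x; apply: (@is_derive_eq _ _ _ (f * g)); first exact: is_deriveM.
by rewrite /GRing.scale/= addrC mulrC.
Qed.

Lemma has_derZ k f df : has_der f df -> has_der (fun x => k * f x) (fun x => k * df x).
Proof. by move=> Hf x; exact: is_deriveZ. Qed.

Lemma has_derC k : has_der (fun=> k) (fun=> 0).
Proof. by move=> x; exact: is_derive_cst. Qed.

Lemma has_der_id : has_der id (fun=> 1).
Proof. by move=> x; exact: is_derive_id. Qed.

Lemma has_der_comp f g df dg : has_der f df -> has_der g dg ->
  has_der (fun x => f (g x)) (fun x => dg x * df (g x)).
Proof.
move=> Hf Hg x; apply: (@is_derive_eq _ _ _ (f \o g)).
  by apply: is_derive1_comp; [exact: Hf|exact: Hg].
by rewrite /GRing.scale/= mulrC.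
Qed.

Lemma has_der_affine a b f df : has_der f df ->
  has_der (fun x => f (a * x + b)) (fun x => a * df (a * x + b)).
Proof.
move=> Hf; apply: (has_der_comp Hf).
apply: has_der_ext (has_derD (has_derZ a has_der_id) (has_derC b)) => //.
by move=> x /=; rewrite mulr1 addr0.
Qed.

Lemma has_der_shift a f df : has_der f df ->
  has_der (fun x => f (x + a)) (fun x => df (x + a)).
Proof.
move=> /(has_der_affine 1 a); apply: has_der_ext => x; by rewrite !mul1r.
Qed.

Lemma has_der_sum (I : Type) (r : seq I) (F dF : I -> R -> R) :
  (forall i, has_der (F i) (dF i)) ->
  has_der (fun x => \sum_(i <- r) F i x) (fun x => \sum_(i <- r) dF i x).
Proof.
move=> H; elim: r => [|i r IH].
  by apply: has_der_ext (has_derC 0) => x; rewrite big_nil.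
by apply: has_der_ext (has_derD (H i) IH) => x; rewrite big_cons.
Qed.

Lemma has_der_continuous f df : has_der f df -> continuous f.
Proof.
move=> H x; apply/differentiable_continuous/derivable1_diffP.
by case: (H x).
Qed.

Lemma has_der_mvt f df (a b : R) : has_der f df -> a <= b ->
  exists2 c, a <= c <= b & f b - f a = df c * (b - a).
Proof.
move=> H ab; have [] := @MVT_segment R f df a b ab.
- by move=> x _; exact: H.
- exact/continuous_subspaceT/has_der_continuous.
by move=> c; rewrite in_itv/= => cab E; exists c.
Qed.

Lemma has_der_bound f df (a b C : R) : has_der f df -> a <= b ->
  (forall x, a <= x <= b -> `|df x| <= C) -> `|f b - f a| <= C * (b - a).
Proof.
move=> H ab HC; have [c cab ->] := has_der_mvt H ab.
by rewrite normrM [X in _ * X]ger0_norm ?subr_ge0// ler_wpM2r ?subr_ge0// HC.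
Qed.

Lemma has_der_eq0 f df (A : set R) : open A -> has_der f df ->
  (forall x, A x -> f x = 0) -> forall x, A x -> df x = 0.
Proof.
move=> oA H A0 x Ax.
have Hx : is_derive x 1 f 0.
  apply: near_eq_is_derive (is_derive_cst 0 x 1).
  have : nbhs x A by exact: open_nbhs_nbhs.
  by apply: filterS => y /A0 ->.
by case: (H x) => _ <-; case: Hx.
Qed.

Lemma has_der_sin : has_der sin cos.
Proof. by move=> x; exact: is_derive_sin. Qed.

Lemma has_der_cos : has_der cos (fun x => - sin x).
Proof. by move=> x; exact: is_derive_cos. Qed.

(** The fundamental theorem of calculus gives a primitive on each interval from [- n] to [n].
    Normalized at 0 they agree on common intervals, and [N x] selects one that covers a
    neighbourhood of [x]. *)
Lemma primitive_exists f : continuous f -> exists F, has_der F f.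
Proof.
move=> cf; pose mu := @lebesgue_measure R.
pose F (n : nat) (x : R) : R := (\int[mu]_(t in `[(- n%:R)%R, x]) f t)%R.
have dF n (x : R) : - n%:R < x < n%:R -> is_derive x 1 (F n) (f x).
  move=> /andP[nx xn].
  have [] := @continuous_FTC1_closed R f (- n%:R) x n%:R xn _ nx (cf x).
    apply: continuous_compact_integrable; first exact: segment_compact.
    exact: continuous_subspaceT.
  by rewrite derive1E => ? ?; split.
have E n m (x : R) : (n <= m)%N -> - n%:R < x < n%:R -> F n x - F n 0 = F m x - F m 0.
  move=> nm xn.
  have sub (z : R) : - n%:R < z < n%:R -> - m%:R < z < m%:R.
    have : n%:R <= m%:R :> R by rewrite ler_nat.
    lra.
  have dG (z : R) : - n%:R < z < n%:R -> is_derive z 1 (F n - F m) 0.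
    by move=> zn; apply: is_derive_eq (is_deriveB (dF _ _ zn) (dF _ _ (sub _ zn))) (subrr _).
  have aux (a b : R) : a <= b -> - n%:R < a -> b < n%:R -> (F n - F m) b = (F n - F m) a.
    move=> ab na bn; apply/eqP; rewrite -subr_eq0.
    have [||c _ ->] := @MVT_segment R (F n - F m) (fun=> 0) a b ab.
    - move=> z; rewrite in_itv/= => zab; apply: dG; lra.
    - apply: derivable_within_continuous => z; rewrite in_itv/= => zab.
      have zn : - n%:R < z < n%:R by lra.
      by case: (dG _ zn).
    - by rewrite mul0r.
  have : (F n - F m) x = (F n - F m) 0.
    have [x0|x0] := leP 0 x; last have /ltW x0' := x0.
      by apply: aux => //; lra.
    by apply/esym; apply: aux => //; lra.
  by rewrite !fctE => ?; lra.
pose N (x : R) := (Num.bound `|x|).+1.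
have NP (x : R) : - (N x)%:R < x < (N x)%:R.
  have := archi_boundP (normr_ge0 x) => H.
  rewrite -ltr_norml; apply: (lt_trans H); by rewrite ltr_nat.
exists (fun x => F (N x) x - F (N x) 0) => x.
have := is_deriveB (dF _ _ (NP x)) (is_derive_cst (F (N x) 0) x 1).
rewrite subr0; apply: near_eq_is_derive.
have : nbhs x `](- (N x)%:R), (N x)%:R[%classic.
  by apply: near_in_itvoo; rewrite in_itv/=; exact: NP.
apply: filterS => y /=; rewrite in_itv/= => yN.
transitivity (F (N x) y - F (N x) 0); first by rewrite !fctE.
have [l|/ltnW l] := leqP (N x) (N y); first exact: E.
by apply/esym; apply: E => //; exact: NP.
Qed.

End RealDerivative.

(** * Iterated averages and their limit *)

Section Averages.
Variable R : realType.
Implicit Types u v : R -> R.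

(** Picked by choice, hence determined only up to a constant; only its increments are used. *)
Definition prim u : R -> R := xget (fun=> 0) [set U | has_der U u].

Lemma primP u : continuous u -> has_der (prim u) u.
Proof. by move=> /primitive_exists[U HU]; rewrite /prim; case: xgetP => // /(_ U). Qed.

Definition dquot (a : R) u : R -> R := fun y => (u (y + a) - u y) / a.

(* [mean a u y] is the average of [u] over the interval from [y] to [y + a]. *)
Definition mean (a : R) u : R -> R := dquot a (prim u).

Lemma has_der_dquot a u du : has_der u du -> has_der (dquot a u) (dquot a du).
Proof.
move=> H; have := has_derZ a^-1 (has_derB (has_der_shift a H) H).
by apply: has_der_ext => x; rewrite /dquot mulrC.
Qed.

Lemma has_der_mean a u : continuous u -> has_der (mean a u) (dquot a u).
Proof. by move=> /primP; exact: has_der_dquot. Qed.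

Lemma dquot_le a u C : 0 < a -> (forall y, `|u y| <= C) ->
  forall y, `|dquot a u y| <= 2 / a * C.
Proof.
move=> a0 HC y; rewrite /dquot normrM normfV (gtr0_norm a0) mulrAC ler_pM2r ?invr_gt0//.
by rewrite (le_trans (ler_normB _ _))// mulr_natl mulr2n lerD.
Qed.

(** The mean value theorem is applied to the difference of the two shifted primitives, so that one
    [c] serves both terms. Uniform bounds on [u - v] and Lipschitz bounds therefore pass to the
    averages. *)
Lemma mean_sub a u v y z : 0 < a -> continuous u -> continuous v ->
  exists2 c, 0 <= c <= a & mean a u y - mean a v z = u (y + c) - v (z + c).
Proof.
move=> a0 /primP Hu /primP Hv.
have H := has_derB (has_der_shift y Hu) (has_der_shift z Hv).
have [c c0a E] := has_der_mvt H (ltW a0).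
exists c => //; move: E; rewrite subr0 !add0r !(addrC c) => E.
have an0 : a != 0 by rewrite gt_eqF.
by apply: (mulIf an0); rewrite -E /mean /dquot !(addrC _ a); field.
Qed.

Lemma mean_val a u y : 0 < a -> continuous u ->
  exists2 c, 0 <= c <= a & mean a u y = u (y + c).
Proof.
move=> a0 /primP Hu.
have [c c0a E] := has_der_mvt (has_der_shift y Hu) (ltW a0).
exists c => //; move: E; rewrite subr0 !add0r !(addrC c) => E.
by rewrite /mean /dquot (addrC y a) E mulfK// gt_eqF.
Qed.

(** Both bounds survive averaging with the same [L], so all iterated averages stay in one class. *)
Definition tame (L : R) u :=
  (forall y, 0 <= u y <= 1) /\ forall y z, `|u y - u z| <= L * `|y - z|.

Lemma tame_continuous L u : 0 < L -> tame L u -> continuous u.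
Proof.
move=> L0 [_ HL] x; apply/cvgrPdist_lt => e e0.
near=> y; apply: (le_lt_trans (HL _ _)); rewrite -ltr_pdivlMl//.
near: y; apply: cvgr_dist_lt; first exact: cvg_id.
by rewrite mulr_gt0 ?invr_gt0.
Unshelve. all: by end_near. Qed.

Lemma tame_mean L a u : 0 < L -> 0 < a -> tame L u -> tame L (mean a u).
Proof.
move=> L0 a0 Hu; have cu := tame_continuous L0 Hu.
split=> [y|y z].
  by have [c _ ->] := mean_val y a0 cu; exact: Hu.1.
have [c _ ->] := mean_sub y z a0 cu cu.
by apply: le_trans (Hu.2 _ _) _; rewrite opprD addrACA subrr addr0.
Qed.

End Averages.

Section Limits.
Variable R : realType.

Lemma limit_of_increments (u b : nat -> R) (S : R) :
  (forall n, `|u n.+1 - u n| <= b n) -> (forall n, \sum_(i < n) b i <= S) ->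
  exists l, forall n, `|l - u n| <=
    sup [set x | exists n, x = \sum_(i < n) b i] - \sum_(i < n) b i.
Proof.
move=> ub bS; set A := [set x | _].
have b0 i : 0 <= b i by apply: le_trans (ub i); exact: normr_ge0.
have supA : has_sup A.
  split; first by exists (\sum_(i < 0) b i); exists 0%N.
  by exists S => _ [n ->].
pose rho n := sup A - \sum_(i < n) b i.
have rho0 n : 0 <= rho n.
  by rewrite subr_ge0; apply: ub_le_sup; [exact: supA.2|exists n].
have inc n m : (n <= m)%N -> `|u m - u n| <= rho n - rho m.
  move=> /subnKC <-; elim: (m - n)%N => [|k IH]; first by rewrite addn0 !subrr normr0.
  have := ler_normD (u (n + k.+1)%N - u (n + k)%N) (u (n + k)%N - u n).
  rewrite subrKA => /le_trans; apply.
  have := ub (n + k)%N; rewrite -addnS => H.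
  apply: (le_trans (lerD H IH)); rewrite /rho addnS big_ord_recr/=; lra.
(* Every [u n - rho n] lies below every [u m + rho m], so the supremum of the left ends belongs to
   all the intervals of radius [rho n] around [u n]. *)
pose L := [set x | exists n, x = u n - rho n].
have ubL m : ubound L (u m + rho m).
  move=> _ [n ->]; have [nm|/ltnW nm] := leqP n m.
    have := inc _ _ nm; rewrite ler_norml => /andP[? ?].
    have := rho0 m; lra.
  have := inc _ _ nm; rewrite ler_norml => /andP[? ?].
  have := rho0 n; lra.
exists (sup L) => n; rewrite ler_norml; apply/andP; split.
  rewrite lerBrDr addrC; apply: ub_le_sup; last by exists n.
  by exists (u 0%N + rho 0%N); exact: ubL.
rewrite lerBlDr addrC; apply: ge_sup => //.
by exists (u 0%N - rho 0%N); exists 0%N.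
Qed.

Lemma le_of_tails (b : nat -> R) (S C x : R) : (forall i, 0 <= b i) ->
  (forall n, \sum_(i < n) b i <= S) -> 0 <= C ->
  (forall n, x <= C * (sup [set x | exists n, x = \sum_(i < n) b i] - \sum_(i < n) b i)) ->
  x <= 0.
Proof.
move=> b0 bS C0; set A := [set x | _] => H.
have supA : has_sup A.
  split; first by exists (\sum_(i < 0) b i); exists 0%N.
  by exists S => _ [n ->].
apply/ler_addgt0Pr => e e0; rewrite add0r.
have d0 : 0 < e / (C + 1) by rewrite divr_gt0// ltr_wpDl.
have [_ [n ->] en] := sup_adherent d0 supA.
apply: (le_trans (H n)).
have : sup A - \sum_(i < n) b i <= e / (C + 1) by lra.
move=> /(ler_wpM2l C0) /le_trans; apply.
rewrite mulrA ler_pdivrMr ?ltr_wpDl//; nra.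
Qed.

End Limits.

Section InfiniteConvolution.
Variables (R : realType) (a : nat -> R) (s L : R) (g : R -> R).
Hypothesis a_gt0 : forall i, 0 < a i.
Hypothesis a_sum : forall n, \sum_(i < n) a i <= s.
Hypothesis L_gt0 : 0 < L.
Hypothesis g_tame : tame L g.

(** The average of length [a k] is outermost: peeling it off shifts [k], and in the limit this
    becomes [w k = mean (a k) (w k.+1)]. *)
Fixpoint iter_mean (k n : nat) : R -> R :=
  if n is n'.+1 then mean (a k) (iter_mean k.+1 n') else g.

Lemma iter_mean_tame k n : tame L (iter_mean k n).
Proof. by elim: n k => [|n IH] k //=; exact: tame_mean. Qed.

Let cont k n : continuous (iter_mean k n).
Proof. exact: tame_continuous (iter_mean_tame k n). Qed.

(** The additional average is the innermost one. It acts directly on [g], which it moves by at most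
    [L * a (k + n)], and the outer averages do not increase the difference. *)
Lemma iter_mean_step k n y :
  `|iter_mean k n.+1 y - iter_mean k n y| <= L * a (k + n).
Proof.
elim: n k y => [|n IH] k y; last first.
  rewrite -[in iter_mean _ _ y]/(mean (a k) (iter_mean k.+1 n.+1) y) /=.
  have [c _ ->] := mean_sub y y (a_gt0 k) (@cont k.+1 n.+1) (@cont k.+1 n).
  by rewrite addnS -addSn; exact: IH.
rewrite addn0 /=.
have [c /andP[c0 ca] ->] := mean_val y (a_gt0 k) (@cont k 0).
apply: (le_trans (g_tame.2 _ _)); rewrite addrAC subrr add0r ler_pM2l//.
by rewrite ger0_norm.
Qed.

Let a_sum_shift k n : \sum_(i < n) L * a (k + i)%N <= L * s.
Proof.
rewrite -mulr_sumr ler_pM2l//; apply: le_trans (a_sum (k + n)).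
by rewrite big_split_ord/= lerDr sumr_ge0// => i _; exact: ltW.
Qed.

Definition conv_tail k n :=
  sup [set x | exists n, x = \sum_(i < n) L * a (k + i)%N]
    - \sum_(i < n) L * a (k + i)%N.

Lemma inf_conv_exists : exists w : nat -> R -> R,
  forall k n y, `|w k y - iter_mean k n y| <= conv_tail k n.
Proof.
have /choice[w Hw] : forall ky : nat * R, exists l, forall n,
    `|l - iter_mean ky.1 n ky.2| <= conv_tail ky.1 n.
  move=> [k y]; apply: (@limit_of_increments R (fun n => iter_mean k n y)
    (fun n => L * a (k + n)%N) (L * s)) => n /=.
    exact: iter_mean_step.
  exact: a_sum_shift.
by exists (fun k y => w (k, y)) => k n y; exact: (Hw (k, y)).
Qed.

(** [w 0] is [g] convolved with normalized indicators of intervals of all the lengths [a i], and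
    [w k] omits the first [k] of them. The averages look to the right only, over a total length at
    most [s], whence the last clause. *)
Lemma bump_sequence : exists w : nat -> R -> R, [/\
  forall k, tame L (w k),
  forall k, has_der (w k) (dquot (a k) (w k.+1)) &
  forall k y c, (forall t, 0 <= t <= s -> g (y + t) = c) -> w k y = c].
Proof.
have [w Hw] := inf_conv_exists.
have tail0 k x C : 0 <= C -> (forall n, x <= C * conv_tail k n) -> x <= 0.
  move=> C0; apply: (@le_of_tails R (fun i => L * a (k + i)%N) (L * s)) => //.
  by move=> i; rewrite mulr_ge0 ?ltW.
have tame_w k : tame L (w k).
  have bd n y : iter_mean k n y - conv_tail k n <= w k y <= iter_mean k n y + conv_tail k n.
    by have := Hw k n y; rewrite ler_norml; lra.
  split=> [y|y z]; last first.
    rewrite -subr_le0; apply: (tail0 k _ 2) => // n.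
    rewrite lerBlDr ler_norml; have := (iter_mean_tame k n).2 y z.
    by rewrite ler_norml; have := bd n y; have := bd n z; lra.
  apply/andP; split.
    rewrite -oppr_le0; apply: (tail0 k _ 1) => // n; rewrite mul1r.
    have := (iter_mean_tame k n).1 y; have := bd n y; lra.
  rewrite -subr_le0; apply: (tail0 k _ 1) => // n; rewrite mul1r.
  have := (iter_mean_tame k n).1 y; have := bd n y; lra.
have cw k : continuous (w k) by exact: tame_continuous (tame_w k).
have tail_rec k n : conv_tail k.+1 n <= conv_tail k n.+1.
  rewrite /conv_tail big_ord_recl/= addn0.
  under [X in _ <= _ - (_ + X)]eq_bigr do rewrite /bump/= add1n addnS -addSn.
  rewrite opprD addrA lerD2r.
  apply: ge_sup; last first.
    move=> _ [m ->].
    have -> : \sum_(i < m) L * a (k.+1 + i)%N =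
      \sum_(i < m.+1) L * a (k + i)%N - L * a k.
      rewrite big_ord_recl/= addn0 addrC addKr.
      by apply: eq_bigr => i _; rewrite /bump/= add1n addnS -addSn.
    rewrite lerD2r; apply: ub_le_sup; last by exists m.+1.
    by exists (L * s) => _ [j ->]; exact: a_sum_shift.
  by exists (\sum_(i < 0) L * a (k.+1 + i)%N); exists 0%N.
(* The identity holds for the finite iterates by definition; each side differs from its iterate by a
   tail of the series, and the tails vanish as [n] grows. *)
have wE k : w k = mean (a k) (w k.+1).
  apply/funext => y; apply/eqP; rewrite -subr_eq0 -normr_le0.
  apply: (tail0 k _ 2) => // n.
  have [c _ E] := mean_sub y y (a_gt0 k) (@cont k.+1 n) (@cw k.+1).
  have H1 := Hw k n.+1 y; have H2 := Hw k.+1 n (y + c).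
  have H3 := tail_rec k n.
  have H4 : conv_tail k n.+1 <= conv_tail k n.
    by rewrite /conv_tail big_ord_recr/= opprD addrA gerBl mulr_ge0 ?ltW.
  rewrite distrC -E -/(iter_mean k n.+1) in H2.
  move: H1 H2; rewrite !ler_norml /=; lra.
exists w; split; first exact: tame_w.
- by move=> k; rewrite {1}wE; exact: has_der_mean.
- move=> k y c gc; apply/eqP; rewrite -subr_eq0 -normr_le0.
  apply: (tail0 k _ 1) => // n; rewrite mul1r.
  suff <- : iter_mean k n y = c by [].
  have : forall t, 0 <= t <= \sum_(i < n) a (k + i)%N -> g (y + t) = c.
    move=> t t0; apply: gc; apply/andP; split; first lra.
    have : \sum_(i < n) a (k + i)%N <= s.
      apply: le_trans (a_sum (k + n)).
      by rewrite big_split_ord/= lerDr sumr_ge0// => i _; exact: ltW.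
    lra.
  elim: n k y {gc} => [|n IH] k y gc /=.
    by rewrite -[y]addr0 gc// big_ord0 lexx.
  have [d /andP[d0 da] ->] := mean_val y (a_gt0 k) (@cont k.+1 n).
  apply: IH => t t0; rewrite -addrA; apply: gc.
  rewrite big_ord_recl/= addn0.
  under eq_bigr do rewrite /bump/= add1n addnS -addSn.
  lra.
Qed.

End InfiniteConvolution.

Section Bump.
Variables (R : realType) (M : nat -> R).
Hypothesis M_gt0 : forall p, 0 < M p.
Hypothesis M_3' : (\sum_(1 <= p <oo) (M p.-1 / M p)%:E < +oo)%E.

(** The trapezoid is 1 for [|y| <= s / 2] and 0 for [|y| >= 3 / 4 * s]. This leaves room for
    averages of total length [s / 8]. *)
Lemma trapezoid_tame (s : R) : 0 < s ->
  tame (4 / s) (fun y : R => Num.min 1 (Num.max 0 ((3 / 4 * s - `|y|) * (4 / s)))).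
Proof.
move=> s0; have s40 : 0 < 4 / s by rewrite divr_gt0.
have lip (x y : R) : `|Num.min 1 (Num.max 0 x) - Num.min 1 (Num.max 0 y)| <= `|x - y|.
  rewrite ler_norml /Num.min /Num.max; have := ler_norm (x - y).
  have := ler_norm (y - x); rewrite distrC.
  by do 4 case: ifP => [|/negbT]; rewrite -?leNgt; lra.
split=> [y|y z].
  rewrite /Num.min /Num.max; do 2 case: ifP => [|/negbT]; rewrite -?leNgt; lra.
apply: (le_trans (lip _ _)); rewrite -mulrBl normrM (gtr0_norm s40) mulrC.
rewrite ler_pM2l// opprD addrACA subrr add0r opprK addrC.
by rewrite -[`|y - z|]normrN opprB ler_dist_dist.
Qed.

(** The derivative of an average is a difference quotient, so the [k]-th derivative of [w 0] is a
    [k]-fold difference quotient of [w k]. Since [w k] is bounded by 1, only the factors [2 / a i]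
    remain. *)
Lemma bump_exists (s : R) : 0 < s -> exists psi : nat -> R -> R, [/\
  forall k, has_der (psi k) (psi k.+1),
  forall y, `|y| <= s / 4 -> psi 0%N y = 1,
  forall k y, s <= `|y| -> psi k y = 0 &
  forall h, 0 < h -> exists2 B, 0 < B & forall j k y, (j <= 2)%N ->
    `|psi (k + j)%N y| <= B * h ^+ k * halfM M k].
Proof.
move=> s0; pose s' := Num.min (s / 8) 1.
have s'0 : 0 < s' by rewrite lt_min divr_gt0//= ltr01.
have [a [a0 aS aM]] := bump_steps M_gt0 M_3' s'0.
have [w [w_tame w_der w_cst]] :=
  bump_sequence a0 aS (divr_gt0 (ltr0n _ 4) s0) (trapezoid_tame s0).
have w1 k y : `|w k y| <= 1.
  by have /andP[? ?] := (w_tame k).1 y; rewrite ger0_norm.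
pose fix D (k j : nat) (u : R -> R) {struct j} : R -> R :=
  if j is j'.+1 then dquot (a k) (D k.+1 j' u) else u.
have D_der j k u du : has_der u du -> has_der (D k j u) (D k j du).
  by move=> H; elim: j k => //= j IH k; exact: has_der_dquot.
have D_rec j k u : D k j (dquot (a (k + j)%N) u) = D k j.+1 u.
  elim: j k => [|j IH] k; first by rewrite addn0.
  by rewrite addnS -addSn /= IH.
have D_bound j k u : (forall y, `|u y| <= 1) ->
    forall y, `|D k j u y| <= \prod_(i < j) (2 / a (k + i)%N).
  move=> u1; elim: j k => [|j IH] k y; first by rewrite big_ord0; exact: u1.
  rewrite big_ord_recl addn0; apply: dquot_le => // z; apply: le_trans (IH _ _) _.
  by rewrite le_eqVlt; apply/orP; left; apply/eqP/eq_bigr => i _; rewrite /bump/= addSnnS.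
pose psi k := D 0%N k (w k).
have psi_der k : has_der (psi k) (psi k.+1).
  by rewrite /psi -D_rec; exact/D_der/w_der.
have s's8 : s' <= s / 8 by rewrite ge_min lexx.
exists psi; split => //.
- move=> y; rewrite ler_norml => ys.
  apply: w_cst => t ts; rewrite min_l// le_max; apply/orP; right.
  rewrite mulrA ler_pdivlMr//; have : `|y + t| <= 3 / 8 * s by rewrite ler_norml; lra.
  lra.
- move=> k y sy.
  (* The set with [15 / 16 * s] in place of [s] is open and contains all [y] with [|y| >= s]; on an
     open set vanishing passes from [psi k] to its derivative. *)
  have : [set z : R | 15 / 16 * s < `|z|] y by rewrite /=; lra.
  elim: k y {sy} => [|k IH] y; last first.
    apply: (has_der_eq0 _ (psi_der k) IH).
    apply: (@open_comp _ _ (fun z : R => `|z|) [set z | 15 / 16 * s < z]);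
      last exact: open_gt.
    by move=> x _; exact: norm_continuous.
  move=> /= sy; apply: w_cst => t ts.
  have H : (3 / 4 * s - `|y + t|) * (4 / s) <= 0.
    apply: mulr_le0_ge0; last by rewrite divr_ge0// ltW.
    rewrite subr_le0; have : `|y| <= `|y + t| + `|t|.
      by rewrite -[X in `|X| <= _](addrK t) ler_normB.
    by rewrite (ger0_norm (x := t)); lra.
  by rewrite max_l// min_r.
- move=> h h0; have [B B0 HB] := aM h h0; exists B => // j k y j2.
  apply: le_trans (HB k); apply: (le_trans (D_bound _ _ _ (w1 _) _)).
  (* The missing factors [2 / a i] are at least 1, because [s'] was capped at 1; hence one bound
     serves all [j <= 2]. *)
  have -> : k.+2 = (k + j + (2 - j))%N by lia.
  rewrite [leRHS]big_split_ord/= -[leLHS]mulr1 ler_wpM2l//.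
    by apply: prodr_ge0 => i _; rewrite divr_ge0// ltW.
  elim/big_rec : _ => // i x _ x1; apply: mulr_ege1 => //.
  rewrite ler_pdivlMr// mul1r.
  have a1 m : a m <= 1.
    apply: (@le_trans _ _ s'); last by rewrite ge_min lexx orbT.
    by apply: le_trans (aS m.+1); rewrite big_ord_recr/= lerDr sumr_ge0// => ? _; exact: ltW.
  by apply: (le_trans (a1 _)); rewrite ler1n.
Qed.

End Bump.

(** * Fourier series *)

Section SineBound.
Variable R : realType.
Implicit Types t x : R.

Lemma sin_ge_half x : 0 <= x <= 1 / 2 -> 3 / 4 * x <= sin x.
Proof.
move=> x01.
have sin_le (y : R) : 0 <= y -> sin y <= y.
  move=> y0; have H := has_derB (@has_der_id R) (@has_der_sin R).
  have [c _] := has_der_mvt H y0.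
  rewrite sin0 !subr0 => E; have := cos_le1 c.
  have : 0 <= (1 - cos c) * y by rewrite mulr_ge0// subr_ge0 cos_le1.
  lra.
have cos_ge (y : R) : 0 <= y <= 1 / 2 -> 3 / 4 <= cos y.
  move=> /andP[y0 y1]; have [c /andP[c0 cy]] := has_der_mvt (@has_der_cos R) y0.
  rewrite cos0 subr0 => E; have := sin_le _ c0; nra.
have [||c /andP[c0 cx]] := @has_der_mvt R sin cos 0 x.
- exact: has_der_sin.
- lra.
- rewrite sin0 !subr0 => ->; rewrite ler_wpM2r//; first lra.
  by apply: cos_ge; lra.
Qed.

(** The range is [5 / 8 = 1 / 2 + 1 / 8] because it will be used for [t = z - y] with [z] in a
    period around 0 and [y] in the support of the bump. *)
Lemma sin_pi_lb t : `|t| <= 5 / 8 -> `|t| / 2 <= `|sin (pi * t)|.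
Proof.
wlog t0 : t / 0 <= t.
  move=> H; have [t0|/ltW t0] := leP 0 t; first exact: H.
  by rewrite -normrN => /H; rewrite mulrN sinN !normrN oppr_ge0; exact.
rewrite (ger0_norm t0) => t58.
have pi2 : 2 <= pi :> R := pi_ge2 R.
have far x : 1 / 2 <= x <= pi / 2 -> 3 / 8 <= sin x.
  move=> x12; apply: (@le_trans _ _ (sin (1 / 2))).
    by have := @sin_ge_half (1 / 2); lra.
  by rewrite leNgt ltr_sin ?in_itv/= -?leNgt; lra.
apply: (le_trans _ (ler_norm _)).
have [h|h] := leP (pi * t) (1 / 2).
  by have := @sin_ge_half (pi * t); have : 0 <= pi * t; nra.
have [h2|h2] := leP (pi * t) (pi / 2).
  by have := far (pi * t); lra.
have -> : sin (pi * t) = sin (pi - pi * t) by rewrite sinB sinpi cospi; lra.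
have := far (pi - pi * t); nra.
Qed.

End SineBound.

(** * The Dirichlet kernel *)

Section DirichletKernel.
Variable R : realType.
Implicit Types (N : nat) (t x y z : R) (u du w dw : R -> R).

Definition freq N (n : 'I_N.*2.+1) : R := n%:R - N%:R.

Lemma freq_rev N (n : 'I_N.*2.+1) : freq (rev_ord n) = - freq n.
Proof.
have nN : (n <= N.*2)%N by rewrite -ltnS.
rewrite /freq /= subSS (natrB _ nN) -[in (N.*2)%:R]addnn natrD; ring.
Qed.

Lemma sum_sin_freq N t : \sum_(n < N.*2.+1) sin (2 * pi * freq n * t) = 0.
Proof.
set S := LHS; suff : S = - S by lra.
rewrite {1}/S (reindex_inj rev_ord_inj)/= -sumrN.
by apply: eq_bigr => n _; rewrite freq_rev -sinN; congr sin; ring.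
Qed.

Definition dirichlet N t : R := \sum_(n < N.*2.+1) cos (2 * pi * freq n * t).

Lemma sum_cos_freq N s t :
  \sum_(n < N.*2.+1) cos (2 * pi * (s + freq n) * t) =
  cos (2 * pi * s * t) * dirichlet N t.
Proof.
under eq_bigr do rewrite mulrDr mulrDl cosD.
by rewrite big_split/= sumrN -!mulr_sumr sum_sin_freq mulr0 subr0.
Qed.

Lemma sum_sin_shift N s t :
  \sum_(n < N.*2.+1) sin (2 * pi * (s + freq n) * t) =
  sin (2 * pi * s * t) * dirichlet N t.
Proof.
under eq_bigr do rewrite mulrDr mulrDl sinD.
by rewrite big_split/= -!mulr_sumr sum_sin_freq mulr0 addr0.
Qed.

Lemma dirichletE N t : sin (pi * t) * dirichlet N t = sin (N.*2.+1%:R * pi * t).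
Proof.
have tel m : sin (pi * t) * (\sum_(n < m) cos (2 * pi * (n%:R - N%:R) * t)) * 2 =
    sin (2 * pi * (m%:R - N%:R) * t - pi * t) + sin (2 * pi * N%:R * t + pi * t).
  elim: m => [|m IH].
    rewrite big_ord0 mulr0 mul0r sub0r.
    have -> : 2 * pi * - N%:R * t - pi * t = - (2 * pi * N%:R * t + pi * t) by ring.
    by rewrite sinN addNr.
  rewrite big_ord_recr/=.
  set A := (X in sin _ * (X + _) * 2); set B := cos _.
  rewrite (_ : sin _ * _ * _ = sin (pi * t) * A * 2 + sin (pi * t) * B * 2); last by ring.
  rewrite IH /B.
  have -> : 2 * pi * (m.+1%:R - N%:R) * t - pi * t =
    2 * pi * (m%:R - N%:R) * t + pi * t by rewrite -natr1; ring.
  set X := 2 * pi * (m%:R - N%:R) * t.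
  rewrite (sinB X) (sinD X); ring.
have E : N.*2.+1%:R = 2 * N%:R + 1 :> R by rewrite -natr1 -muln2 natrM mulrC.
have := tel N.*2.+1; rewrite -/(dirichlet N t).
have -> : 2 * pi * (N.*2.+1%:R - N%:R) * t - pi * t = N.*2.+1%:R * pi * t.
  by rewrite E; ring.
have -> : 2 * pi * N%:R * t + pi * t = N.*2.+1%:R * pi * t.
  by rewrite E; ring.
lra.
Qed.

Lemma dirichlet_abs N t : `|sin (pi * t)| * `|dirichlet N t| <= 1.
Proof. by rewrite -normrM dirichletE sin_max. Qed.

Lemma has_der_cos_lin c d : has_der (fun y => cos (c * y + d)) (fun y => c * - sin (c * y + d)).
Proof. exact: (has_der_affine c d (@has_der_cos R)). Qed.

Lemma has_der_sin_lin c d : has_der (fun y => sin (c * y + d)) (fun y => c * cos (c * y + d)).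
Proof. exact: (has_der_affine c d (@has_der_sin R)). Qed.

Lemma sin_nat_pi (n : nat) : sin (n%:R * pi) = 0 :> R.
Proof.
elim: n => [|n IH]; first by rewrite mul0r sin0.
by rewrite -natr1 mulrDl mul1r sinD IH sinpi; ring.
Qed.

Lemma sin_freq_pi N (n : 'I_N.*2.+1) : sin (pi * freq n) = 0.
Proof.
by rewrite /freq mulrBr sinB ![pi * _]mulrC !sin_nat_pi; ring.
Qed.

(** The primitive is explicit. Over a period of length 1 only the zero frequency contributes, so the
    kernel has mass 1. *)
Lemma dirichlet_primitive N z : exists P, has_der P (fun y => dirichlet N (z - y)) /\
  P (z + 1 / 2) - P (z - 1 / 2) = 1.
Proof.
pose p (n : 'I_N.*2.+1) y : R := if n == N :> nat then y
  else - (2 * pi * freq n)^-1 * sin (2 * pi * freq n * (z - y)).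
have fn0 (n : 'I_N.*2.+1) : n != N :> nat -> 2 * pi * freq n != 0 :> R.
  move=> nN; apply: mulf_neq0; first by rewrite gt_eqF// mulr_gt0// pi_gt0.
  by rewrite /freq subr_eq0 eqr_nat.
exists (fun y => \sum_n p n y); split.
  apply: has_der_sum => n; rewrite /p; case: eqVneq => [nN|/fn0 nN].
    apply: has_der_ext (@has_der_id R) => // y.
    by rewrite /freq nN subrr mulr0 mul0r cos0.
  have := has_derZ (- (2 * pi * freq n)^-1)
    (has_der_sin_lin (- (2 * pi * freq n)) (2 * pi * freq n * z)).
  apply: has_der_ext => y /=.
    by congr (_ * sin _); ring.
  by rewrite mulrA mulrNN mulVf// mul1r; congr cos; ring.
have NN : (N < N.*2.+1)%N by rewrite ltnS -addnn leq_addr.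
rewrite -sumrB (bigD1 (Ordinal NN))//= big1 => [|n nN].
  by rewrite addr0 /p/= eqxx; lra.
have {}nN : (n == N :> nat) = false by apply: contraNF nN => /eqP nN; apply/eqP/val_inj.
rewrite /p nN; apply/eqP; rewrite subr_eq0; apply/eqP; congr (_ * _).
have -> : 2 * pi * freq n * (z - (z + 1 / 2)) = - (pi * freq n) by field.
have -> : 2 * pi * freq n * (z - (z - 1 / 2)) = pi * freq n by field.
by rewrite sinN sin_freq_pi oppr0.
Qed.

(** Away from the zeros of the denominator of the kernel, an integration by parts of the oscillating
    sine gains the factor [1 / N.*2.+1]. The constant depends on [C] and [s] only, so it is uniform
    in [z], in [v] and in the interval. *)
Lemma dirichlet_outer (C s : R) : 0 < s -> 0 <= C -> exists2 D, 0 <= D &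
  forall N z (v dv V : R -> R) (a b : R), a <= b -> b - a <= 1 ->
  has_der v dv -> has_der V (fun y => v y * dirichlet N (z - y)) ->
  (forall y, `|v y| <= C) -> (forall y, `|dv y| <= C) ->
  (forall y, a <= y <= b -> s <= `|sin (pi * (z - y))|) ->
  `|V b - V a| <= D / N.*2.+1%:R.
Proof.
move=> s0 C0; pose D := (C / s + C / s) + (C / s + C * pi / s ^+ 2).
have pi0 := pi_gt0 R.
have Cs0 : 0 <= C / s by rewrite divr_ge0// ltW.
have D0 : 0 <= D.
  by rewrite /D !addr_ge0// divr_ge0 ?exprn_ge0 ?mulr_ge0// ltW.
exists D => // N z v dv V a b ab ba1 Hv HV vC dvC sins.
pose l : R := N.*2.+1%:R.
have l0 : 0 < l by rewrite ltr0n.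
have lpi0 : 0 < l * pi by exact: mulr_gt0.
pose S y := sin (pi * (z - y)).
pose dS y := - pi * cos (pi * (z - y)).
have HS : has_der S dS.
  apply: has_der_ext (has_der_sin_lin (- pi) (pi * z)) => y; rewrite /S /dS.
    by congr sin; ring.
  by congr (_ * cos _); ring.
pose K y := cos (l * pi * (z - y)).
pose dK y := l * pi * sin (l * pi * (z - y)).
have HK : has_der K dK.
  apply: has_der_ext (has_der_cos_lin (- (l * pi)) (l * pi * z)) => y; rewrite /K /dK.
    by congr cos; ring.
  by rewrite mulrNN; congr (_ * sin _); ring.
pose vK y := v y * K y.
have HvK : has_der vK (fun y => dv y * K y + v y * dK y) by exact: has_derM.
have S0 y : a <= y <= b -> S y != 0.
  by move=> /sins h; rewrite -normr_gt0; exact: lt_le_trans h.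
(* The boundary term of the integration by parts: its derivative contains the product
   [v y * dirichlet N (z - y)], so [V - H] is left with the derivative [dW], which is of order
   [1 / l]. *)
pose H := fun y => (l * pi)^-1 * (vK y * (S y)^-1).
pose dW y := - (l * pi)^-1 * (dv y * K y / S y - v y * K y * dS y / S y ^+ 2).
have HH y : a <= y <= b -> is_derive y 1 (fun y => V y - H y) (dW y).
  move=> yab; have Sy := S0 _ yab.
  have i1 := is_deriveV Sy (HS y).
  have i2 := is_deriveM (HvK y) i1.
  have i3 := is_deriveZ (l * pi)^-1 i2.
  have i4 : is_derive y 1 (fun y => V y - H y) _ := is_deriveB (HV y) i3.
  apply: (is_derive_eq i4).
  have E : dirichlet N (z - y) = sin (l * pi * (z - y)) / S y.
    by apply: (mulfI Sy); rewrite dirichletE mulrCA divff// mulr1.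
  rewrite E /GRing.scale/= /vK /dK /dW.
  have [ln pn] : l != 0 /\ pi != 0 :> R by rewrite !gt_eqF.
  move: ln pn Sy; move: (S y) (K y) (dS y) (sin (l * pi * (z - y))) (l) (pi) => s1 k1 d1 x1 l1 p1 *.
  by field; apply/and3P.
have [c cab E] : exists2 c, c \in `[a, b]%R &
    V b - H b - (V a - H a) = dW c * (b - a).
  apply: (@MVT_segment R (fun y => V y - H y) dW a b ab).
    by move=> y; rewrite in_itv/= => yab; apply: HH; lra.
  apply: derivable_within_continuous => y; rewrite in_itv/= => yab.
  by case: (HH y yab).
move: cab; rewrite in_itv/= => cab.
have K1 y : `|K y| <= 1 by exact: cos_max.
have Sinv y : a <= y <= b -> `|(S y)^-1| <= s^-1.
  by move=> yab; rewrite normfV lef_pV2 ?posrE ?normr_gt0 ?S0// sins.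
have si0 : 0 <= s^-1 by rewrite invr_ge0 ltW.
have Hb y : a <= y <= b -> `|H y| <= (C / s) / (l * pi).
  move=> yab; rewrite /H /vK 3!normrM (gtr0_norm (x := (l * pi)^-1)) ?invr_gt0//.
  rewrite mulrC ler_pM2r ?invr_gt0//.
  apply: ler_pM => //; last exact: Sinv.
  rewrite -[leRHS]mulr1; exact: ler_pM.
have Hd : `|V b - H b - (V a - H a)| <= (C / s + C * pi / s ^+ 2) / (l * pi).
  rewrite E /dW normrM -[leRHS]mulr1; apply: ler_pM => //; last first.
    by rewrite ger0_norm ?subr_ge0.
  rewrite normrM normrN (gtr0_norm (x := (l * pi)^-1)) ?invr_gt0//.
  rewrite mulrC ler_pM2r ?invr_gt0//.
  apply: (le_trans (ler_normB _ _)); apply: lerD.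
    rewrite 2!normrM; apply: ler_pM => //; last exact: Sinv.
    rewrite -[leRHS]mulr1; exact: ler_pM.
  rewrite normrM; apply: ler_pM => //; last first.
    by rewrite -!exprVn normrX; apply: lerXn2r; rewrite ?nnegrE//; exact: Sinv.
  rewrite 2!normrM; apply: ler_pM => //.
    rewrite -[leRHS]mulr1; exact: ler_pM.
  rewrite /dS normrM normrN (gtr0_norm pi0) -[leRHS]mulr1 ler_pM2l//.
  exact: cos_max.
have {}Hd : `|V b - V a| <= D / (l * pi).
  have hb : `|H b| <= _ := Hb b ltac:(lra).
  have ha : `|H a| <= _ := Hb a ltac:(lra).
  have -> : D / (l * pi) = C / s / (l * pi) + C / s / (l * pi) +
    (C / s + C * pi / s ^+ 2) / (l * pi) by rewrite /D !mulrDl.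
  move: Hd ha hb; rewrite !ler_norml.
  move: (C / s / (l * pi)) ((C / s + _) / _) => T1 T2; lra.
apply: (le_trans Hd); rewrite ler_wpM2l// lef_pV2 ?posrE//.
rewrite -[leLHS]mulr1 ler_pM2l//; have := pi_ge2 R; lra.
Qed.

End DirichletKernel.

Arguments freq {R N} n.

Section DirichletConvergence.
Variable R : realType.
Implicit Types (w dw P : R -> R) (z : R).

Lemma has_der_cst_on P dP (a b : R) : has_der P dP -> a <= b ->
  (forall y, a <= y <= b -> dP y = 0) -> P b = P a.
Proof.
move=> HP ab H; apply/eqP; rewrite -subr_eq0 -normr_le0.
rewrite -(mul0r (b - a)); apply: has_der_bound HP ab _ => x /H ->.
by rewrite normr0.
Qed.

Lemma tail_small (D e : R) : 0 < e -> exists N0, forall N, (N0 <= N)%N ->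
  D / N.*2.+1%:R <= e.
Proof.
move=> e0; exists (Num.bound `|D / e|) => N NN.
rewrite ler_pdivrMr// mulrC -ler_pdivrMr//.
apply: (le_trans (ler_norm _)); apply: (le_trans (ltW (archi_boundP (normr_ge0 _)))).
by rewrite ler_nat (leq_trans NN)// -addnn ltnW// ltnS leq_addr.
Qed.

(** [P 1 - P (-1)] is the integral of [w] against the kernel centred at [z]. If [|z| > 1 / 4], the
    support of [w] stays away from [z] and only an outer term occurs. Otherwise the period around
    [z] covers the support, and the unit mass of the kernel isolates [w z]. *)
Lemma dirichlet_cvg w dw (B z e : R) : has_der w dw ->
  (forall y, `|w y| <= B) -> (forall y, `|dw y| <= B) ->
  (forall y, 1 / 8 <= `|y| -> w y = 0) -> `|z| <= 1 / 2 -> 0 < e ->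
  exists N0, forall N P, (N0 <= N)%N ->
  has_der P (fun y => w y * dirichlet N (z - y)) -> `|P 1 - P (-1) - w z| <= e.
Proof.
move=> Hw wB dwB w0 z12 e0.
have B0 : 0 <= B := le_trans (normr_ge0 _) (wB 0).
have w0' y : 1 / 8 <= y \/ y <= - (1 / 8) -> w y = 0.
  move=> h; apply: w0; case: h => h.
    by apply: le_trans (ler_norm _).
  by rewrite -normrN; apply: le_trans (ler_norm _); lra.
have cst P N a b : has_der P (fun y => w y * dirichlet N (z - y)) -> a <= b ->
    (1 / 8 <= a \/ b <= - (1 / 8)) -> P b = P a.
  move=> HP ab h; apply: (has_der_cst_on HP ab) => y yab.
  rewrite w0' ?mul0r//; lra.
have [z14|z14] := leP `|z| (1 / 4); last first.
  have [D D0 HD] := @dirichlet_outer R B (1 / 16) ltac:(lra) B0.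
  have [N0 HN0] := tail_small D e0.
  exists N0 => N P NN HP; apply: le_trans (HN0 N NN).
  rewrite (w0 z) ?subr0; last by lra.
  rewrite (cst P N (1 / 8) 1) ?(cst P N (-1) (- (1 / 8))) -?(cst P N (-1) (- (1 / 8)))//; try lra.
  apply: (HD N z w dw) => //; try lra.
  move=> y y18; apply: le_trans (sin_pi_lb _); last first.
    by move: z12; rewrite !ler_norml; lra.
  have : 1 / 4 - 1 / 8 <= `|z - y|; last lra.
  apply: le_trans (lerB_dist _ _).
  have : `|y| <= 1 / 8 by rewrite ler_norml; lra.
  lra.
(* Between [z - d] and [z + d] the integrand will be at most [2 * B]; this [d] makes the central
   part at most [4 * B * d <= e / 2]. *)
pose d := Num.min (1 / 2) (e / (8 * (B + 1))).
have d0 : 0 < d by rewrite lt_min !divr_gt0// mulr_gt0// ltr_wpDl.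
have d12 : d <= 1 / 2 by rewrite ge_min lexx.
have de : 4 * B * d <= e / 2.
  have : d <= e / (8 * (B + 1)) by rewrite ge_min lexx orbT.
  rewrite ler_pdivlMr ?mulr_gt0 ?ltr_wpDl//; nra.
have B20 : 0 <= 2 * B by rewrite mulr_ge0.
have [D D0 HD] := @dirichlet_outer R (2 * B) (d / 2) ltac:(lra) B20.
have e40 : 0 < e / 4 by lra.
have [N0 HN0] := tail_small D e40.
exists N0 => N P NN HP.
have [KP [HKP KP1]] := dirichlet_primitive N z.
pose v y := w y - w z.
have Hv : has_der v dw.
  apply: has_der_ext (has_derB Hw (has_derC (w z))) => // y.
  by rewrite subr0.
pose Q y := P y - w z * KP y.
have HQ : has_der Q (fun y => v y * dirichlet N (z - y)).
  apply: has_der_ext (has_derB HP (has_derZ (w z) HKP)) => // y.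
  by rewrite /v mulrBl.
have vB y : `|v y| <= 2 * B.
  by rewrite (le_trans (ler_normB _ _))// mulr_natl mulr2n lerD.
have dvB y : `|dw y| <= 2 * B by apply: (le_trans (dwB y)); lra.
move: (z14); rewrite ler_norml => z14'.
have -> : P 1 - P (-1) - w z = (Q (z + 1 / 2) - Q (z + d)) + (Q (z + d) - Q (z - d))
    + (Q (z - d) - Q (z - 1 / 2)).
  rewrite (cst P N (z + 1 / 2) 1)// ?(cst P N (-1) (z - 1 / 2)) -?(cst P N (-1) (z - 1 / 2))//; try lra.
  by rewrite /Q; move: KP1; move: (KP _) (KP _) => k1 k2; nra.
have far y : d <= `|z - y| <= 1 / 2 -> d / 2 <= `|sin (pi * (z - y))|.
  by move=> h; apply: le_trans (sin_pi_lb _); lra.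
have h1 : `|Q (z + 1 / 2) - Q (z + d)| <= e / 4.
  apply: le_trans (HN0 N NN); apply: (HD N z v dw Q) => //; try lra.
  move=> y hy; apply: far; rewrite ler0_norm; lra.
have h2 : `|Q (z - d) - Q (z - 1 / 2)| <= e / 4.
  apply: le_trans (HN0 N NN); apply: (HD N z v dw Q) => //; try lra.
  move=> y hy; apply: far; rewrite ger0_norm; lra.
have h3 : `|Q (z + d) - Q (z - d)| <= e / 2.
  apply: le_trans de.
  rewrite (_ : 4 * B * d = 2 * B * (z + d - (z - d))); last by ring.
  apply: has_der_bound HQ _ _; first by lra.
  move=> y hy; rewrite normrM.
  (* The kernel is at most the inverse of [|sin (pi * (z - y))|], hence at most [2 / |z - y|]; the
     Lipschitz bound on [w] compensates this singularity. *)
  have : `|v y| <= B * `|z - y|.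
    have [yz|/ltW zy] := leP y z.
      rewrite distrC (ger0_norm (x := z - y)) ?subr_ge0//.
      exact: has_der_bound Hw yz (fun x _ => dwB x).
    rewrite (distrC z) (ger0_norm (x := y - z)) ?subr_ge0//.
    exact: has_der_bound Hw zy (fun x _ => dwB x).
  have h : `|z - y| <= 1 / 2 by rewrite ler_norml; lra.
  have s1 : `|z - y| / 2 <= `|sin (pi * (z - y))| by apply: sin_pi_lb; lra.
  have := dirichlet_abs N (z - y).
  have := normr_ge0 (dirichlet N (z - y)); have := normr_ge0 (z - y).
  move: s1; move: `|sin _| `|dirichlet _ _| `|z - y| `|v y| => s' k t v' s1 t0 k0 sk vt.
  have : t / 2 * k <= 1 by apply: le_trans sk; rewrite ler_wpM2r.
  have : v' * k <= B * t * k by rewrite ler_wpM2r.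
  have : B * (t / 2 * k) <= B * 1 -> B * t * k <= 2 * B by lra.
  move=> H1 H2 H3; apply: (le_trans H2); apply: H1; exact: ler_wpM2l.
apply: (le_trans (ler_normD _ _)).
have := ler_normD (Q (z + 1 / 2) - Q (z + d)) (Q (z + d) - Q (z - d)); lra.
Qed.

End DirichletConvergence.

Section ComplexModulus.
Variable R : realType.
Implicit Types (z : R[i]) (t : R).

Lemma cabs_ge0 z : 0 <= cabs z.
Proof. by case: z => a b; rewrite /cabs/= sqrtr_ge0. Qed.

Lemma cabsM z1 z2 : cabs (z1 * z2) = cabs z1 * cabs z2.
Proof. exact: Normc.normcM. Qed.

Lemma cabsD z1 z2 : cabs (z1 + z2) <= cabs z1 + cabs z2.
Proof. exact: le_normcD. Qed.

Lemma cabsN z : cabs (- z) = cabs z.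
Proof. exact: normcN. Qed.

Lemma cabs0 : cabs 0 = 0 :> R.
Proof. exact: Normc.normc0. Qed.

Lemma cabs1 : cabs 1 = 1 :> R.
Proof. exact: Normc.normc1. Qed.

Lemma cabs_prod (I : Type) (r : seq I) (F : I -> R[i]) :
  cabs (\prod_(i <- r) F i) = \prod_(i <- r) cabs (F i).
Proof.
elim: r => [|i r IH]; first by rewrite !big_nil cabs1.
by rewrite !big_cons cabsM IH.
Qed.

Lemma cabsX z n : cabs (z ^+ n) = cabs z ^+ n.
Proof. by elim: n => [|n IH]; rewrite ?expr0 ?cabs1// !exprS cabsM IH. Qed.

Lemma cabs_sum (I : Type) (r : seq I) (F : I -> R[i]) :
  cabs (\sum_(i <- r) F i) <= \sum_(i <- r) cabs (F i).
Proof.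
elim: r => [|i r IH]; first by rewrite !big_nil cabs0.
by rewrite !big_cons (le_trans (cabsD _ _))// lerD2l.
Qed.

Lemma cabsR t : cabs (Complex t 0) = `|t|.
Proof. by rewrite /cabs/= expr0n addr0 sqrtr_sqr. Qed.

Lemma cabs_im t : cabs (Complex 0 t) = `|t|.
Proof. by rewrite /cabs/= expr0n add0r sqrtr_sqr. Qed.

Lemma cabs_le_ReIm z : cabs z <= `|complex.Re z| + `|complex.Im z|.
Proof.
case: z => a b; have -> : Complex a b = Complex a 0 + Complex 0 b.
  by apply/eqP; rewrite eq_complex/= addr0 add0r !eqxx.
by apply: (le_trans (cabsD _ _)); rewrite cabsR cabs_im /= addr0 add0r.
Qed.

Definition cexp t : R[i] := Complex (cos (2 * pi * t)) (sin (2 * pi * t)).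

Lemma cexpD s t : cexp (s + t) = cexp s * cexp t.
Proof.
apply/eqP; rewrite eq_complex/= mulrDr cosD sinD; apply/andP; split; apply/eqP => //.
by rewrite addrC.
Qed.

Lemma cexp0 : cexp 0 = 1.
Proof. by apply/eqP; rewrite eq_complex/= mulr0 cos0 sin0 !eqxx. Qed.

Lemma cexp_sum (I : Type) (r : seq I) (F : I -> R) :
  cexp (\sum_(i <- r) F i) = \prod_(i <- r) cexp (F i).
Proof.
elim: r => [|i r IH]; first by rewrite !big_nil cexp0.
by rewrite !big_cons cexpD IH.
Qed.

Lemma cabs_cexp t : cabs (cexp t) = 1.
Proof. by rewrite /cabs/= cos2Dsin2 sqrtr1. Qed.

Lemma cexp_int (m : int) : cexp m%:~R = 1.
Proof.
have nat_case (n : nat) : cexp n%:R = 1.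
  elim: n => [|n IH]; first exact: cexp0.
  rewrite -natr1 cexpD IH mul1r; apply/eqP; rewrite eq_complex/= mulr1.
  by rewrite mulr_natl cos2pi sin2pi !eqxx.
case: m => n; first exact: nat_case.
have := cexpD (Negz n)%:~R n.+1%:R; rewrite (nat_case n.+1) mulr1 => <-.
by rewrite NegzE mulrNz addNr cexp0.
Qed.

End ComplexModulus.

Section FourierCoefficients.
Variables (R : realType) (psi : nat -> R -> R).
Hypothesis psi_der : forall k, has_der (psi k) (psi k.+1).
Hypothesis psi0 : forall k y, 1 / 8 <= `|y| -> psi k y = 0.
Hypothesis psi_bounded : forall k, exists C, forall y, `|psi k y| <= C.
Implicit Types (eta s z : R).

Definition integ (u : R -> R) : R := prim u 1 - prim u (-1).

Lemma integE u U : has_der U u -> integ u = U 1 - U (-1).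
Proof.
move=> HU; have Hp : has_der (prim u) u.
  by rewrite /prim; case: xgetP => // /(_ U).
have N11 : -1 <= 1 :> R by lra.
have E := has_der_cst_on (has_derB Hp HU) N11.
have {}E := E ltac:(by move=> y _; rewrite subrr); rewrite /integ; lra.
Qed.

Lemma continuous_psi_trig (f df : R -> R) k : has_der f df ->
  exists U, has_der U (fun y => psi k y * f y).
Proof.
move=> Hf; apply: primitive_exists.
exact: has_der_continuous (has_derM (psi_der k) Hf).
Qed.

Let cosl eta y := cos (2 * pi * eta * y).
Let sinl eta y := sin (2 * pi * eta * y).

Let has_der_cosl eta : has_der (cosl eta) (fun y => 2 * pi * eta * - sinl eta y).
Proof.
apply: has_der_ext (has_der_cos_lin (2 * pi * eta) 0) => y; by rewrite addr0.
Qed.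

Let has_der_sinl eta : has_der (sinl eta) (fun y => 2 * pi * eta * cosl eta y).
Proof.
apply: has_der_ext (has_der_sin_lin (2 * pi * eta) 0) => y; by rewrite addr0.
Qed.

(** The Fourier transform of [psi k] at [eta]; the interval from -1 to 1 contains the support. *)
Definition coef k eta : R[i] :=
  Complex (integ (fun y => psi k y * cos (2 * pi * eta * y)))
    (- integ (fun y => psi k y * sin (2 * pi * eta * y))).

Lemma coefS k eta : coef k.+1 eta = Complex 0 (2 * pi * eta) * coef k eta.
Proof.
have [C HC] := continuous_psi_trig k (has_der_cosl eta).
have [S HS] := continuous_psi_trig k (has_der_sinl eta).
have p1 : psi k 1 = 0 by apply: psi0; rewrite normr1; lra.
have pN1 : psi k (-1) = 0 by apply: psi0; rewrite normrN1; lra.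
rewrite /coef (integE HC) (integE HS).
have H1 : has_der (fun y => psi k y * cosl eta y + 2 * pi * eta * S y)
    (fun y => psi k.+1 y * cosl eta y).
  apply: has_der_ext (has_derD (has_derM (psi_der k) (has_der_cosl eta))
    (has_derZ (2 * pi * eta) HS)) => // y; ring.
have H2 : has_der (fun y => psi k y * sinl eta y - 2 * pi * eta * C y)
    (fun y => psi k.+1 y * sinl eta y).
  apply: has_der_ext (has_derB (has_derM (psi_der k) (has_der_sinl eta))
    (has_derZ (2 * pi * eta) HC)) => // y; ring.
rewrite (integE H1) (integE H2) p1 pN1.
apply/eqP; rewrite eq_complex/=; apply/andP; split; apply/eqP; ring.
Qed.

Lemma coefE k eta : coef k eta = Complex 0 (2 * pi * eta) ^+ k * coef 0%N eta.
Proof.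
elim: k => [|k IH]; first by rewrite expr0 mul1r.
by rewrite coefS IH exprS mulrA.
Qed.

Lemma coef_le k eta B : (forall y, `|psi k y| <= B) -> cabs (coef k eta) <= 4 * B.
Proof.
move=> HB; have B0 : 0 <= B := le_trans (normr_ge0 _) (HB 0).
have bd f df : has_der f df -> (forall y, `|f y| <= 1) ->
    `|integ (fun y => psi k y * f y)| <= 2 * B.
  move=> Hf f1; have [U HU] := continuous_psi_trig k Hf.
  rewrite (integE HU).
  have N11 : -1 <= 1 :> R by lra.
  have H := has_der_bound HU N11 (C := B); rewrite (_ : 2 * B = B * (1 - -1)); last by ring.
  apply: H => x _; rewrite normrM -[leRHS]mulr1; exact: ler_pM.
apply: (le_trans (cabs_le_ReIm _)) => /=; rewrite normrN.
have := bd _ _ (has_der_cosl eta) (fun y => cos_max _).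
have := bd _ _ (has_der_sinl eta) (fun y => sin_max _).
rewrite /cosl /sinl; lra.
Qed.

(** Each derivative multiplies the coefficient by [2 i pi eta]. The orders [k] and [k + 2] together
    supply the weight [1 + eta ^+ 2], which makes the later sums over lattice points bounded. *)
Lemma coef_weight eta (C : R) k : 0 <= C ->
  (forall j y, (j <= 2)%N -> `|psi (k + j)%N y| <= C) ->
  cabs (coef 0%N eta) * (1 + eta ^+ 2) * `|eta| ^+ k <= 8 * C.
Proof.
move=> C0 HC.
have pi2 := pi_ge2 R.
have h0 := coef_le eta (fun y => HC 0%N y isT).
have h2 := coef_le eta (fun y => HC 2 y isT).
move: h0 h2; rewrite addn0 (coefE k eta) (coefE (k + 2)%N eta) !cabsM !cabsX !cabs_im.
have e2 : `|eta| <= `|2 * pi * eta|.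
  rewrite normrM ler_peMl// ger0_norm; last by rewrite mulr_ge0// pi_ge0.
  lra.
have ek j : `|eta| ^+ j <= `|2 * pi * eta| ^+ j by apply: lerXn2r; rewrite ?nnegrE.
have c0 := cabs_ge0 (coef 0%N eta).
have h n : `|2 * pi * eta| ^+ n * cabs (coef 0%N eta) <= 4 * C ->
    cabs (coef 0%N eta) * `|eta| ^+ n <= 4 * C.
  by apply: le_trans; rewrite mulrC ler_wpM2r.
move=> /h h0 /h h2; rewrite mulrDr mulr1 mulrDl.
have -> : 8 * C = 4 * C + 4 * C by ring.
apply: lerD => //.
by rewrite -[eta ^+ 2]real_normK ?num_real// -mulrA -exprD addnC.
Qed.

(** A Fourier series with all frequencies moved by [s]. The offset will be the fractional part of a
    coordinate of [xi], so that subtracting these frequencies from [xi] leads to lattice points. *)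
Definition partial_sum N s k z : R[i] := \sum_(n < N.*2.+1)
  Complex 0 (2 * pi * (s + freq n)) ^+ k * coef 0%N (s + freq n)
    * cexp ((s + freq n) * z).

Lemma fourier_inversion s z e k : `|z| <= 1 / 2 -> 0 < e ->
  exists N0, forall N, (N0 <= N)%N ->
    cabs (Complex (psi k z) 0 - partial_sum N s k z) <= e.
Proof.
move=> z12 e0.
pose wc y := psi k y * cos (2 * pi * s * (z - y)).
pose ws y := psi k y * sin (2 * pi * s * (z - y)).
have Hc (t : R) : has_der (fun y => cos (2 * pi * t * (z - y)))
    (fun y => 2 * pi * t * sin (2 * pi * t * (z - y))).
  apply: has_der_ext (has_der_cos_lin (- (2 * pi * t)) (2 * pi * t * z)) => y.
    by congr cos; ring.
  by rewrite mulrNN; congr (_ * sin _); ring.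
have Hs (t : R) : has_der (fun y => sin (2 * pi * t * (z - y)))
    (fun y => - (2 * pi * t) * cos (2 * pi * t * (z - y))).
  apply: has_der_ext (has_der_sin_lin (- (2 * pi * t)) (2 * pi * t * z)) => y.
    by congr sin; ring.
  by congr (_ * cos _); ring.
have [C0 HC0] := psi_bounded k; have [C1 HC1] := psi_bounded k.+1.
have C00 : 0 <= C0 := le_trans (normr_ge0 _) (HC0 0).
have C10 : 0 <= C1 := le_trans (normr_ge0 _) (HC1 0).
pose B := C0 + C1 + `|2 * pi * s| * C0.
have s0 : 0 <= `|2 * pi * s| * C0 by rewrite mulr_ge0.
have le1 (a b c : R) : `|a| <= c -> `|b| <= 1 -> `|a * b| <= c.
  by move=> h1 h2; rewrite normrM -[leRHS]mulr1; apply: ler_pM.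
have bd f df : has_der f df -> (forall y, `|f y| <= 1) ->
   (forall y, `|df y| <= `|2 * pi * s|) -> forall e', 0 < e' ->
   exists N0, forall N P, (N0 <= N)%N ->
   has_der P (fun y => psi k y * f y * dirichlet N (z - y)) ->
   `|P 1 - P (-1) - psi k z * f z| <= e'.
  move=> Hf f1 df1 e' e'0; apply: (dirichlet_cvg (B := B) (has_derM (psi_der k) Hf)) => //.
  - by move=> y; apply: (@le_trans _ _ C0); [exact: le1|rewrite /B; lra].
  - move=> y; apply: (le_trans (ler_normD _ _)).
    have : `|psi k.+1 y * f y| <= C1 by exact: le1.
    have : `|psi k y * df y| <= `|2 * pi * s| * C0.
      by rewrite normrM mulrC ler_pM.
    rewrite /B; lra.
  - by move=> y /(psi0 k) ->; rewrite mul0r.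
have e2 : 0 < e / 2 by lra.
(* Summing the terms produces the kernel times the cosine or sine of [2 * pi * s * (z - y)]. At
   [y = z] these are 1 and 0, so the real and imaginary parts tend to [psi k z] and 0. *)
have [Nc HNc] := bd _ _ (Hc s) (fun y => cos_max _)
  (fun y => le1 _ _ _ (lexx _) (sin_max _)) _ e2.
have Nle : `|- (2 * pi * s)| <= `|2 * pi * s| by rewrite normrN.
have [Ns HNs] := bd _ _ (Hs s) (fun y => sin_max _)
  (fun y => le1 _ _ _ Nle (cos_max _)) _ e2.
exists (maxn Nc Ns) => N; rewrite geq_max => /andP[/HNc{}HNc /HNs{}HNs].
have /choice[Pc HPc] (n : 'I_N.*2.+1) :=
  continuous_psi_trig k (Hc (s + @freq R N n)).
have /choice[Ps HPs] (n : 'I_N.*2.+1) :=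
  continuous_psi_trig k (Hs (s + @freq R N n)).
have term n : Complex 0 (2 * pi * (s + freq n)) ^+ k * coef 0%N (s + freq n)
    * cexp ((s + freq n) * z) =
    Complex (Pc n 1 - Pc n (-1)) (Ps n 1 - Ps n (-1)).
  rewrite -coefE -(integE (HPc n)) -(integE (HPs n)) /coef /cexp.
  have [C HC] := continuous_psi_trig k (has_der_cosl (s + freq n)).
  have [S HS] := continuous_psi_trig k (has_der_sinl (s + freq n)).
  rewrite (integE HC) (integE HS).
  set eta := s + freq n; set a := 2 * pi * (eta * z).
  have E y : 2 * pi * eta * (z - y) = a - 2 * pi * eta * y by rewrite /a; ring.
  have H1 : has_der (fun y => cos a * C y + sin a * S y)
      (fun y => psi k y * cos (2 * pi * eta * (z - y))).
    apply: has_der_ext (has_derD (has_derZ (cos a) HC) (has_derZ (sin a) HS)) => // y.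
    by rewrite E cosB /cosl /sinl -/eta; ring.
  have H2 : has_der (fun y => sin a * C y - cos a * S y)
      (fun y => psi k y * sin (2 * pi * eta * (z - y))).
    apply: has_der_ext (has_derB (has_derZ (sin a) HC) (has_derZ (cos a) HS)) => // y.
    by rewrite E sinB /cosl /sinl -/eta; ring.
  rewrite (integE H1) (integE H2).
  apply/eqP; rewrite eq_complex/=; apply/andP; split; apply/eqP; ring.
have -> : partial_sum N s k z =
    Complex (\sum_n (Pc n 1 - Pc n (-1))) (\sum_n (Ps n 1 - Ps n (-1))).
  rewrite /partial_sum; under eq_bigr do rewrite term.
  elim/big_rec3 : _ => [|n a b c _ ->] //.
rewrite !sumrB.
have H1 := HNc (fun y => \sum_n Pc n y).
have H2 := HNs (fun y => \sum_n Ps n y).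
move: H1 H2; rewrite subrr mulr0 cos0 sin0 mulr1 mulr0 subr0 => H1 H2.
apply: (le_trans (cabs_le_ReIm _)) => /=; rewrite sub0r normrN distrC.
have -> : e = e / 2 + e / 2 by lra.
apply: lerD.
- apply: H1; apply: has_der_ext (has_der_sum (index_enum _) HPc) => // y.
  by rewrite -mulr_sumr sum_cos_freq mulrA.
- apply: H2; apply: has_der_ext (has_der_sum (index_enum _) HPs) => // y.
  by rewrite -mulr_sumr sum_sin_shift mulrA.
Qed.

End FourierCoefficients.

Section WindowSums.
Variable R : realType.
Implicit Types (s : R) (N : nat).

Lemma window_rec (V : nmodType) (F : R -> V) N :
  \sum_(n < N.+1.*2.+1) F (freq n) =
  F (- N.+1%:R) + \sum_(n < N.*2.+1) F (freq n) + F N.+1%:R.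
Proof.
transitivity (\sum_(n < (N.*2).+3) F (n%:R - N.+1%:R)); first by [].
rewrite big_ord_recl big_ord_recr/= addrA; congr (_ + _ + _).
- by congr F; rewrite sub0r.
- apply: eq_bigr => n _; congr F; rewrite /freq /bump/= add1n.
  by rewrite -[n.+1%:R]natr1 -[N.+1%:R]natr1; ring.
- congr F; rewrite /bump/= add1n.
  rewrite -[(N.*2).+2%:R]natr1 -[(N.*2).+1%:R]natr1 -[in (N.*2)%:R]muln2 natrM.
  by rewrite -[N.+1%:R]natr1; ring.
Qed.

Definition window_weight s N : R := \sum_(n < N.*2.+1) (1 + (s + freq n) ^+ 2)^-1.

Let den0 (t : R) : 0 < 1 + t ^+ 2.
Proof. by rewrite ltr_wpDr// sqr_ge0. Qed.

Lemma window_weight_mono s N m : (N <= m)%N -> window_weight s N <= window_weight s m.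
Proof.
move=> /subnKC <-; elim: (m - N)%N => [|k IH]; first by rewrite addn0.
apply: (le_trans IH); rewrite addnS /window_weight (window_rec (fun x : R => (1 + (s + x) ^+ 2)^-1)).
by rewrite -addrA addrCA lerDl addr_ge0// invr_ge0 ltW.
Qed.

Lemma window_weight_le s N : 0 <= s <= 1 -> window_weight s N <= 20.
Proof.
(* The correction makes the induction telescope: the two terms added at [m = N.+1] contribute at
   most [16 * (m^-1 - (m + 1)^-1)]. *)
move=> s01; suff : window_weight s N <= 20 - 16 / N.+1%:R.
  by move=> /le_trans; apply; rewrite gerBl divr_ge0.
elim: N => [|N IH].
  rewrite /window_weight big_ord_recl big_ord0 addr0 /freq/= subrr addr0.
  have : (1 + s ^+ 2)^-1 <= 1 by rewrite invf_le1// lerDl sqr_ge0.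
  lra.
rewrite /window_weight (window_rec (fun x : R => (1 + (s + x) ^+ 2)^-1)) -/(window_weight s N).
set m : R := N.+1%:R.
have m1 : 1 <= m by rewrite ler1n.
have -> : N.+2%:R = m + 1 :> R by rewrite -natr1.
have lem t : 0 <= t -> (1 + m ^+ 2) / 4 <= 1 + t ^+ 2 ->
    (1 + t ^+ 2)^-1 <= 8 * (m^-1 - (m + 1)^-1).
  move=> t0 mt; have -> : 8 * (m^-1 - (m + 1)^-1) = (m * (m + 1) / 8)^-1.
    by field; rewrite !gt_eqF; lra.
  rewrite lef_pV2 ?posrE//; first by nra.
  rewrite divr_gt0// mulr_gt0; lra.
have h1 : (1 + (s + - m) ^+ 2)^-1 <= 8 * (m^-1 - (m + 1)^-1).
  have -> : (s + - m) ^+ 2 = (m - s) ^+ 2 by ring.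
  apply: lem; first lra.
  have : (m - 1) ^+ 2 <= (m - s) ^+ 2 by apply: lerXn2r; rewrite ?nnegrE; lra.
  have := sqr_ge0 (m - 4 / 3); rewrite !expr2; lra.
have h2 : (1 + (s + m) ^+ 2)^-1 <= 8 * (m^-1 - (m + 1)^-1).
  apply: lem; first lra.
  have : m ^+ 2 <= (s + m) ^+ 2 by apply: lerXn2r; rewrite ?nnegrE; lra.
  have := sqr_ge0 m; lra.
move: h1 h2 IH; rewrite -/m; set u := (1 + (s + - m) ^+ 2)^-1; set v := (1 + (s + m) ^+ 2)^-1.
by move: (m^-1) ((m + 1)^-1) u v (window_weight s N) => x y u v w; lra.
Qed.

Lemma window_weight_cauchy s e : 0 <= s <= 1 -> 0 < e -> exists N0, forall N m,
  (N0 <= N)%N -> (N <= m)%N -> window_weight s m - window_weight s N <= e.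
Proof.
move=> s01 e0; pose A := [set x | exists N, x = window_weight s N].
have supA : has_sup A.
  split; first by exists (window_weight s 0); exists 0%N.
  by exists 20 => _ [n ->]; exact: window_weight_le.
have [_ [N0 ->] H] := sup_adherent e0 supA.
exists N0 => N m N0N Nm.
have : window_weight s m <= sup A by apply: ub_le_sup; [exact: supA.2|exists m].
have := window_weight_mono s N0N; lra.
Qed.

End WindowSums.

Section BumpFourier.
Variables (R : realType) (M : nat -> R).
Hypothesis M_gt0 : forall p, 0 < M p.
Hypothesis M_3' : (\sum_(1 <= p <oo) (M p.-1 / M p)%:E < +oo)%E.

(* In the last clause [N0] is uniform in the order [k] of differentiation. *)
Lemma bump_fourier (r : R) : 0 < r -> r <= 1 / 8 ->
  exists (psi : nat -> R -> R) (c : R -> R[i]), [/\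
  forall k, has_der (psi k) (psi k.+1),
  forall y, `|y| <= r / 4 -> psi 0%N y = 1,
  forall k y, r <= `|y| -> psi k y = 0,
  forall h, 0 < h -> exists2 B, 0 < B &
    [/\ forall k y, `|psi k y| <= B * h ^+ k * halfM M k,
      forall k eta, cabs (c eta) * (1 + eta ^+ 2) * `|eta| ^+ k
        <= B * h ^+ k * halfM M k &
      forall k N s z, 0 <= s <= 1 ->
        cabs (\sum_(n < N.*2.+1) Complex 0 (2 * pi * (s + freq n)) ^+ k *
          c (s + freq n) * cexp ((s + freq n) * z)) <= B * h ^+ k * halfM M k] &
  forall h e s, 0 < h -> 0 < e -> 0 <= s <= 1 -> exists N0, forall N k z,
    (N0 <= N)%N -> `|z| <= 1 / 2 ->
    cabs (Complex (psi k z) 0 -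
      \sum_(n < N.*2.+1) Complex 0 (2 * pi * (s + freq n)) ^+ k *
          c (s + freq n) * cexp ((s + freq n) * z)) <= e * h ^+ k * halfM M k].
Proof.
move=> r0 r18; have [psi [psi_der psi1 psi0 psiB]] := bump_exists M_gt0 M_3' r0.
have psi0' k y : 1 / 8 <= `|y| -> psi k y = 0 by move=> h; apply: psi0; lra.
have psi_bounded k : exists C, forall y, `|psi k y| <= C.
  have [B _ HB] := psiB 1 ltr01; exists (B * 1 ^+ k * halfM M k) => y.
  by have := HB 0%N k y isT; rewrite addn0.
have pi0 := pi_gt0 R.
have Npos k : 0 < halfM M k := halfM_gt0 M_gt0 k.
pose c := coef psi 0.
have cW h : 0 < h -> exists2 B, 0 < B & forall k eta,
    cabs (c eta) * (1 + eta ^+ 2) * `|2 * pi * eta| ^+ k <= B * h ^+ k * halfM M k.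
  move=> h0; have tp0 : 0 < 2 * pi :> R by rewrite mulr_gt0.
  have hp0 : 0 < h / (2 * pi) by rewrite divr_gt0.
  have [B B0 HB] := psiB _ hp0; exists (8 * B) => [|k eta]; first by rewrite mulr_gt0.
  have := coef_weight psi_der psi0' eta (C := B * (h / (2 * pi)) ^+ k * halfM M k)
    (k := k) ltac:(by rewrite !mulr_ge0 ?exprn_ge0 ?ltW) (fun j y => HB j k y).
  move=> /(ler_wpM2l (exprn_ge0 k (ltW tp0))) H.
  rewrite normrM (gtr0_norm tp0) exprMn mulrCA; apply: (le_trans H).
  rewrite le_eqVlt; apply/orP; left; apply/eqP.
  rewrite expr_div_n; field; rewrite expf_neq0//; exact: lt0r_neq0.
have term k s (n : R) z B : cabs (c (s + n)) * (1 + (s + n) ^+ 2) * `|2 * pi * (s + n)| ^+ k <= B ->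
    cabs (Complex 0 (2 * pi * (s + n)) ^+ k * c (s + n) * cexp ((s + n) * z))
    <= B * (1 + (s + n) ^+ 2)^-1.
  move=> H; rewrite !cabsM cabs_cexp mulr1 cabsX cabs_im.
  rewrite ler_pdivlMr ?ltr_wpDr ?sqr_ge0//.
  by apply: le_trans H; rewrite -[leLHS]mulrA [leLHS]mulrC.
exists psi, c; split => //.
- move=> h h0; have [B1 B10 HB1] := psiB h h0; have [B2 B20 HB2] := cW h h0.
  have nn k : 0 <= h ^+ k * halfM M k by rewrite mulr_ge0 ?exprn_ge0 ?ltW.
  exists (B1 + 20 * B2) => [|]; first by rewrite addr_gt0// mulr_gt0.
  split.
  + move=> k y; have := HB1 0%N k y isT; rewrite addn0 => /le_trans; apply.
    by rewrite -!mulrA ler_wpM2r// lerDl mulr_ge0// ltW.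
  + move=> k eta; apply: (@le_trans _ _ (B2 * h ^+ k * halfM M k)).
      apply: le_trans (HB2 k eta); apply: ler_wpM2l.
        by rewrite mulr_ge0 ?cabs_ge0// addr_ge0// sqr_ge0.
      apply: lerXn2r; rewrite ?nnegrE// normrM ler_peMl// ger0_norm ?mulr_ge0 ?ltW//.
      have := pi_ge2 R; lra.
    rewrite -!mulrA ler_wpM2r//; lra.
  + move=> k N s z s01; apply: (le_trans (cabs_sum _ _)).
    apply: (@le_trans _ _ (B2 * h ^+ k * halfM M k * window_weight s N)).
      by rewrite mulr_sumr; apply: ler_sum => n _; exact: term.
    apply: (@le_trans _ _ (B2 * h ^+ k * halfM M k * 20)).
      apply: ler_wpM2l; last exact: window_weight_le.
      by rewrite -mulrA; apply: mulr_ge0; [exact: ltW|exact: nn].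
    rewrite (_ : _ * 20 = 20 * B2 * (h ^+ k * halfM M k)); last by ring.
    rewrite -[leRHS]mulrA ler_wpM2r//; lra.
- move=> h e s h0 e0 s01; have [B B0 HB] := cW h h0.
  have eB0 : 0 < e / (2 * B) by rewrite divr_gt0// mulr_gt0.
  have [N0 HN0] := window_weight_cauchy s01 eB0.
  exists N0 => N k z N0N z12.
  have hk0 : 0 < h ^+ k * halfM M k by rewrite mulr_gt0 ?exprn_gt0.
  have e20 : 0 < e / 2 * (h ^+ k * halfM M k) by rewrite mulr_gt0// divr_gt0.
  have [N1 HN1] := fourier_inversion psi_der psi0' psi_bounded s k z12 e20.
  (* Pointwise inversion yields an index [N1] depending on [k] and [z], so it is used only at the
     far index [m]. Between [N] and [m] the terms are dominated by the window weights, uniformly in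
     [k] and [z]. *)
  pose m := maxn N N1.
  have H1 := HN1 m (leq_maxr _ _).
  pose S j : R[i] := \sum_(n < j.*2.+1) Complex 0 (2 * pi * (s + freq n)) ^+ k *
          c (s + freq n) * cexp ((s + freq n) * z).
  have H2 j : (N <= j)%N -> cabs (S j - S N) <=
      B * (h ^+ k * halfM M k) * (window_weight s j - window_weight s N).
    move=> /subnKC <-; elim: (j - N)%N => [|i IH].
      by rewrite addn0 !subrr cabs0 mulr0.
    have -> : S (N + i.+1)%N - S N = S (N + i)%N - S N +
       (Complex 0 (2 * pi * (s + - (N + i).+1%:R)) ^+ k * c (s + - (N + i).+1%:R) *
          cexp ((s + - (N + i).+1%:R) * z) +
       Complex 0 (2 * pi * (s + (N + i).+1%:R)) ^+ k * c (s + (N + i).+1%:R) *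
          cexp ((s + (N + i).+1%:R) * z)).
      rewrite /S addnS (window_rec (fun x => Complex 0 (2 * pi * (s + x)) ^+ k *
          c (s + x) * cexp ((s + x) * z))); ring.
    apply: (le_trans (cabsD _ _)); apply: (le_trans (lerD IH (cabsD _ _))).
    apply: (le_trans (lerD (lexx _) (lerD (term _ _ _ _ _ (HB _ _)) (term _ _ _ _ _ (HB _ _))))).
    rewrite /window_weight addnS (window_rec (fun x : R => (1 + (s + x) ^+ 2)^-1)) -!/(window_weight _ _).
    rewrite le_eqVlt; apply/orP; left; apply/eqP; ring.
  have H3 : cabs (S m - S N) <= e / 2 * (h ^+ k * halfM M k).
    apply: (le_trans (H2 m (leq_maxl _ _))).
    apply: (@le_trans _ _ (B * (h ^+ k * halfM M k) * (e / (2 * B)))).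
      apply: ler_wpM2l; first by rewrite mulr_ge0 ?ltW.
      by apply: HN0 => //; exact: leq_maxl.
    rewrite le_eqVlt; apply/orP; left; apply/eqP; field; exact: lt0r_neq0.
  have -> : e * h ^+ k * halfM M k = e / 2 * (h ^+ k * halfM M k) +
     e / 2 * (h ^+ k * halfM M k) by field.
  rewrite -[X in cabs (_ - X)]/(S N).
  have -> : Complex (psi k z) 0 - S N = (Complex (psi k z) 0 - S m) + (S m - S N).
    by rewrite addrA subrK.
  apply: (le_trans (cabsD _ _)); exact: lerD.
Qed.

End BumpFourier.

(** * Lattices *)

Section RowNorm.
Variables (R : realType) (d : nat).
Implicit Types x v : 'rV[R]_d.

Lemma coord_le_norm x i : `|x 0 i| <= `|x|.
Proof.
have : `|x| <= `|x| by [].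
by rewrite {1}/Num.Def.normr/= mx_normrE => /bigmax_leP[_ H]; exact: (H (0, i) isT).
Qed.

Lemma norm_le_coord x c : 0 <= c -> (forall i, `|x 0 i| <= c) -> `|x| <= c.
Proof.
move=> c0 H; rewrite /Num.Def.normr/= mx_normrE.
by apply/bigmax_leP; split => // -[i j] _ /=; rewrite ord1.
Qed.

Definition opnorm (B : 'M[R]_d) : R := \sum_i \sum_j `|B i j|.

Lemma opnorm_ge0 B : 0 <= opnorm B.
Proof. by apply: sumr_ge0 => i _; apply: sumr_ge0. Qed.

Lemma norm_mulmx_le v (B : 'M[R]_d) : `|v *m B| <= opnorm B * `|v|.
Proof.
apply: norm_le_coord => [|j]; first by rewrite mulr_ge0 ?opnorm_ge0.
rewrite mxE; apply: (le_trans (ler_norm_sum _ _ _)).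
rewrite /opnorm mulr_suml; apply: ler_sum => i _.
rewrite normrM mulrC; apply: ler_pM => //; last exact: coord_le_norm.
by rewrite (bigD1 j)//= lerDl sumr_ge0.
Qed.

End RowNorm.

Section LatticeBasis.
Variables (R : realType) (d : nat) (L : set 'rV[R]_d).
Hypothesis HL : lattice L.

Let L0 : L 0. Proof. by case: HL. Qed.
Let LB x y : L x -> L y -> L (x - y). Proof. by case: HL => _ + _ _; exact. Qed.
Let LN x : L x -> L (- x). Proof. by move=> Lx; rewrite -sub0r; exact: LB. Qed.
Let LD x y : L x -> L y -> L (x + y).
Proof. by move=> Lx Ly; rewrite -[y]opprK; apply: LB => //; exact: LN. Qed.

Lemma lattice_mulz x (m : int) : L x -> L (m%:~R *: x).
Proof.
move=> Lx; have nat_case (n : nat) : L (n%:R *: x).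
  elim: n => [|n IH]; first by rewrite scale0r.
  by rewrite -natr1 scalerDl scale1r; exact: LD.
case: m => n; first exact: nat_case.
by rewrite NegzE mulrNz scaleNr; apply: LN; exact: nat_case.
Qed.

Lemma lattice_comb (n : 'rV[int]_d) (B : 'M[R]_d) :
  (forall i, L (row i B)) -> L (map_mx intr n *m B).
Proof.
move=> HB; rewrite mulmx_sum_row.
apply: (big_ind L) => // i _; rewrite mxE; exact: lattice_mulz.
Qed.

Lemma lattice_discrete : exists2 e : R, 0 < e & forall x, L x -> `|x| < e -> x = 0.
Proof.
case: HL => _ _ /(_ _ L0) [_ [V V0 VL]] _.
have /nbhs_ballP[e/= e0 He] := V0; exists e => // x Lx xe.
have : (V `&` L) x by split => //; apply: He; rewrite -ball_normE/= sub0r normrN.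
by rewrite VL.
Qed.

Lemma lattice_independent : exists2 B : 'M[R]_d, B \in unitmx & forall i, L (row i B).
Proof.
have Hspan i : exists s : seq 'rV[R]_d, (forall x, x \in s -> L x) /\
    delta_mx 0 i \in span s.
  by case: HL => _ _ _ /(_ (delta_mx 0 i))[s sL si]; exists s.
have [S HS] := choice Hspan.
pose s := flatten [seq S i | i <- enum 'I_d].
have sL x : x \in s -> L x.
  by move=> /flattenP[_ /mapP[i _ ->]] /(HS i).1.
pose A : 'M[R]_(size s, d) := \matrix_(k, j) (in_tuple s)`_k 0 j.
have rowA k : row k A = s`_k by apply/rowP => j; rewrite !mxE.
have fA : row_full A.
  rewrite -sub1mx; apply/row_subP => i; rewrite row1.
  have : delta_mx 0 i \in span (in_tuple s).
    have sub : {subset S i <= in_tuple s}.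
      move=> x xS; apply/flattenP; exists (S i) => //; apply/mapP; exists i => //.
      by rewrite mem_enum.
    by have /subvP/(_ _ (HS i).2) := sub_span sub.
  move=> /coord_span ->; apply: summx_sub => k _; apply: scalemx_sub.
  by rewrite -rowA; exact: row_sub.
exists (rowsub (fullrankfun fA) A); first exact: fullrowsub_unit.
move=> i; rewrite row_rowsub rowA; apply: sL; exact: mem_nth.
Qed.

Lemma lattice_finite_index (B : 'M[R]_d) : B \in unitmx -> (forall i, L (row i B)) ->
  exists2 q : nat, (0 < q)%N & forall v, L v ->
    exists n : 'rV[int]_d, q%:R *: v = map_mx intr n *m B.
Proof.
move=> uB LBr; have [e e0 He] := lattice_discrete.
(* With [Q] cells per coordinate, the difference of two multiples of [v] in the same cell is an
   integer combination of rows of [B] up to a lattice vector shorter than [e], hence up to 0. *)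
pose Q := (Num.bound `|(opnorm B + 1) / e|).+1.
have Qe : opnorm B * Q%:R^-1 < e.
  rewrite ltr_pdivrMr ?ltr0n// mulrC -ltr_pdivrMr//.
  apply: (@le_lt_trans _ _ ((opnorm B + 1) / e)).
    by rewrite ler_pM2r ?invr_gt0// lerDl.
  apply: (le_lt_trans (ler_norm _)); apply: (lt_trans (archi_boundP (normr_ge0 _))).
  by rewrite ltr_nat.
have Q0 : 0 < Q%:R :> R by rewrite ltr0n.
(* Dirichlet's pigeonhole argument for the multiples of [v] modulo the rows of [B]. *)
exists ((Q ^ d)`!) => [|v Lv]; first exact: fact_gt0.
pose t := v *m invmx B.
have vt : v = t *m B by rewrite /t mulmxKV.
clearbody t.
pose fr (x : R) := x - (Num.floor x)%:~R.
have fr01 x : 0 <= fr x < 1.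
  by have := floor_itv x; rewrite intrD /fr; lra.
pose cell (x : R) : nat := `|Num.floor (Q%:R * fr x)|%N.
have cellP x : (cell x)%:R <= Q%:R * fr x < (cell x)%:R + 1.
  have fge0 : (0 <= Num.floor (Q%:R * fr x))%R.
    by rewrite floor_ge0 mulr_ge0//; have := fr01 x; lra.
  have -> : (cell x)%:R = (Num.floor (Q%:R * fr x))%:~R :> R.
    by rewrite -[in RHS](gez0_abs fge0).
  by have := floor_itv (Q%:R * fr x); rewrite intrD.
have cellQ x : (cell x < Q)%N.
  rewrite -(ltr_nat R); have := cellP x; have := fr01 x; nra.
pose F (k : 'I_(Q ^ d).+1) : {ffun 'I_d -> 'I_Q} :=
  [ffun i => Ordinal (cellQ (k%:R * t 0 i))].
have /injectivePn[k [k' kk' FE]] : ~~ injectiveb F.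
  apply/negP => /injectiveP/leq_card.
  by rewrite card_ffun !card_ord ltnn.
wlog ltk : k k' kk' FE / (k < k')%N.
  move=> H; have [|lt|/val_inj E] := ltngtP k k'; first exact: H.
    by apply: (H k' k) => //; rewrite eq_sym.
  by rewrite E eqxx in kk'.
pose n : 'rV[int]_d := \row_i (Num.floor (k'%:R * t 0 i) - Num.floor (k%:R * t 0 i)).
pose w := (k' - k)%:R *: v - map_mx intr n *m B.
have w0 : w = 0.
  apply: He.
    apply: LB; last exact: lattice_comb.
    by rewrite -[(k' - k)%:R]/((k' - k)%N%:Z%:~R); exact: lattice_mulz.
  apply: le_lt_trans Qe.
  rewrite /w vt scalemxAl -mulmxBl; apply: (le_trans (norm_mulmx_le _ _)).
  apply: ler_wpM2l; first exact: opnorm_ge0.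
  apply: norm_le_coord => [|i]; first by rewrite invr_ge0 ltW.
  rewrite !mxE intrB natrB 1?ltnW//.
  have := congr1 (fun f : {ffun 'I_d -> 'I_Q} => val (f i)) FE.
  rewrite !ffunE/= => ce.
  have := cellP (k%:R * t 0 i); have := cellP (k'%:R * t 0 i); rewrite -ce.
  rewrite (_ : (k'%:R - k%:R) * t 0 i - _ = fr (k'%:R * t 0 i) - fr (k%:R * t 0 i)).
    2: by rewrite /fr; ring.
  move: (fr _) (fr _) (cell _)%:R => x y c h1 h2.
  rewrite -[Q%:R^-1]mul1r ler_pdivlMr// -[X in _ * X](gtr0_norm Q0) -normrM ler_norml; lra.
move/eqP: w0; rewrite subr_eq0 => /eqP w0.
(* The factorial is a multiple of every difference [k' - k] that can occur, hence a common
   denominator for all [v]. *)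
have [m Em] : exists m, (Q ^ d)`! = (m * (k' - k))%N.
  have /dvdnP : (k' - k %| (Q ^ d)`!)%N; last by [].
  apply: dvdn_fact; rewrite subn_gt0 ltk/=.
  by apply: leq_trans (leq_subr _ _) _; rewrite -ltnS.
exists (m%:Z *: n); rewrite Em natrM -scalerA w0.
apply/rowP => j; rewrite !mxE mulr_sumr; apply: eq_bigr => i _.
by rewrite !mxE intrM mulrA.
Qed.

Lemma det_replace_row (f : 'rV[R]_d) (i : 'I_d) :
  \det (\matrix_(k, j) (if k == i then f 0 j else (k == j)%:R)) = f 0 i.
Proof.
set X := (X in \det X).
rewrite (expand_det_col X i) (bigD1 i)//= big1 => [|k ki]; last first.
  by rewrite mxE (negbTE ki) mul0r.
rewrite addr0 mxE eqxx /cofactor addnn -signr_odd odd_double expr0 mul1r.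
rewrite (_ : row' i (col' i X) = 1%:M) ?det1 ?mulr1//.
apply/matrixP => a b; rewrite !mxE (negbTE (_ : lift i a != i)).
  by rewrite (inj_eq lift_inj).
by rewrite eq_sym neq_lift.
Qed.

Lemma lattice_basis : exists2 B : 'M[R]_d, B \in unitmx &
  forall v, L v <-> exists n : 'rV[int]_d, v = map_mx intr n *m B.
Proof.
have [B0 uB0 LB0] := lattice_independent.
have [q q0 Hq] := lattice_finite_index uB0 LB0.
have qR : q%:R != 0 :> R by rewrite pnatr_eq0 -lt0n.
(* Any system of lattice vectors of minimal nonzero determinant is a basis. *)
pose P (m : nat) := `[< exists B : 'M[R]_d, exists N : 'M[int]_d,
  [/\ B \in unitmx, forall i, L (row i B), q%:R *: B = map_mx intr N *m B0 &
      `|\det N|%N = m] >].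
have coords (B : 'M[R]_d) : (forall i, L (row i B)) ->
    exists N : 'M[int]_d, q%:R *: B = map_mx intr N *m B0.
  move=> HB; have /choice[N HN] := fun i => Hq _ (HB i).
  exists (\matrix_(i, j) N i 0 j); apply/row_matrixP => i.
  rewrite row_mul (_ : row i (map_mx _ _) = map_mx intr (N i)).
    by rewrite -HN; apply/rowP => j; rewrite !mxE.
  by apply/rowP => j; rewrite !mxE.
have exP : exists m, P m.
  have [N HN] := coords _ LB0.
  by exists `|\det N|%N; apply/asboolP; exists B0, N.
case: (ex_minnP exP) => m /asboolP[B [N [uB LBB HN detN]]] Hmin.
exists B => // v; split; last by move=> [n ->]; exact: lattice_comb.
move=> Lv; pose t := v *m invmx B.
have vt : v = t *m B by rewrite /t mulmxKV.
clearbody t.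
pose n : 'rV[int]_d := \row_j Num.floor (t 0 j).
exists n; rewrite {1}vt; congr (_ *m _); apply/rowP => i.
apply/eqP; rewrite !mxE -subr_eq0; apply/negPn/negP => ni.
pose f : 'rV[R]_d := t - map_mx intr n.
have fi01 : 0 < f 0 i < 1.
  have := floor_itv (t 0 i); rewrite intrD => h.
  rewrite !mxE lt_neqAle eq_sym ni/=; lra.
(* Replacing row [i] of [B] by the lattice vector with coordinates [f] multiplies the determinant by
   [f 0 i], strictly between 0 and 1, against minimality. *)
pose X : 'M[R]_d := \matrix_(k, j) (if k == i then f 0 j else (k == j)%:R).
have detX : \det X = f 0 i := det_replace_row f i.
have uX : X *m B \in unitmx.
  by rewrite unitmx_mul uB andbT unitmxE unitfE detX gt_eqF//; case/andP: fi01.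
have LX k : L (row k (X *m B)).
  rewrite row_mul; have [->|ki] := eqVneq k i.
    have -> : row i X = f by apply/rowP => j; rewrite !mxE eqxx.
    by rewrite /f mulmxBl -vt; apply: LB => //; exact: lattice_comb.
  have -> : row k X = delta_mx 0 k.
    by apply/rowP => j; rewrite !mxE (negbTE ki) eqxx/= eq_sym.
  by rewrite -rowE.
have [N' HN'] := coords _ LX.
have detE (B' : 'M[R]_d) (N1 : 'M[int]_d) : q%:R *: B' = map_mx intr N1 *m B0 ->
    (\det N1)%:~R * \det B0 = q%:R ^+ d * \det B'.
  by move=> H; rewrite -detZ H det_mulmx det_map_mx.
have dB0 : \det B0 != 0 by rewrite -unitfE -unitmxE.
have detB : \det B != 0 by rewrite -unitfE -unitmxE.
have E : (\det N')%:~R = f 0 i * (\det N)%:~R :> R.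
  apply: (mulIf dB0); rewrite (detE _ _ HN') -mulrA (detE _ _ HN).
  by rewrite det_mulmx detX mulrCA.
have Nn0 : (\det N)%:~R != 0 :> R.
  apply: contraNneq detB => N0; have := detE _ _ HN.
  by rewrite N0 mul0r => /esym/eqP; rewrite mulf_eq0 expf_eq0 (negbTE qR) andbF/=.
have : P `|\det N'|%N by apply/asboolP; exists (X *m B), N'.
move=> /Hmin; rewrite -detN -(ler_nat R) !natr_absz !intr_norm E normrM leNgt.
case/andP: fi01 => f0 f1.
by rewrite (gtr0_norm f0) gtr_pMl ?normr_gt0// f1.
Qed.

End LatticeBasis.

(** * Derivatives of all orders in several variables *)

Section ComplexDerivative.
Variables (R : realType) (d : nat).
Local Notation E := 'rV[R]_d.
Implicit Types (u v : E -> R[i]) (x : E).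

Definition ccont x u :=
  {for x, continuous (repart u)} /\ {for x, continuous (impart u)}.

Definition cder (i : 'I_d) x u (z : R[i]) :=
  is_derive x (delta_mx 0 i) (repart u) (complex.Re z) /\
  is_derive x (delta_mx 0 i) (impart u) (complex.Im z).

Lemma ccont_cst x (c : R[i]) : ccont x (fun=> c).
Proof. by split; exact: cst_continuous. Qed.

Lemma ccontD x u v : ccont x u -> ccont x v -> ccont x (fun y => u y + v y).
Proof.
move=> [u1 u2] [v1 v2]; split.
- rewrite (_ : repart _ = repart u + repart v); first exact: continuousD.
  by apply/funext => y; rewrite /repart raddfD.
- rewrite (_ : impart _ = impart u + impart v); first exact: continuousD.
  by apply/funext => y; rewrite /impart raddfD.
Qed.

Lemma ccontM x u v : ccont x u -> ccont x v -> ccont x (fun y => u y * v y).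
Proof.
move=> [u1 u2] [v1 v2]; split.
- rewrite (_ : repart _ = repart u * repart v - impart u * impart v).
    by apply: continuousB; exact: continuousM.
  by apply/funext => y; rewrite /repart /impart !fctE; case: (u y) (v y) => [? ?] [? ?].
- rewrite (_ : impart _ = repart u * impart v + impart u * repart v).
    by apply: continuousD; exact: continuousM.
  by apply/funext => y; rewrite /repart /impart !fctE; case: (u y) (v y) => [? ?] [? ?].
Qed.

Lemma ccont_sum (I : Type) (r : seq I) (F : I -> E -> R[i]) x :
  (forall i, ccont x (F i)) -> ccont x (fun y => \sum_(i <- r) F i y).
Proof.
move=> H; elim: r => [|i r IH].
  rewrite (_ : (fun _ => _) = fun=> 0); first exact: ccont_cst.
  by apply/funext => y; rewrite big_nil.
rewrite (_ : (fun _ => _) = fun y => F i y + \sum_(j <- r) F j y); first exact: ccontD.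
by apply/funext => y; rewrite big_cons.
Qed.

Lemma ccont_prod (I : Type) (r : seq I) (F : I -> E -> R[i]) x :
  (forall i, ccont x (F i)) -> ccont x (fun y => \prod_(i <- r) F i y).
Proof.
move=> H; elim: r => [|i r IH].
  rewrite (_ : (fun _ => _) = fun=> 1); first exact: ccont_cst.
  by apply/funext => y; rewrite big_nil.
rewrite (_ : (fun _ => _) = fun y => F i y * \prod_(j <- r) F j y); first exact: ccontM.
by apply/funext => y; rewrite big_cons.
Qed.

Lemma near_eq_ccont x u v : (\near x, u x = v x) -> ccont x u -> ccont x v.
Proof.
move=> uv [u1 u2]; have uvx : u x = v x := nbhs_singleton uv; split.
- have E : repart u x = repart v x by rewrite /repart uvx.
  suff : repart v @ x --> repart v x by []; rewrite -E.
  have nb : \forall y \near x, repart u y = repart v y.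
    by apply: filterS uv => y uvy; rewrite /repart uvy.
  exact: cvg_trans (near_eq_cvg nb) u1.
- have E : impart u x = impart v x by rewrite /impart uvx.
  suff : impart v @ x --> impart v x by []; rewrite -E.
  have nb : \forall y \near x, impart u y = impart v y.
    by apply: filterS uv => y uvy; rewrite /impart uvy.
  exact: cvg_trans (near_eq_cvg nb) u2.
Qed.

Lemma cder_cst i x (c : R[i]) : cder i x (fun=> c) 0.
Proof. by split; exact: is_derive_cst. Qed.

Lemma cderD i x u v z w : cder i x u z -> cder i x v w ->
  cder i x (fun y => u y + v y) (z + w).
Proof.
move=> [u1 u2] [v1 v2]; split; rewrite raddfD.
- rewrite (_ : repart _ = repart u + repart v); first exact: is_deriveD.
  by apply/funext => y; rewrite /repart raddfD.
- rewrite (_ : impart _ = impart u + impart v); first exact: is_deriveD.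
  by apply/funext => y; rewrite /impart raddfD.
Qed.

Lemma cderM i x u v z w : cder i x u z -> cder i x v w ->
  cder i x (fun y => u y * v y) (z * v x + u x * w).
Proof.
move=> [u1 u2] [v1 v2]; split.
- rewrite (_ : repart _ = repart u * repart v - impart u * impart v); last first.
    by apply/funext => y; rewrite /repart /impart !fctE; case: (u y) (v y) => [? ?] [? ?].
  apply: (is_derive_eq (is_deriveB (is_deriveM u1 v1) (is_deriveM u2 v2))).
  rewrite /GRing.scale/= /repart /impart.
  by case: z u1 u2 => ? ? _ _; case: w v1 v2 => ? ? _ _; case: (u x) (v x) => [? ?] [? ?]/=; ring.
- rewrite (_ : impart _ = repart u * impart v + impart u * repart v); last first.
    by apply/funext => y; rewrite /repart /impart !fctE; case: (u y) (v y) => [? ?] [? ?].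
  apply: (is_derive_eq (is_deriveD (is_deriveM u1 v2) (is_deriveM u2 v1))).
  rewrite /GRing.scale/= /repart /impart.
  by case: z u1 u2 => ? ? _ _; case: w v1 v2 => ? ? _ _; case: (u x) (v x) => [? ?] [? ?]/=; ring.
Qed.

Lemma cderZ i x (c : R[i]) u z : cder i x u z -> cder i x (fun y => c * u y) (c * z).
Proof. by move=> /(cderM (cder_cst i x c)); rewrite mul0r add0r. Qed.

Lemma cder_sum i x (I : Type) (r : seq I) (F : I -> E -> R[i]) (dF : I -> R[i]) :
  (forall j, cder i x (F j) (dF j)) ->
  cder i x (fun y => \sum_(j <- r) F j y) (\sum_(j <- r) dF j).
Proof.
move=> H; elim: r => [|j r IH].
  rewrite (_ : (fun _ => _) = fun=> 0); last by apply/funext => y; rewrite big_nil.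
  by rewrite big_nil; exact: cder_cst.
rewrite (_ : (fun _ => _) = fun y => F j y + \sum_(k <- r) F k y).
  by rewrite big_cons; exact: cderD.
by apply/funext => y; rewrite big_cons.
Qed.

Lemma near_eq_cder i x u v z : (\near x, u x = v x) -> cder i x u z -> cder i x v z.
Proof.
move=> uv [u1 u2]; split.
- apply: near_eq_is_derive u1; apply: filterS uv => y.
  by rewrite /repart => ->.
- apply: near_eq_is_derive u2; apply: filterS uv => y.
  by rewrite /impart => ->.
Qed.

Lemma cder_pderiv i x u z : cder i x u z -> pderiv i u x = z.
Proof. by move=> [[_ u1] [_ u2]]; rewrite /pderiv u1 u2; case: z {u1 u2}. Qed.

End ComplexDerivative.

(** * Jets and the Leibniz rule *)

Section Jets.
Variables (R : realType) (d : nat).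
Local Notation E := 'rV[R]_d.
Implicit Types (phi chi : E -> R[i]) (u v : seq 'I_d -> E -> R[i]) (Omega : set E).

(* [u s] plays the role of the derivative of [u [::]] along the coordinates
   listed in [s], the head of the list being differentiated last. *)
Definition jet Omega u := forall s x, Omega x ->
  ccont x (u s) /\ forall i, cder i x (u s) (u (i :: s) x).

Lemma smooth_jet Omega phi : smooth_on Omega phi -> jet Omega (fun s => pderivs s phi).
Proof.
move=> H s x Ox; have [c1 c2 der] := H s x Ox; split => // i.
by have [d1 d2] := der i; split; exact: derivableP.
Qed.

(** Derivatives at points of an open set depend only on values nearby, so a jet is determined by its
    entry at the empty list. A formula for all derivatives is thus proved by checking that it
    defines a jet. *)
Lemma jet_pderivs Omega u phi : open Omega -> jet Omega u ->
  (forall x, Omega x -> phi x = u [::] x) ->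
  forall s x, Omega x -> pderivs s phi x = u s x.
Proof.
move=> oO Hu phiu; elim=> [|i s IH] x Ox; first exact: phiu.
apply: cder_pderiv; apply: near_eq_cder ((Hu s x Ox).2 i).
have : nbhs x Omega by exact: open_nbhs_nbhs.
by apply: filterS => y /IH <-.
Qed.

Lemma jet_smooth Omega u phi : open Omega -> jet Omega u ->
  (forall x, Omega x -> phi x = u [::] x) -> smooth_on Omega phi.
Proof.
move=> oO Hu phiu s x Ox.
have nE : \near x, u s x = pderivs s phi x.
  have : nbhs x Omega by exact: open_nbhs_nbhs.
  by apply: filterS => y Oy; rewrite (jet_pderivs oO Hu phiu).
have [uc ud] := Hu s x Ox.
have [c1 c2] := near_eq_ccont nE uc; split => // i.
by have [[? _] [? _]] := near_eq_cder nE (ud i).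
Qed.

Lemma jet_cst0 Omega : jet Omega (fun _ _ => 0).
Proof. by move=> s x _; split => [|i]; [exact: ccont_cst|exact: cder_cst]. Qed.

Lemma jet_lin Omega (a : R[i]) u v : jet Omega u -> jet Omega v ->
  jet Omega (fun s x => a * u s x + v s x).
Proof.
move=> Hu Hv s x Ox; have [uc ud] := Hu s x Ox; have [vc vd] := Hv s x Ox.
split=> [|i]; last exact: cderD (cderZ a (ud i)) (vd i).
by apply: ccontD vc; apply: ccontM uc; exact: ccont_cst.
Qed.

(** All ways to distribute the derivatives in [s] over two factors, with repetition; the Leibniz
    rule then needs no binomial coefficients. *)
Fixpoint splits (s : seq 'I_d) : seq (seq 'I_d * seq 'I_d) :=
  if s is i :: s' then
    [seq (i :: pq.1, pq.2) | pq <- splits s'] ++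
    [seq (pq.1, i :: pq.2) | pq <- splits s']
  else [:: ([::], [::])].

Lemma splits_subseq s pq : pq \in splits s -> subseq pq.1 s /\ subseq pq.2 s.
Proof.
elim: s pq => [|i s IH] pq /=; first by rewrite inE => /eqP ->.
have sub p : subseq p s -> subseq p (i :: s).
  by move=> ps; apply: subseq_trans ps (subseq_cons _ _).
rewrite mem_cat => /orP[] /mapP[pq' /IH[h1 h2] ->]; split.
- by rewrite /= eqxx.
- exact: sub.
- exact: sub.
- by rewrite /= eqxx.
Qed.

Lemma splits_weight (h1 h2 : R) s :
  \sum_(pq <- splits s) h1 ^+ size pq.1 * h2 ^+ size pq.2 = (h1 + h2) ^+ size s.
Proof.
elim: s => [|i s IH] /=; first by rewrite big_seq1/= !expr0 mulr1.
rewrite big_cat !big_map/= exprS -IH mulrDl !mulr_sumr; congr (_ + _).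
  by apply: eq_bigr => pq _; rewrite exprS mulrA.
by apply: eq_bigr => pq _; rewrite exprS mulrCA.
Qed.

Lemma splits_size s pq : pq \in splits s -> (size pq.1 + size pq.2)%N = size s.
Proof.
elim: s pq => [|i s IH] pq /=; first by rewrite inE => /eqP ->.
by rewrite mem_cat => /orP[] /mapP[pq' /IH <- ->] /=; rewrite ?addSn ?addnS.
Qed.

Definition jetM u v s x : R[i] := \sum_(pq <- splits s) u pq.1 x * v pq.2 x.

Lemma jet_mul Omega u v : jet Omega u -> jet Omega v -> jet Omega (jetM u v).
Proof.
move=> Hu Hv s x Ox; split=> [|i].
  by apply: ccont_sum => pq; apply: ccontM; [exact: (Hu _ _ Ox).1|exact: (Hv _ _ Ox).1].
rewrite /jetM /= big_cat !big_map/= -big_split/=.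
by apply: cder_sum => pq; apply: cderM; [exact: (Hu _ _ Ox).2|exact: (Hv _ _ Ox).2].
Qed.

Lemma smooth_mul Omega phi chi : open Omega -> smooth_on Omega phi ->
  smooth_on Omega chi -> smooth_on Omega (fun x => phi x * chi x).
Proof.
move=> oO /smooth_jet Hphi /smooth_jet Hchi.
apply: (jet_smooth oO (jet_mul Hphi Hchi)) => x Ox.
by rewrite /jetM /= big_seq1.
Qed.

Lemma pderivs_mul Omega phi chi s x : open Omega -> smooth_on Omega phi ->
  smooth_on Omega chi -> Omega x ->
  pderivs s (fun x => phi x * chi x) x =
  \sum_(pq <- splits s) pderivs pq.1 phi x * pderivs pq.2 chi x.
Proof.
move=> oO /smooth_jet Hphi /smooth_jet Hchi Ox.
by apply: (jet_pderivs oO (jet_mul Hphi Hchi)) => // y Oy; rewrite /jetM /= big_seq1.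
Qed.

Lemma smooth_lin Omega a phi chi : open Omega -> smooth_on Omega phi ->
  smooth_on Omega chi -> smooth_on Omega (fun x => a * phi x + chi x).
Proof.
by move=> oO /smooth_jet Hphi /smooth_jet Hchi; exact: (jet_smooth oO (jet_lin a Hphi Hchi)).
Qed.

Lemma pderivs_lin Omega a phi chi s x : open Omega -> smooth_on Omega phi ->
  smooth_on Omega chi -> Omega x ->
  pderivs s (fun x => a * phi x + chi x) x = a * pderivs s phi x + pderivs s chi x.
Proof.
move=> oO /smooth_jet Hphi /smooth_jet Hchi Ox.
by rewrite (jet_pderivs oO (jet_lin a Hphi Hchi)).
Qed.

Lemma smooth_eq_on (O : set E) phi chi : open O -> (forall x, O x -> phi x = chi x) ->
  smooth_on O phi -> smooth_on O chi.
Proof.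
by move=> oO H /smooth_jet Hphi; apply: (jet_smooth oO Hphi) => x /H.
Qed.

Definition monom (al : {ffun 'I_d -> nat}) : seq 'I_d :=
  flatten [seq nseq (al i) i | i <- enum 'I_d].

Lemma size_monom al : size (monom al) = mabs al.
Proof.
rewrite /monom size_flatten /shape -map_comp sumnE big_map /mabs big_enum/=.
by apply: eq_bigr => i _; rewrite /= size_nseq.
Qed.

Lemma count_monom al i : count_mem i (monom al) = al i.
Proof.
rewrite /monom count_flatten -map_comp sumnE big_map big_enum/= (bigD1 i)//=.
rewrite count_nseq /= eqxx mul1n big1 ?addn0// => j ji.
by rewrite count_nseq/= (negbTE ji) mul0n.
Qed.

Lemma monom_sorted al : sorted (fun i j : 'I_d => (i <= j)%N) (monom al).
Proof.
rewrite /monom; have : sorted (fun i j : 'I_d => (i < j)%N) (enum 'I_d).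
  by have := iota_ltn_sorted 0 d; rewrite -val_enum_ord sorted_map.
have tr : transitive (fun i j : 'I_d => (i <= j)%N) by move=> ? ? ?; exact: leq_trans.
elim: (enum 'I_d) => //= i s IH pis.
have lt_tr : transitive (fun i j : 'I_d => (i < j)%N) by move=> ? ? ?; exact: ltn_trans.
have {}IH := IH (path_sorted pis).
have lei j : j \in flatten [seq nseq (al i) i | i <- s] -> (i <= j)%N.
  move=> /flattenP[_ /mapP[k ks ->]]; rewrite mem_nseq => /andP[_ /eqP ->].
  by have /allP/(_ _ ks)/ltnW := order_path_min lt_tr pis.
elim: (al i) => //= n IHn; rewrite path_sortedE// IHn andbT.
apply/allP => j; rewrite mem_cat mem_nseq => /orP[/andP[_ /eqP ->]//|].
exact: lei.
Qed.

(** [mderiv] differentiates along sorted lists, and a sublist of a sorted list is sorted. The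
    Leibniz rule therefore stays among the [mderiv], and mixed derivatives never have to be
    interchanged. *)
Lemma subseq_monom al s : subseq s (monom al) -> exists be, s = monom be.
Proof.
move=> sub; exists [ffun i => count_mem i s].
have tr : transitive (fun i j : 'I_d => (i <= j)%N) by move=> ? ? ?; exact: leq_trans.
apply: (sorted_eq tr _ _ (monom_sorted _)).
- by move=> i j h; apply/val_inj/anti_leq.
- exact: subseq_sorted tr _ _ sub (monom_sorted al).
- apply/allP => i _; rewrite /= count_monom ffunE; exact/eqP.
Qed.

End Jets.

Section ChainRule.
Variables (R : realType) (d : nat).
Local Notation E := 'rV[R]_d.
Implicit Types (x xi : E) (F dF : R -> R[i]).

Lemma is_derive_line (f : E -> R) (v x : E) (df : R) :
  is_derive (0 : R) 1 (fun t : R => f (t *: v + x)) df -> is_derive x v f df.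
Proof.
move=> [dl vl].
have E : (fun h : R => h^-1 *: (((fun t : R => f (t *: v + x)) \o shift (0 : R)) (h *: (1 : R))
    - f (0 *: v + x))) = (fun h : R => h^-1 *: ((f \o shift x) (h *: v) - f x)).
  by apply/funext => h /=; rewrite scale0r add0r addr0 /GRing.scale/= mulr1.
split; first by move: dl; rewrite /derivable E.
by rewrite -vl /derive E.
Qed.

Definition chas_der F dF :=
  has_der (fun t => complex.Re (F t)) (fun t => complex.Re (dF t)) /\
  has_der (fun t => complex.Im (F t)) (fun t => complex.Im (dF t)).

Lemma cder_comp (i : 'I_d) F dF (l : E -> R) (b : R) x : chas_der F dF ->
  (forall t : R, l (t *: delta_mx 0 i + x) = b * t + l x) ->
  cder i x (fun y => F (l y)) (Complex b 0 * dF (l x)).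
Proof.
move=> [F1 F2] Hl; split; apply: is_derive_line.
- rewrite (_ : (fun t : R => _) = fun t => complex.Re (F (b * t + l x))); last first.
    by apply/funext => t; rewrite /repart Hl.
  apply: is_derive_eq (has_der_affine b (l x) F1 0) _.
  by rewrite mulr0 add0r; case: (dF (l x)) => u v /=; ring.
- rewrite (_ : (fun t : R => _) = fun t => complex.Im (F (b * t + l x))); last first.
    by apply/funext => t; rewrite /impart Hl.
  apply: is_derive_eq (has_der_affine b (l x) F2 0) _.
  by rewrite mulr0 add0r; case: (dF (l x)) => u v /=; ring.
Qed.

Lemma ccont_comp F dF (l : E -> R) x : chas_der F dF -> {for x, continuous l} ->
  ccont x (fun y => F (l y)).
Proof.
move=> [/has_der_continuous F1 /has_der_continuous F2] cl; split.
- exact: (continuous_comp cl (F1 _)).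
- exact: (continuous_comp cl (F2 _)).
Qed.

Lemma chas_der_cexp (a : R) : chas_der (fun t => cexp (a * t))
  (fun t => Complex 0 (2 * pi * a) * cexp (a * t)).
Proof.
split => /=.
- apply: has_der_ext (has_der_cos_lin (2 * pi * a) 0) => t; rewrite addr0.
    by congr cos; ring.
  by rewrite (_ : 2 * pi * (a * t) = 2 * pi * a * t); [ring|ring].
- apply: has_der_ext (has_der_sin_lin (2 * pi * a) 0) => t; rewrite addr0.
    by congr sin; ring.
  by rewrite (_ : 2 * pi * (a * t) = 2 * pi * a * t); [ring|ring].
Qed.

Lemma dotDr xi x y : dot xi (x + y) = dot xi x + dot xi y.
Proof. by rewrite /dot -big_split; apply: eq_bigr => i _; rewrite mxE mulrDr. Qed.

Lemma dotZr xi (t : R) x : dot xi (t *: x) = t * dot xi x.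
Proof. by rewrite /dot mulr_sumr; apply: eq_bigr => i _; rewrite mxE mulrCA. Qed.

Lemma dotC x y : dot x y = dot y x.
Proof. by rewrite /dot; apply: eq_bigr => i _; rewrite mulrC. Qed.

Lemma dot_delta xi i : dot xi (delta_mx 0 i) = xi 0 i.
Proof.
rewrite /dot (bigD1 i)//= big1 => [|j ji]; rewrite mxE.
  by rewrite !eqxx mulr1 addr0.
by rewrite (negbTE ji) andbF mulr0.
Qed.

Lemma dot_continuous xi : continuous (dot xi : E -> R).
Proof.
rewrite /dot; elim: (index_enum _) => [|i r IH] x.
  rewrite (_ : (fun _ => _) = fun=> 0); first exact: cst_continuous.
  by apply/funext => y; rewrite big_nil.
rewrite (_ : (fun _ => _) = fun y : E => xi 0 i * y 0 i + \sum_(j <- r) xi 0 j * y 0 j).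
  apply: (@continuousD _ _ _ (fun y : E => xi 0 i * y 0 i)
    (fun y : E => \sum_(j <- r) xi 0 j * y 0 j) x); last exact: IH.
  by apply: (@continuousM _ _ (fun=> xi 0 i) (fun y : E => y 0 i) x);
    [exact: cst_continuous|exact: coord_continuous].
by apply/funext => y; rewrite big_cons.
Qed.

Lemma echarE xi x : echar xi x = cexp (-1 * dot xi x).
Proof. by rewrite /echar /cexp mulN1r mulrN cosN sinN. Qed.

Definition echar_jet xi (s : seq 'I_d) x : R[i] :=
  (\prod_(j <- s) Complex 0 (2 * pi * - xi 0 j)) * echar xi x.

Lemma jet_echar xi : jet setT (echar_jet xi).
Proof.
move=> s x _; have cc : ccont x (echar xi).
  have -> : echar xi = fun y => cexp (-1 * dot xi y) by apply/funext => y; exact: echarE.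
  exact: ccont_comp (chas_der_cexp (-1)) (@dot_continuous xi x).
have cd i : cder i x (echar xi) (Complex 0 (2 * pi * - xi 0 i) * echar xi x).
  have -> : echar xi = fun y => cexp (-1 * dot xi y) by apply/funext => y; exact: echarE.
  have := @cder_comp i _ _ (dot xi) (xi 0 i) x (chas_der_cexp (-1)).
  have -> : Complex (xi 0 i) 0 * (Complex 0 (2 * pi * -1) * cexp (-1 * dot xi x)) =
      Complex 0 (2 * pi * - xi 0 i) * cexp (-1 * dot xi x).
    by rewrite mulrA; congr (_ * _); apply/eqP; rewrite eq_complex/=; apply/andP; split; apply/eqP; ring.
  by apply=> t; rewrite dotDr dotZr dot_delta mulrC.
split=> [|i]; first by apply: ccontM cc; exact: ccont_cst.
rewrite /echar_jet big_cons -mulrA mulrCA; exact: cderZ.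
Qed.

Lemma smooth_echar Omega xi : smooth_on Omega (echar xi).
Proof.
have H : smooth_on setT (echar xi).
  by apply: jet_smooth openT (jet_echar xi) _ => x _; rewrite /echar_jet big_nil mul1r.
by move=> s x _; exact: H.
Qed.

Lemma pderivs_echar_le xi s x :
  cabs (pderivs s (echar xi) x) <= (2 * pi * `|xi|) ^+ size s.
Proof.
rewrite (jet_pderivs openT (jet_echar xi))//; last first.
  by move=> y _; rewrite /echar_jet big_nil mul1r.
rewrite /echar_jet cabsM echarE cabs_cexp mulr1 cabs_prod.
elim: s => [|j s IH]; first by rewrite big_nil.
rewrite big_cons exprS; apply: ler_pM => //; rewrite ?cabs_ge0 ?prodr_ge0//.
  by move=> *; exact: cabs_ge0.
rewrite cabs_im normrM normrN ger0_norm ?mulr_ge0 ?pi_ge0//.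
by rewrite ler_wpM2l ?mulr_ge0 ?pi_ge0// coord_le_norm.
Qed.

End ChainRule.

Section GradedJets.
Variables (R : realType) (d : nat) (B : 'M[R]_d).
Local Notation E := 'rV[R]_d.
Local Notation index := ('I_d -> nat).
Implicit Types (be : index) (U : index -> E -> R[i]).

Definition incr be (i : 'I_d) : index := fun k => (be k + (k == i))%N.

Lemma incrC be i j : incr (incr be i) j = incr (incr be j) i.
Proof. by apply/funext => k; rewrite /incr addnAC. Qed.

(* A family indexed by multi-indices that is stable under differentiation in
   the coordinate system dual to the rows of [B]. *)
Definition graded U := forall be x, ccont x (U be) /\
  forall j, cder j x (U be) (\sum_i Complex (B i j) 0 * U (incr be i) x).

Fixpoint graded_jet U (s : seq 'I_d) be (x : E) : R[i] :=
  if s is j :: s' then \sum_i Complex (B i j) 0 * graded_jet U s' (incr be i) x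
  else U be x.

Lemma jet_graded U be : graded U -> jet setT (fun s => graded_jet U s be).
Proof.
move=> HU s x _; split.
  elim: s be => [|j s IH] be /=; first exact: (HU be x).1.
  by apply: ccont_sum => i; apply: ccontM; [exact: ccont_cst|exact: IH].
move=> j; elim: s be => [|k s IH] be; first exact: (HU be x).2.
have -> : graded_jet U [:: j, k & s] be x =
    \sum_i Complex (B i k) 0 * graded_jet U (j :: s) (incr be i) x.
  rewrite /=; under eq_bigr do rewrite mulr_sumr.
  under [RHS]eq_bigr do rewrite mulr_sumr.
  rewrite exchange_big/=; apply: eq_bigr => i _; apply: eq_bigr => l _.
  by rewrite mulrCA incrC.
by apply: cder_sum => i; apply: cderZ; exact: IH.
Qed.

(** One derivative in a standard coordinate is a combination of derivatives in the adapted ones,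
    with coefficients from a column of [B]; their absolute values sum to at most [opnorm B]. *)
Lemma graded_jet_le U (A : R) s be x : 0 <= A ->
  (forall ga, (\sum_i ga i = \sum_i be i + size s)%N -> cabs (U ga x) <= A) ->
  cabs (graded_jet U s be x) <= opnorm B ^+ size s * A.
Proof.
move=> A0; elim: s be => [|j s IH] be H /=.
  by rewrite expr0 mul1r; apply: H; rewrite addn0.
apply: (le_trans (cabs_sum _ _)); rewrite exprS -mulrA.
apply: (@le_trans _ _ (\sum_i `|B i j| * (opnorm B ^+ size s * A))).
  apply: ler_sum => i _; rewrite cabsM cabsR ler_wpM2l//.
  apply: IH => ga Hga; apply: H; rewrite Hga /incr big_split/=.
  have -> : (\sum_(k < d) (k == i) = 1)%N.
    by rewrite (bigD1 i)//= eqxx big1// => k /negbTE ->.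
  by rewrite -addnA add1n.
rewrite -mulr_suml ler_wpM2r ?mulr_ge0 ?exprn_ge0 ?opnorm_ge0//.
by apply: ler_sum => i _; rewrite (bigD1 j)//= lerDl sumr_ge0.
Qed.

Lemma graded_sub U V : graded U -> graded V -> graded (fun be x => U be x - V be x).
Proof.
move=> HU HV be x; have [uc ud] := HU be x; have [vc vd] := HV be x.
have E1 (f g : E -> R[i]) : (fun y => f y - g y) = fun y => f y + -1 * g y.
  by apply/funext => y; rewrite mulN1r.
split=> [|j].
  by rewrite E1; apply: ccontD => //; apply: ccontM => //; exact: ccont_cst.
rewrite E1; have := cderD (ud j) (cderZ (-1) (vd j)).
by rewrite mulN1r -sumrB; under eq_bigr do rewrite -mulrBr.
Qed.

Variable x0 : E.
(** The pairing of [x - x0] with row [i] of [B]. If the rows form a basis of a lattice, all these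
    coordinates are integers exactly when [x - x0] lies in the dual lattice. *)
Definition lcoord (i : 'I_d) (x : E) : R := ((x - x0) *m B^T) 0 i.

Lemma lcoordE i x : lcoord i x = dot (row i B) (x - x0).
Proof.
by rewrite /lcoord mxE /dot; apply: eq_bigr => j _; rewrite !mxE mulrC.
Qed.

Lemma lcoord_continuous i : continuous (lcoord i).
Proof.
move=> x; rewrite (_ : lcoord i = fun y => dot (row i B) y + - dot (row i B) x0).
  by apply: (@continuousD _ _ _ (dot (row i B)) (fun=> - dot (row i B) x0) x);
    [exact: dot_continuous|exact: cst_continuous].
by apply/funext => y; rewrite lcoordE dotDr -scaleN1r dotZr mulN1r.
Qed.

Definition tensor (F : 'I_d -> nat -> R -> R[i]) be x : R[i] :=
  \prod_i F i (be i) (lcoord i x).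

Lemma graded_tensor (F : 'I_d -> nat -> R -> R[i]) :
  (forall i k, chas_der (F i k) (F i k.+1)) -> graded (tensor F).
Proof.
move=> HF be x; split.
  by apply: ccont_prod => i; apply: ccont_comp (HF _ _) (@lcoord_continuous _ _).
move=> j; rewrite /tensor; have := index_enum_uniq 'I_d.
elim: (index_enum 'I_d) => [_|a r IH /= /andP[ar ur]].
  rewrite (_ : (fun _ => _) = fun=> 1); last by apply/funext => y; rewrite big_nil.
  rewrite big_nil; exact: cder_cst.
rewrite (_ : (fun _ => _) = fun y => F a (be a) (lcoord a y) *
    \prod_(i <- r) F i (be i) (lcoord i y)); last first.
  by apply/funext => y; rewrite big_cons.
have lin (t : R) : lcoord a (t *: delta_mx 0 j + x) = B a j * t + lcoord a x.
  by rewrite !lcoordE -addrA (dotDr _ (t *: _)) dotZr dot_delta mxE mulrC.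
have E1 : \prod_(i <- r) F i (incr be a i) (lcoord i x) =
    \prod_(i <- r) F i (be i) (lcoord i x).
  apply: eq_big_seq => i ir; rewrite /incr (_ : (i == a) = false) ?addn0//.
  by apply: contraNF ar => /eqP <-.
have E2 : \sum_(i <- r) Complex (B i j) 0 *
      \prod_(k <- a :: r) F k (incr be i k) (lcoord k x) =
    F a (be a) (lcoord a x) * \sum_(i <- r) Complex (B i j) 0 *
      \prod_(k <- r) F k (incr be i k) (lcoord k x).
  rewrite mulr_sumr; apply: eq_big_seq => i ir.
  rewrite big_cons {1}/incr (_ : (a == i) = false) ?addn0; first by rewrite mulrCA.
  by apply: contraNF ar => /eqP ->.
rewrite big_cons E2 big_cons E1 {1}/incr eqxx addn1 mulrA.
exact: cderM (cder_comp (HF a (be a)) lin) (IH ur).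
Qed.

End GradedJets.

(** * Test functions and ultradistributions *)

Section ZeroFunction.
Variables (R : realType) (d : nat).

Lemma smooth_cst0 (O : set 'rV[R]_d) : smooth_on O (fun=> 0 : R[i]).
Proof.
move=> s x _; have H : smooth_on setT ((fun=> 0) : 'rV[R]_d -> R[i]).
  exact: (jet_smooth openT (@jet_cst0 R d setT) (fun _ _ => erefl)).
exact: H.
Qed.

Lemma pderivs_cst0 s (x : 'rV[R]_d) : pderivs s (fun=> 0 : R[i]) x = 0.
Proof. by rewrite (jet_pderivs openT (@jet_cst0 R d setT)). Qed.

End ZeroFunction.

Section Bounds.
Variables (R : realType) (d : nat) (M : nat -> R).
Hypothesis M_gt0 : forall p, 0 < M p.
Hypothesis M_0 : M 0%N = 1.
Hypothesis M_1 : forall p, (1 <= p)%N -> M p ^+ 2 <= M p.-1 * M p.+1.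
Hypothesis M_3' : (\sum_(1 <= p <oo) (M p.-1 / M p)%:E < +oo)%E.
Local Notation E := 'rV[R]_d.
Implicit Types (phi chi : E -> R[i]) (K Omega : set E) (h C : R).

Definition bnd K h C phi := forall al x, K x ->
  cabs (mderiv al phi x) <= C * h ^+ mabs al * M (mabs al).

Lemma ultranorm_le K h C phi : 0 < h ->
  (ultranorm M K h phi <= C%:E)%E <-> bnd K h C phi.
Proof.
move=> h0; have hM al : 0 < h ^+ mabs al * M (mabs (al : {ffun 'I_d -> nat})).
  by rewrite mulr_gt0// exprn_gt0.
split=> [H al x Kx|H].
  rewrite -mulrA -ler_pdivrMr// -lee_fin; apply: le_trans H.
  by apply: ereal_sup_ubound; exists (x, al).
apply: ge_ereal_sup => _ [[x al] [/= Kx _] <-].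
by rewrite lee_fin ler_pdivrMr// mulrA; exact: H.
Qed.

Lemma ultranorm_lt K h phi : 0 < h -> (ultranorm M K h phi < +oo)%E <->
  exists2 C, 0 < C & bnd K h C phi.
Proof.
move=> h0; split=> [|[C C0 H]].
  case E : (ultranorm M K h phi) => [r| |]// _.
    exists (`|r| + 1); first by rewrite ltr_wpDl.
    by apply/ultranorm_le => //; rewrite E lee_fin ler_wpDr// ler_norm.
  by exists 1 => //; apply/ultranorm_le => //; rewrite E leNye.
apply: le_lt_trans (ltry C); exact/ultranorm_le.
Qed.

Lemma bnd_le K h C C' phi : 0 <= h -> C <= C' -> bnd K h C phi -> bnd K h C' phi.
Proof.
move=> h0 CC H al x Kx; apply: le_trans (H al x Kx) _.
by rewrite -!mulrA ler_wpM2r// mulr_ge0 ?exprn_ge0// ltW.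
Qed.

Lemma bnd_leh K h h' C phi : 0 <= h -> h <= h' -> 0 <= C ->
  bnd K h C phi -> bnd K h' C phi.
Proof.
move=> h0 hh C0 H al x Kx; apply: le_trans (H al x Kx) _.
apply: ler_wpM2r; first exact: ltW.
by apply: ler_wpM2l => //; apply: lerXn2r; rewrite ?nnegrE// (le_trans h0).
Qed.

Lemma bnd_sub K K' h C phi : K `<=` K' -> bnd K' h C phi -> bnd K h C phi.
Proof. by move=> KK H al x /KK; exact: H. Qed.

(** The Leibniz sum is a binomial sum, whence [h1 + h2]; the weights combine by
    [M p * M q <= M (p + q)]. *)
Lemma bnd_mul Omega K h1 h2 C1 C2 phi chi : open Omega -> K `<=` Omega ->
  0 <= h1 -> 0 <= h2 -> 0 <= C1 -> 0 <= C2 ->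
  smooth_on Omega phi -> smooth_on Omega chi ->
  bnd K h1 C1 phi -> bnd K h2 C2 chi ->
  bnd K (h1 + h2) (C1 * C2) (fun x => phi x * chi x).
Proof.
move=> oO KO h10 h20 C10 C20 sphi schi H1 H2 al x Kx.
rewrite /mderiv -/(monom al) (pderivs_mul (monom al) oO)//; last exact: KO.
apply: (le_trans (cabs_sum _ _)).
rewrite -size_monom -(splits_weight h1 h2) mulr_sumr mulr_suml.
rewrite big_seq [leRHS]big_seq; apply: ler_sum => pq pqs.
have [/subseq_monom[b1 E1] /subseq_monom[b2 E2]] := splits_subseq pqs.
have := H1 b1 x Kx; have := H2 b2 x Kx.
rewrite /mderiv -!/(monom _) -!size_monom -E1 -E2 cabsM => h2' h1'.
have := ler_pM (cabs_ge0 _) (cabs_ge0 _) h1' h2' => /le_trans; apply.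
rewrite [leLHS](_ : _ = C1 * C2 * (h1 ^+ size pq.1 * h2 ^+ size pq.2) *
  (M (size pq.1) * M (size pq.2))); last by ring.
apply: ler_wpM2l; first by rewrite !mulr_ge0 ?exprn_ge0.
by rewrite -(splits_size pqs); exact: M_superM.
Qed.

Lemma bnd_scale Omega K h C (a : R[i]) phi : open Omega -> K `<=` Omega ->
  smooth_on Omega phi -> bnd K h C phi -> bnd K h (cabs a * C) (fun x => a * phi x).
Proof.
move=> oO KO sphi H al x Kx.
have s0 := @smooth_cst0 R d Omega.
have := pderivs_lin a (monom al) oO sphi s0 (KO _ Kx).
rewrite pderivs_cst0 addr0.
rewrite /mderiv -/(monom al); under eq_fun do rewrite addr0.
move=> ->; rewrite cabsM -!mulrA ler_wpM2l ?cabs_ge0// mulrA.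
exact: (H al x Kx).
Qed.

Lemma bnd_echar K h xi C : 0 < h -> (forall q, (2 * pi * `|xi| / h) ^+ q <= C * M q) ->
  bnd K h C (echar xi).
Proof.
move=> h0 HC al x _; rewrite /mderiv -/(monom al).
apply: (le_trans (pderivs_echar_le _ _ _)); rewrite size_monom.
have := HC (mabs al); rewrite expr_div_n ler_pdivrMr ?exprn_gt0//.
by move=> H; apply: (le_trans H); rewrite [leLHS]mulrAC.
Qed.

Lemma echar_E_space Omega xi : E_space M Omega (echar xi).
Proof.
move=> K h _ h0; split; first exact: smooth_echar.
apply/ultranorm_lt => //.
have [B B0 HB] := pow_le_M M_gt0 M_0 M_1 M_3'
  (divr_ge0 (mulr_ge0 (mulr_ge0 (ler0n _ 2) (pi_ge0 R)) (normr_ge0 xi)) (ltW h0)).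
by exists B => //; exact: bnd_echar.
Qed.

Lemma E_space_smooth Omega phi : E_space M Omega phi -> smooth_on Omega phi.
Proof.
move=> H; have c0 : compact_in (set0 : set E) Omega.
  by split; [exact: compact0|exact: sub0set].
by have [] := H _ 1 c0 ltr01.
Qed.

Lemma E_space_bnd Omega phi K h : E_space M Omega phi -> compact_in K Omega -> 0 < h ->
  exists2 C, 0 < C & bnd K h C phi.
Proof. by move=> H cK h0; have [_ /ultranorm_lt] := H K h cK h0; exact. Qed.

Lemma E_spaceP Omega phi : smooth_on Omega phi ->
  (forall K h, compact_in K Omega -> 0 < h -> exists2 C, 0 < C & bnd K h C phi) ->
  E_space M Omega phi.
Proof. by move=> sm H K h cK h0; split => //; apply/ultranorm_lt => //; exact: H. Qed.

Lemma E_space_mul Omega phi chi : open Omega -> E_space M Omega phi ->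
  E_space M Omega chi -> E_space M Omega (fun x => phi x * chi x).
Proof.
move=> oO Ephi Echi; apply: E_spaceP.
  by apply: smooth_mul => //; exact: E_space_smooth.
move=> K h cK h0; have h20 : 0 < h / 2 by rewrite divr_gt0.
have [C1 C10 H1] := E_space_bnd Ephi cK h20.
have [C2 C20 H2] := E_space_bnd Echi cK h20.
exists (C1 * C2); first exact: mulr_gt0.
have := bnd_mul oO cK.2 (ltW h20) (ltW h20) (ltW C10) (ltW C20)
  (E_space_smooth Ephi) (E_space_smooth Echi) H1 H2.
by rewrite -splitr.
Qed.

Lemma E_space_lin Omega a phi chi : open Omega -> E_space M Omega phi ->
  E_space M Omega chi -> E_space M Omega (fun x => a * phi x + chi x).
Proof.
move=> oO Ephi Echi.
have sphi := E_space_smooth Ephi; have schi := E_space_smooth Echi.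
apply: E_spaceP; first exact: smooth_lin.
move=> K h cK h0; have [C1 C10 H1] := E_space_bnd Ephi cK h0.
have [C2 C20 H2] := E_space_bnd Echi cK h0.
have a0 := cabs_ge0 a.
exists (cabs a * C1 + C2); first by rewrite ltr_wpDl// mulr_ge0// ltW.
move=> al x Kx; rewrite /mderiv -/(monom al) (pderivs_lin _ _ oO)//; last exact: cK.2.
apply: (le_trans (cabsD _ _)); rewrite cabsM !mulrDl; apply: lerD; last exact: H2.
by rewrite -!mulrA ler_wpM2l// mulrA; exact: H1.
Qed.

Lemma E_space_cst0 Omega : E_space M Omega (fun=> 0).
Proof.
apply: E_spaceP; first exact: smooth_cst0.
move=> K h _ h0; exists 1 => // al x Kx.
rewrite /mderiv pderivs_cst0.
by rewrite cabs0 mul1r mulr_ge0 ?exprn_ge0 ?ltW.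
Qed.

Lemma csupport_notin phi x : ~ csupport phi x -> phi x = 0.
Proof.
move=> H; apply/eqP/negPn/negP => px; apply: H.
exact: subset_closure.
Qed.

Lemma smooth_of_support Omega K phi : K `<=` Omega -> csupport phi `<=` K ->
  smooth_on Omega phi -> smooth_on setT phi.
Proof.
move=> KO sK sm s x _; have [/sK/KO|nx] := pselect (csupport phi x); first exact: sm.
have oN : open (~` csupport phi) by rewrite openC; exact: closed_closure.
apply: (smooth_eq_on oN (phi := fun=> 0)) nx.
  by move=> y; move/csupport_notin ->.
exact: smooth_cst0.
Qed.

Lemma csupport_mul phi chi : csupport (fun x => phi x * chi x) `<=` csupport phi.
Proof.
apply: closure_subset => x /=; apply: contra_neq => ->; exact: mul0r.
Qed.

Lemma D_K_bnd Omega K phi h : D_K M Omega K phi -> 0 < h -> exists2 C, 0 < C & bnd K h C phi.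
Proof. by move=> H h0; have [[_ B] _] := H h h0; exact/ultranorm_lt. Qed.

Lemma D_K_smooth Omega K phi : D_K M Omega K phi -> smooth_on Omega phi.
Proof. by move=> H; have [[]] := H 1 ltr01. Qed.

Lemma D_K_support Omega K phi : D_K M Omega K phi -> csupport phi `<=` K.
Proof. by move=> H; have [] := H 1 ltr01. Qed.

Lemma D_KP Omega K phi : smooth_on Omega phi -> csupport phi `<=` K ->
  (forall h, 0 < h -> exists2 C, 0 < C & bnd K h C phi) -> D_K M Omega K phi.
Proof. by move=> sm sK H h h0; do !split => //; apply/ultranorm_lt => //; exact: H. Qed.

Lemma D_K_mul Omega K phi chi : open Omega -> compact_in K Omega ->
  D_K M Omega K phi -> E_space M Omega chi -> D_K M Omega K (fun x => phi x * chi x).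
Proof.
move=> oO cK Dphi Echi; have sphi := D_K_smooth Dphi.
have schi := E_space_smooth Echi.
apply: D_KP; first exact: smooth_mul.
  by move=> x /csupport_mul; exact: (D_K_support Dphi).
move=> h h0; have h20 : 0 < h / 2 by rewrite divr_gt0.
have [C1 C10 H1] := D_K_bnd Dphi h20; have [C2 C20 H2] := E_space_bnd Echi cK h20.
exists (C1 * C2); first exact: mulr_gt0.
have := bnd_mul oO cK.2 (ltW h20) (ltW h20) (ltW C10) (ltW C20) sphi schi H1 H2.
by rewrite -splitr.
Qed.

Lemma D_K_mono Omega Omega' K phi : K `<=` Omega -> D_K M Omega K phi -> D_K M Omega' K phi.
Proof.
move=> KO Dphi; apply: D_KP; last by move=> h; exact: D_K_bnd Dphi.
  move=> s x _; exact: (smooth_of_support KO (D_K_support Dphi) (D_K_smooth Dphi)).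
exact: D_K_support Dphi.
Qed.

End Bounds.

(** * Continuity estimates and equicontinuity *)

Section Functionals.
Variables (R : realType) (d : nat) (M : nat -> R).
Hypothesis M_gt0 : forall p, 0 < M p.
Hypothesis M_0 : M 0%N = 1.
Hypothesis M_1 : forall p, (1 <= p)%N -> M p ^+ 2 <= M p.-1 * M p.+1.
Local Notation E := 'rV[R]_d.
Variable Omega : set E.
Hypothesis openOmega : open Omega.
Implicit Types (phi chi : E -> R[i]) (K : set E) (h C A : R).
Implicit Types (f F : (E -> R[i]) -> R[i]) (S : set (E -> R[i])).

Lemma linear_on0 S f : linear_on S f -> S (fun=> 0) -> f (fun=> 0) = 0.
Proof.
move=> lf S0; have := lf 1 _ _ S0 S0.
under eq_fun do rewrite mulr0 addr0.
by rewrite mul1r => /eqP; rewrite -subr_eq subrr => /eqP <-.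
Qed.

Lemma linear_onZ S f (a : R[i]) phi : linear_on S f -> S (fun=> 0) -> S phi ->
  f (fun x => a * phi x) = a * f phi.
Proof.
move=> lf S0 Sphi; have := lf a _ _ Sphi S0.
by under eq_fun do rewrite addr0; rewrite (linear_on0 lf S0) addr0.
Qed.

Lemma D_KZ K (a : R[i]) phi : compact_in K Omega -> D_K M Omega K phi ->
  D_K M Omega K (fun x => a * phi x).
Proof.
move=> cK Dphi; have sphi := D_K_smooth Dphi.
apply: (D_KP M_gt0).
- have := smooth_lin a openOmega sphi (@smooth_cst0 R d Omega).
  by under eq_fun do rewrite addr0.
- move=> x xs; apply: (D_K_support Dphi); apply: closure_subset xs => y /=.
  by apply: contra_neq => ->; rewrite mulr0.
- move=> h h0; have [C C0 HC] := D_K_bnd M_gt0 Dphi h0.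
  have a0 := cabs_ge0 a.
  exists (cabs a * C + 1); first by rewrite ltr_wpDl// mulr_ge0// ltW.
  apply: (bnd_le M_gt0 (ltW h0) _ (bnd_scale a openOmega cK.2 sphi HC)).
  by rewrite lerDl.
Qed.

Lemma D_K0 K : D_K M Omega K (fun=> 0).
Proof.
apply: (D_KP M_gt0); first exact: smooth_cst0.
  move=> x; rewrite /csupport (_ : [set _ | _] = set0) ?closure0//.
  by rewrite predeqE => y /=; rewrite eqxx.
move=> h h0; exists 1 => // al x _; rewrite /mderiv pderivs_cst0 cabs0 mul1r.
by rewrite mulr_ge0 ?exprn_ge0// ltW.
Qed.

Lemma D_dual_bound f K : D_dual M Omega f -> compact_in K Omega ->
  exists h C, [/\ 0 < h, 0 <= C & forall chi A, D_K M Omega K chi -> 0 <= A ->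
    bnd M K h A chi -> cabs (f chi) <= C * A].
Proof.
move=> [lf cf] cK; have [W0 [_ W0f _ /(_ K cK)[h [de [h0 de0 HW]]]]] := cf 1 ltr01.
exists h, (2 / de); split => //; first by rewrite divr_ge0// ltW.
move=> chi A Dchi A0 HA; apply/ler_addgt0Pr => e e0.
(* [A] may be 0, so the rescaling divides by a slightly larger number; [t] brings the seminorm of
   [chi] down to [de / 2]. *)
pose e' := A + e * de / 2.
have e'0 : 0 < e' by rewrite ltr_wpDl// divr_gt0// mulr_gt0.
pose t := de / (2 * e').
have t0 : 0 < t by rewrite divr_gt0// mulr_gt0.
have Dt : D_K M Omega K (fun x => Complex t 0 * chi x) by exact: D_KZ.
have Df phi : D_K M Omega K phi -> D_space M Omega phi by move=> ?; exists K.
have : cabs (f (fun x => Complex t 0 * chi x)) < 1.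
  apply: W0f; apply: HW => //.
  apply: (@le_lt_trans _ _ (de / 2)%:E); last by rewrite lte_fin; lra.
  apply/(ultranorm_le M_gt0 K _ _ h0).
  apply: (bnd_le M_gt0 (ltW h0) _ (bnd_scale (Complex t 0) openOmega cK.2 (D_K_smooth Dchi) HA)).
  rewrite cabsR gtr0_norm// /t mulrAC ler_pdivrMr ?mulr_gt0//.
  rewrite (_ : de / 2 * (2 * e') = de * e'); last by field.
  rewrite ler_pM2l// /e' lerDl divr_ge0// mulr_ge0 ?ltW//.
rewrite (linear_onZ _ lf (Df _ (D_K0 K)) (Df _ Dchi)) cabsM cabsR gtr0_norm//.
rewrite /t mulrC -ltr_pdivlMr// mul1r invf_div => /ltW /le_trans; apply.
rewrite (_ : 2 / de * A + e = 2 * e' / de)// /e'; field; exact: lt0r_neq0.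
Qed.

(** Continuity with explicit constants, which can be shared by a whole sequence of functionals. *)
Definition E_cont F K h C := forall chi A, E_space M Omega chi -> 0 <= A ->
  bnd M K h A chi -> cabs (F chi) <= C * A.

Lemma mul_linear f K phi : D_dual M Omega f -> compact_in K Omega ->
  D_K M Omega K phi -> linear_on (E_space M Omega) (mul_ultradist phi f).
Proof.
move=> [lf _] cK Dphi a chi chi' Echi Echi'; rewrite /mul_ultradist.
rewrite -lf; last 2 first.
- by exists K => //; exact: D_K_mul.
- by exists K => //; exact: D_K_mul.
by congr f; apply/funext => x; rewrite mulrDr mulrCA.
Qed.

Lemma mul_cont f K phi : D_dual M Omega f -> compact_in K Omega ->
  D_K M Omega K phi -> exists h C, [/\ 0 < h, 0 <= C &
    E_cont (mul_ultradist phi f) K h C].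
Proof.
move=> Hf cK Dphi; have [h [C [h0 C0 HC]]] := D_dual_bound Hf cK.
have h20 : 0 < h / 2 by rewrite divr_gt0.
have [A1 A10 HA1] := D_K_bnd M_gt0 Dphi h20.
exists (h / 2), (C * A1); split => //; first by rewrite mulr_ge0// ltW.
move=> chi A Echi A0 HA; rewrite -mulrA; apply: HC.
- exact: D_K_mul.
- by rewrite mulr_ge0// ltW.
- rewrite [h]splitr; apply: (bnd_mul M_gt0 M_0 M_1 openOmega cK.2 (ltW h20) (ltW h20)
    (ltW A10) A0 (D_K_smooth Dphi) (E_space_smooth Echi) HA1 HA).
Qed.

Lemma E_dual_of_cont F K h C : compact_in K Omega -> 0 < h -> 0 <= C ->
  linear_on (E_space M Omega) F -> E_cont F K h C -> E_dual M Omega F.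
Proof.
move=> cK h0 C0 lF HF; split => // e e0; exists K, h, (e / (C + 1)).
have C10 : 0 < C + 1 by rewrite ltr_wpDl.
split => //; first by rewrite divr_gt0.
move=> chi Echi /ltW /(ultranorm_le M_gt0 K _ _ h0) H.
rewrite /=; apply: (le_lt_trans (HF _ _ Echi (divr_ge0 (ltW e0) (ltW C10)) H)).
by rewrite mulrA ltr_pdivrMr// mulrC ltr_pM2l// ltrDl.
Qed.

Lemma E_dual_bounded_cst F K h C : compact_in K Omega -> 0 < h -> 0 <= C ->
  linear_on (E_space M Omega) F -> E_cont F K h C ->
  E_dual_bounded_seq M Omega (fun=> F).
Proof.
move=> cK h0 C0 lF HF; split=> [_|B [BE Bb]].
  exact: E_dual_of_cont cK h0 C0 lF HF.
have [A A0 HA] : exists2 A, 0 <= A & forall chi, B chi -> bnd M K h A chi.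
  have := Bb K h cK h0; set s := ereal_sup _ => sfin.
  have Hs chi : B chi -> (ultranorm M K h chi <= s)%E.
    by move=> Bchi; apply: ereal_sup_ubound; exists chi.
  case: s sfin Hs => [r| |]// _ Hs.
    exists `|r| => // chi /Hs rl; apply/(ultranorm_le M_gt0 K _ _ h0).
    by apply: (le_trans rl); rewrite lee_fin ler_norm.
  exists 0 => // chi /Hs; rewrite leeNy_eq => /eqP E; apply/(ultranorm_le M_gt0 K _ _ h0).
  by rewrite E leNye.
by exists (C * A) => _ chi Bchi; exact: (HF _ _ (BE _ Bchi) A0 (HA _ Bchi)).
Qed.

(** A compact exhaustion of [Omega]; removing open balls around the points outside [Omega] makes
    each set closed and contained in [Omega]. *)
Definition exhaust (n : nat) : set E :=
  [set x | `|x| <= n%:R] `&` ~` (\bigcup_(y in ~` Omega) [set x | `|y - x| < n.+1%:R^-1]).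

Lemma exhaust_compact n : compact_in (exhaust n) Omega.
Proof.
split; last first.
  move=> x [_ H]; apply: contrapT => nx; apply: H; exists x => //=.
  by rewrite subrr normr0 invr_gt0 ltr0n.
apply: bounded_closed_compact.
  exists n%:R; split; first exact: num_real.
  by move=> m nm x [xn _]; apply: le_trans xn (ltW nm).
apply: closedI.
  rewrite (_ : [set x | _] = (fun x : E => `|x|) @^-1` [set y | y <= n%:R])//.
  by apply: closed_comp; [move=> x _; exact: norm_continuous|exact: closed_le].
rewrite closedC; apply: bigcup_open => y _.
rewrite (_ : [set x | _] = ball y n.+1%:R^-1); last by rewrite -ball_normE.
exact: ball_open.
Qed.

Lemma exhaust_sub K : compact_in K Omega -> exists n0, forall n, (n0 <= n)%N -> K `<=` exhaust n.
Proof.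
move=> [cK KO]; have /compact_near_coveringP cov := cK.
have := cov nat \oo (fun n x => exhaust n x) _.
move=> /(_ _)[]; last by move=> N _ HN; exists N => n Nn x Kx; exact: (HN n Nn x Kx).
move=> x Kx; have /nbhs_ballP[r /= r0 Hr] : nbhs x Omega.
  by apply: open_nbhs_nbhs; split => //; exact: KO.
have r20 : 0 < r / 2 by rewrite divr_gt0.
have [N1 _ HN1] : \forall n \near \oo, (n.+1%:R^-1 : R) < r / 2.
  by apply: near_infty_natSinv_lt (PosNum r20).
pose N2 := Num.bound (`|x| + r / 2).
exists (ball x (r / 2), [set n | (maxn N1 N2 <= n)%N]).
  by split; [exact: nbhsx_ballx|exists (maxn N1 N2)].
move=> [y n] /= [xy]; rewrite geq_max => /andP[n1 n2].
move: xy; rewrite -ball_normE/= => xy; split.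
  rewrite /=; have := archi_boundP (addr_ge0 (normr_ge0 x) (ltW r20)) => H.
  have : N2%:R <= n%:R :> R by rewrite ler_nat.
  have : `|y| <= `|x| + `|x - y| by rewrite -[X in `|X| <= _](subKr x) ler_normB.
  rewrite -/N2 in H; lra.
move=> [z nz /= zy]; apply: nz; apply: Hr; rewrite -ball_normE/=.
have := lt_trans zy (HN1 n n1) => /= zr.
have := ler_normD (x - y) (y - z); rewrite subrKA (distrC y z); lra.
Qed.

(** If no constants worked for all [p], there would be test functions of size at most 1 on
    [exhaust n] with parameter [n.+1%:R^-1], on which some [g p] is at least [n]. Each seminorm is
    at most 1 on all but finitely many of them, so they form a bounded set, contradicting strong
    boundedness. *)
Lemma E_dual_bounded_equicontinuous g : E_dual_bounded_seq M Omega g ->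
  exists K h C, [/\ compact_in K Omega, 0 < h, 0 <= C & forall p, E_cont (g p) K h C].
Proof.
move=> [gE gB]; apply: contrapT => H.
have E0 := @E_space_cst0 R d M M_gt0 Omega.
have step (n : nat) : exists pc : nat * (E -> R[i]), [/\ E_space M Omega pc.2,
    bnd M (exhaust n) n.+1%:R^-1 1 pc.2 & n%:R <= cabs (g pc.1 pc.2)].
  apply: contrapT => Hn; apply: H; exists (exhaust n), n.+1%:R^-1, n%:R.
  split => //; first exact: exhaust_compact.
  move=> p chi A Echi A0 HA; rewrite leNgt; apply/negP => lt.
  have G0 : 0 < cabs (g p chi) by apply: le_lt_trans lt; rewrite mulr_ge0.
  apply: Hn; exists (p, fun x => Complex (n%:R / cabs (g p chi)) 0 * chi x).
  have t0 : 0 <= n%:R / cabs (g p chi) by rewrite divr_ge0// ltW.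
  split => /=.
  - have := E_space_lin M_gt0 (Complex (n%:R / cabs (g p chi)) 0) openOmega Echi E0.
    by under eq_fun do rewrite addr0.
  - have n0 : 0 <= n.+1%:R^-1 :> R by rewrite invr_ge0.
    apply: (bnd_le M_gt0 n0 _ (bnd_scale _ openOmega (exhaust_compact n).2 (E_space_smooth Echi) HA)).
    by rewrite cabsR ger0_norm// mulrAC ler_pdivrMr// mul1r ltW.
  - rewrite (linear_onZ _ (gE p).1 E0 Echi) cabsM cabsR ger0_norm// divfK//.
    exact: lt0r_neq0.
have [pc Hpc] := choice step.
have EB : E_bounded M Omega [set (pc n).2 | n in [set: nat]].
  split=> [_ [n _ <-]|K h cK h0]; first by have [] := Hpc n.
  have [n0 Hn0] := exhaust_sub cK.
  (* From [n1] on, [K] lies in [exhaust n] and [n.+1%:R^-1 <= h], so the bound is 1; the finitely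
     many earlier functions are bounded one by one. *)
  pose n1 := maxn n0 (Num.bound h^-1).
  have HCn n : exists C, 0 < C /\ bnd M K h C (pc n).2.
    have [En _ _] := Hpc n; have [C C0 HC] := E_space_bnd M_gt0 En cK h0.
    by exists C.
  have [C HC] := choice HCn.
  apply: (@le_lt_trans _ _ (1 + \sum_(n < n1) C n)%:E); last exact: ltry.
  apply: ge_ereal_sup => _ [_ [n _ <-] <-]; apply/(ultranorm_le M_gt0 K _ _ h0).
  have [nn1|nn1] := ltnP n n1.
    apply: (bnd_le M_gt0 (ltW h0) _ (HC n).2).
    rewrite (bigD1 (Ordinal nn1))//= addrCA lerDl addr_ge0// sumr_ge0// => i _.
    by have [/ltW] := HC i.
  have [_ Hn _] := Hpc n.
  have hn : n.+1%:R^-1 <= h.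
    rewrite -[leRHS]invrK lef_pV2 ?posrE ?invr_gt0//.
    have := archi_boundP (ltW (_ : 0 < h^-1)); rewrite invr_gt0 => /(_ h0) hb.
    apply: (le_trans (ltW hb)); rewrite ler_nat.
    by apply: leq_trans (leqnSn _); apply: leq_trans nn1; exact: leq_maxr.
  have KK : K `<=` exhaust n by apply: Hn0; apply: leq_trans nn1; exact: leq_maxl.
  have n0' : 0 <= n.+1%:R^-1 :> R by rewrite invr_ge0.
  have := bnd_leh M_gt0 n0' hn ler01 (bnd_sub KK Hn).
  apply: (bnd_le M_gt0 (ltW h0)); rewrite lerDl sumr_ge0// => i _.
  by have [/ltW] := HC i.
have [c Hc] := gB _ EB.
have [_ _ H1] := Hpc (Num.bound `|c|).
have := Hc (pc (Num.bound `|c|)).1 _ (ex_intro2 _ _ (Num.bound `|c|) I erefl).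
move=> /(le_trans H1); have := archi_boundP (normr_ge0 c); have := ler_norm c; lra.
Qed.

End Functionals.

(** * Periodization of a bump *)

Section ChasDer.
Variable R : realType.
Implicit Types F G : R -> R[i].

Lemma chas_derZ (c : R[i]) F dF : chas_der F dF ->
  chas_der (fun t => c * F t) (fun t => c * dF t).
Proof.
case: c => a b [F1 F2]; split.
- apply: has_der_ext (has_derB (has_derZ a F1) (has_derZ b F2)) => t;
  by [case: (F t) | case: (dF t)].
- apply: has_der_ext (has_derD (has_derZ a F2) (has_derZ b F1)) => t;
  by [case: (F t) => ? ? /=; rewrite addrC | case: (dF t) => ? ? /=; rewrite addrC].
Qed.

Lemma chas_der_sum (I : Type) (r : seq I) (F dF : I -> R -> R[i]) :
  (forall i, chas_der (F i) (dF i)) ->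
  chas_der (fun t => \sum_(i <- r) F i t) (fun t => \sum_(i <- r) dF i t).
Proof.
move=> H; split.
- apply: has_der_ext (has_der_sum r (fun i => (H i).1)) => t; by rewrite raddf_sum.
- apply: has_der_ext (has_der_sum r (fun i => (H i).2)) => t; by rewrite raddf_sum.
Qed.

Lemma chas_der_real (f df : R -> R) : has_der f df ->
  chas_der (fun t => Complex (f t) 0) (fun t => Complex (df t) 0).
Proof. by move=> H; split => //=; exact: has_derC. Qed.

End ChasDer.

(** Factors are exchanged one at a time. Errors are measured relative to the bounds [P i], which
    preserves their product and with it the dependence on the order of differentiation. *)
Lemma cabs_prod_sub (R : realType) (I : Type) (r : seq I) (a b : I -> R[i])
    (P : I -> R) (e : R) : 0 <= e ->
  (forall i, cabs (a i) <= P i) -> (forall i, cabs (b i) <= P i) ->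
  (forall i, cabs (a i - b i) <= e * P i) ->
  cabs (\prod_(i <- r) a i - \prod_(i <- r) b i) <= (size r)%:R * e * \prod_(i <- r) P i.
Proof.
move=> e0 aP bP abP; have P0 i : 0 <= P i := le_trans (cabs_ge0 _) (aP i).
elim: r => [|i r IH]; first by rewrite !big_nil subrr cabs0 !mul0r.
rewrite !big_cons (_ : _ - _ = (a i - b i) * \prod_(j <- r) a j +
  b i * (\prod_(j <- r) a j - \prod_(j <- r) b j)); last by ring.
apply: (le_trans (cabsD _ _)); rewrite !cabsM cabs_prod.
have -> : (size (i :: r))%:R * e * (P i * \prod_(j <- r) P j) =
    e * P i * \prod_(j <- r) P j + P i * ((size r)%:R * e * \prod_(j <- r) P j).
  by rewrite /= -natr1; ring.
apply: lerD; apply: ler_pM => //; rewrite ?cabs_ge0 ?prodr_ge0//.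
- by move=> *; exact: cabs_ge0.
- by apply: ler_prod => j _; rewrite cabs_ge0 aP.
Qed.

Section TensorBump.
Variables (R : realType) (d : nat) (M : nat -> R).
Hypothesis M_gt0 : forall p, 0 < M p.
Hypothesis M_0 : M 0%N = 1.
Hypothesis M_1 : forall p, (1 <= p)%N -> M p ^+ 2 <= M p.-1 * M p.+1.
Local Notation E := 'rV[R]_d.
Variables (B : 'M[R]_d) (x0 : E) (r : R) (psi : nat -> R -> R) (c : R -> R[i]).
Hypothesis unitB : B \in unitmx.
Hypothesis r_gt0 : 0 < r.
Hypothesis psi_der : forall k, has_der (psi k) (psi k.+1).
Hypothesis psi_off : forall k y, r <= `|y| -> psi k y = 0.

Definition bump_sum N s k z : R[i] :=
  \sum_(n < N.*2.+1) Complex 0 (2 * pi * (s + freq n)) ^+ k * c (s + freq n)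
    * cexp ((s + freq n) * z).

Hypothesis psi_bound : forall h, 0 < h -> exists2 C, 0 < C &
  [/\ forall k y, `|psi k y| <= C * h ^+ k * halfM M k,
      forall k eta, cabs (c eta) * (1 + eta ^+ 2) * `|eta| ^+ k <= C * h ^+ k * halfM M k &
      forall k N s z, 0 <= s <= 1 -> cabs (bump_sum N s k z) <= C * h ^+ k * halfM M k].
Hypothesis psi_approx : forall h e s, 0 < h -> 0 < e -> 0 <= s <= 1 ->
  exists N0, forall N k z, (N0 <= N)%N -> `|z| <= 1 / 2 ->
    cabs (Complex (psi k z) 0 - bump_sum N s k z) <= e * h ^+ k * halfM M k.

Local Notation lc := (lcoord B x0).

Definition bump_fun := tensor B x0 (fun _ k y => Complex (psi k y) 0).

Definition Bump : E -> R[i] := bump_fun (fun=> 0%N).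

Lemma chas_der_bump_sum N s k : chas_der (bump_sum N s k) (bump_sum N s k.+1).
Proof.
have E : bump_sum N s k.+1 = fun t => \sum_(n < N.*2.+1)
    Complex 0 (2 * pi * (s + freq n)) ^+ k * c (s + freq n) *
    (Complex 0 (2 * pi * (s + freq n)) * cexp ((s + freq n) * t)).
  by apply/funext => t; apply: eq_bigr => n _; rewrite exprS; ring.
rewrite E; apply: chas_der_sum => n.
exact: chas_derZ (chas_der_cexp (s + freq n)).
Qed.

(** The frequencies lie in [s] plus the integers, so an integer shift multiplies the sum by the
    phase [cexp (s * m%:~R)]: the modulus is periodic even though the sum need not be. *)
Lemma bump_sum_shift N s k z (m : int) :
  cabs (bump_sum N s k (z + m%:~R)) = cabs (bump_sum N s k z).
Proof.
rewrite (_ : bump_sum N s k (z + m%:~R) = cexp (s * m%:~R) * bump_sum N s k z).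
  by rewrite cabsM cabs_cexp mul1r.
rewrite /bump_sum mulr_sumr; apply: eq_bigr => n _.
have -> : (s + freq n) * (z + m%:~R) =
    s * m%:~R + freq n * m%:~R + (s + freq n) * z by ring.
have -> : freq n * m%:~R = ((n%:Z - N%:Z) * m)%:~R :> R by rewrite intrM intrB.
by rewrite !cexpD cexp_int mulr1; ring.
Qed.

Lemma graded_bump : graded B bump_fun.
Proof. by apply: graded_tensor => i k; exact: chas_der_real. Qed.

Definition trig_fun N (s : 'I_d -> R) := tensor B x0 (fun i => bump_sum N (s i)).

Lemma graded_trig N s : graded B (trig_fun N s).
Proof. by apply: graded_tensor => i k; exact: chas_der_bump_sum. Qed.

Lemma prod_halfM_le (be : 'I_d -> nat) (C h : R) : 0 <= C -> 0 < h ->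
  \prod_i (C * h ^+ be i * halfM M (be i)) <= C ^+ d * h ^+ (\sum_i be i) * M (\sum_i be i)%N.
Proof.
move=> C0 h0.
rewrite big_split/= big_split/= prodr_const card_ord -expr_sum -!mulrA.
apply: ler_wpM2l; first exact: exprn_ge0.
apply: ler_wpM2l; first by rewrite exprn_ge0// ltW.
apply: le_trans (M_superM_prod M_gt0 M_0 M_1 be).
apply: ler_prod => i _; apply/andP; split; first exact/ltW/halfM_gt0.
exact: (halfM_le_M M_gt0 M_0 M_1).
Qed.

Lemma bump_fun_le h : 0 < h -> exists2 C, 0 < C & forall be x,
  cabs (bump_fun be x) <= C * h ^+ (\sum_i be i) * M (\sum_i be i)%N.
Proof.
move=> h0; have [C C0 [HC _ _]] := psi_bound h0.
exists (C ^+ d) => [|be x]; first exact: exprn_gt0.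
apply: le_trans (prod_halfM_le be (ltW C0) h0).
rewrite /bump_fun /tensor cabs_prod; apply: ler_prod => i _.
by rewrite cabs_ge0 cabsR HC.
Qed.

(* Points at which the bump agrees with its periodization along the lattice dual to
   the rows of [B]: points of the central cell, or points where both vanish. *)
Definition good (x : E) := (forall i, `|lc i x| <= 1 / 2) \/
  (exists i, forall m : int, r <= `|lc i x - m%:~R|).

Lemma bump_trig_sub h e (s : 'I_d -> R) : 0 < h -> 0 < e -> (forall i, 0 <= s i <= 1) ->
  exists N, forall be x, good x ->
    cabs (bump_fun be x - trig_fun N s be x) <= e * h ^+ (\sum_i be i) * M (\sum_i be i)%N.
Proof.
move=> h0 e0 s01; have [C C0 [HC _ HS]] := psi_bound h0.
(* Exchanging [d] factors costs [d * e'] times a product containing [C ^+ d]; [d.+1] keeps the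
   denominator nonzero when [d = 0]. *)
pose e' := e / (d.+1%:R * C ^+ d).
have Cd0 : 0 < C ^+ d by rewrite exprn_gt0.
have e'0 : 0 < e' by rewrite divr_gt0// mulr_gt0// ltr0n.
have [N0 HN0] := choice (fun i => psi_approx h0 (mulr_gt0 e'0 C0) (s01 i)).
pose N := (\max_i N0 i)%N.
have main be (z : 'I_d -> R) : (forall i, `|z i| <= 1 / 2) ->
    cabs (\prod_i Complex (psi (be i) (z i)) 0 - \prod_i bump_sum N (s i) (be i) (z i))
    <= e * h ^+ (\sum_i be i) * M (\sum_i be i)%N.
  move=> z12.
  have := @cabs_prod_sub R 'I_d (index_enum _)
    (fun i => Complex (psi (be i) (z i)) 0) (fun i => bump_sum N (s i) (be i) (z i))
    (fun i => C * h ^+ be i * halfM M (be i)) e' (ltW e'0).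
  move=> H; apply: le_trans (H _ _ _) _.
  - by move=> i; rewrite cabsR.
  - by move=> i; exact: HS.
  - move=> i; apply: (le_trans (HN0 i N _ _ _ (z12 i))); first exact: leq_bigmax.
    by rewrite !mulrA.
  have -> : size (index_enum 'I_d) = d by rewrite -[RHS]card_ord cardT enumT.
  apply: (@le_trans _ _ (d.+1%:R * e' * (C ^+ d * h ^+ (\sum_i be i) * M (\sum_i be i)%N))).
    apply: ler_pM => //.
    - by rewrite mulr_ge0// ltW.
    - by apply: prodr_ge0 => i _; apply: le_trans (HC _ 0).
    - by rewrite ler_pM2r// ler_nat.
    - by apply: prod_halfM_le => //; exact: ltW.
  rewrite le_eqVlt; apply/orP; left; apply/eqP; rewrite /e'.
  have Dn0 : d.+1%:R != 0 :> R by rewrite pnatr_eq0.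
  move: (lt0r_neq0 Cd0) Dn0 => Cn0 Dn0.
  by move: (C ^+ d) (d.+1%:R) (h ^+ _) (M _) Cn0 Dn0 => u v w t u0 v0; field; rewrite u0 v0.
exists N => be x [gx|[i0 gx]]; first exact: main.
have zero (y : 'I_d -> R) : r <= `|y i0| -> \prod_i Complex (psi (be i) (y i)) 0 = 0 :> R[i].
  by move=> ry; rewrite (bigD1 i0)//= psi_off// mul0r.
rewrite /bump_fun /tensor zero; last by have := gx 0; rewrite subr0.
(* The coordinates are moved to the central cell. The bump vanishes there as well, since coordinate
   [i0] has distance at least [r] from every integer, and the modulus of the trigonometric sum is
   unchanged. *)
pose m i := Num.floor (lc i x + 1 / 2).
pose z i := lc i x - (m i)%:~R.
have z12 i : `|z i| <= 1 / 2.
  have := floor_itv (lc i x + 1 / 2); rewrite intrD -/(m i) => h'.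
  by rewrite /z ler_norml; lra.
have := main be z z12; rewrite zero; last exact: gx.
rewrite !sub0r !cabsN /trig_fun /tensor !cabs_prod => /(le_trans _); apply.
apply: ler_prod => i _; rewrite cabs_ge0/= -(bump_sum_shift _ _ _ (z i) (m i)).
by rewrite /z subrK.
Qed.

Lemma graded_bnd (U : ('I_d -> nat) -> E -> R[i]) K h A : graded B U -> 0 <= A -> 0 <= h ->
  (forall be x, K x -> cabs (U be x) <= A * h ^+ (\sum_i be i) * M (\sum_i be i)%N) ->
  smooth_on setT (U (fun=> 0%N)) /\ bnd M K (opnorm B * h) A (U (fun=> 0%N)).
Proof.
move=> HU A0 h0 HA; have Hj := jet_graded (fun=> 0%N) HU; split.
  exact: (jet_smooth openT Hj (fun _ _ => erefl)).
move=> al x Kx; rewrite /mderiv -/(monom al).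
rewrite (jet_pderivs openT Hj (fun _ _ => erefl))//.
have sz : (\sum_(i < d) 0 + size (monom al) = mabs al)%N.
  by rewrite big1// add0n size_monom.
apply: (le_trans (@graded_jet_le R d B U (A * h ^+ mabs al * M (mabs al)) _ _ _ _ _)).
- by rewrite !mulr_ge0 ?exprn_ge0// ltW.
- by move=> ga; rewrite sz => <-; exact: HA.
- rewrite size_monom exprMn le_eqVlt; apply/orP; left; apply/eqP; ring.
Qed.

Definition box : set E := [set x | forall i, `|lc i x| <= r].

Lemma lc_inv x : x = x0 + (\row_i lc i x) *m invmx B^T.
Proof.
have -> : \row_i lc i x = (x - x0) *m B^T by apply/rowP => i; rewrite mxE.
by rewrite mulmxK ?unitmx_tr// addrC subrK.
Qed.

Lemma box_norm x (t : R) : 0 <= t -> (forall i, `|lc i x| <= t) ->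
  `|x - x0| <= opnorm (invmx B^T) * t.
Proof.
move=> t0 H; rewrite [in leLHS](lc_inv x) addrC addKr.
apply: (le_trans (norm_mulmx_le _ _)); apply: ler_wpM2l; first exact: opnorm_ge0.
by apply: norm_le_coord => // i; rewrite mxE.
Qed.

Lemma box_compact : compact box.
Proof.
apply: bounded_closed_compact.
  exists (`|x0| + opnorm (invmx B^T) * r); split; first exact: num_real.
  move=> t /ltW tb x bx; apply: le_trans tb.
  rewrite -[X in `|X|](subrK x0) addrC; apply: (le_trans (ler_normD _ _)).
  by rewrite lerD2l; apply: box_norm => //; exact: ltW.
rewrite (_ : box = \bigcap_(i in [set: 'I_d]) [set x | `|lc i x| <= r]); last first.
  by rewrite predeqE => x; split => [H i _|H i]; exact: H.
apply: closed_bigI => i _.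
rewrite (_ : [set x | _] = (fun x => `|lc i x|) @^-1` [set y | y <= r])//.
apply: closed_comp; last exact: closed_le.
move=> x _; apply: (@continuous_comp _ _ _ (lc i) (fun y : R => `|y|)).
  exact: lcoord_continuous.
exact: norm_continuous.
Qed.

Lemma Bump_support : csupport Bump `<=` box.
Proof.
have cb : closed box by apply: compact_closed box_compact; exact: norm_hausdorff.
rewrite [X in _ `<=` X](iffLR (closure_id _) cb); apply: closure_subset.
move=> x /= /eqP bx i; rewrite leNgt; apply/negP => ri.
by apply: bx; rewrite /Bump /bump_fun /tensor (bigD1 i)//= psi_off ?mul0r// ltW.
Qed.

Lemma Bump_D Omega : box `<=` Omega -> D_K M Omega box Bump.
Proof.
move=> bO; apply: (D_KP M_gt0); last 2 first.
- exact: Bump_support.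
- move=> h h0; have op0 : 0 < opnorm B + 1 by rewrite ltr_wpDl ?opnorm_ge0.
  have [C C0 HC] := bump_fun_le (divr_gt0 h0 op0).
  exists C => //.
  have [_ H] := graded_bnd graded_bump (ltW C0) (ltW (divr_gt0 h0 op0)) (fun be x (_ : box x) => HC be x).
  apply: (bnd_leh M_gt0 _ _ (ltW C0) H).
    by rewrite mulr_ge0 ?opnorm_ge0// divr_ge0// ltW.
  by rewrite mulrA ler_pdivrMr// mulrC ler_pM2l// lerDl.
have [C C0 HC] := bump_fun_le ltr01.
have [sm _] := graded_bnd graded_bump (ltW C0) ler01 (fun be x (_ : box x) => HC be x).
by move=> s x _; exact: sm.
Qed.

Lemma trig_expansion N (s : 'I_d -> R) xi x :
  echar xi x * trig_fun N s (fun=> 0%N) x =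
  \sum_(n : {ffun 'I_d -> 'I_N.*2.+1})
    ((\prod_i c (s i + freq (n i))) * cexp (- dot ((\row_i (s i + freq (n i))) *m B) x0)) *
    echar (xi - (\row_i (s i + freq (n i))) *m B) x.
Proof.
rewrite /trig_fun /tensor /bump_sum.
rewrite bigA_distr_bigA/= mulr_sumr; apply: eq_bigr => n _.
under eq_bigr do rewrite expr0 mul1r.
rewrite big_split/= -cexp_sum mulrCA -mulrA; congr (_ * _).
rewrite !echarE -!cexpD; congr cexp.
have -> : \sum_i (s i + freq (n i)) * lc i x = dot ((\row_i (s i + freq (n i))) *m B) (x - x0).
  rewrite mulmx_sum_row dotC.
  transitivity (\sum_i (s i + freq (n i)) * dot (x - x0) (row i B)).
    by apply: eq_bigr => i _; rewrite lcoordE dotC.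
  elim/big_rec2 : _ => [|i u v _ ->].
    by rewrite /dot big1// => j _; rewrite !mxE mulr0.
  by rewrite dotDr dotZr mxE.
move: (_ *m B) => eta.
rewrite dotDr -[in dot eta (- x0)]scaleN1r dotZr dotC (dotC (xi - eta)) dotDr.
by rewrite -[in dot x (- eta)]scaleN1r dotZr (dotC x eta) (dotC x xi); ring.
Qed.

(** The sup norm is attained at one coordinate. Its coefficient absorbs the whole power [k], and the
    others contribute only their decay, so a single [halfM M k] appears. *)
Lemma coef_prod_le h : 0 < h -> exists2 C, 0 < C & forall (a : 'I_d -> R) k,
  (\prod_i cabs (c (a i))) * `|\row_i a i| ^+ k
  <= C * h ^+ k * halfM M k * \prod_i (1 + a i ^+ 2)^-1.
Proof.
move=> h0; have [C C0 [_ HC _]] := psi_bound h0.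
have w0 (t : R) : 0 < 1 + t ^+ 2 by rewrite ltr_wpDr// sqr_ge0.
have N0 k := ltW (halfM_gt0 M_gt0 k).
have H0 t : cabs (c t) <= C * (1 + t ^+ 2)^-1.
  by have := HC 0%N t; rewrite !expr0 !mulr1 /halfM big_ord0 mulr1 ler_pdivlMr.
exists (C ^+ d) => [|a k]; first exact: exprn_gt0.
have prod_w : 0 <= \prod_i (1 + a i ^+ 2)^-1.
  by apply: prodr_ge0 => i _; rewrite invr_ge0 ltW.
have allH : \prod_i cabs (c (a i)) <= C ^+ d * \prod_i (1 + a i ^+ 2)^-1.
  rewrite -[in C ^+ d](card_ord d) -prodr_const -big_split/=.
  by apply: ler_prod => i _; rewrite cabs_ge0 H0.
case: k => [|k].
  by rewrite !expr0 !mulr1 /halfM big_ord0 mulr1.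
have [z|nz] := eqVneq `|\row_i a i| 0.
  by rewrite z expr0n mulr0 !mulr_ge0 ?exprn_ge0// ltW.
have [[j i] /= Ei] : exists ij, `|\row_i a i| = `|(\row_i a i) ij.1 ij.2|.
  exact: mx_norm_neq0.
rewrite Ei mxE (bigD1 i)//= [X in _ <= _ * X](bigD1 i)//=.
have -> : C ^+ d = C * C ^+ (d.-1).
  by rewrite -exprS prednK// (leq_ltn_trans _ (ltn_ord i)).
rewrite mulrAC (_ : _ * (_ * _) = C * h ^+ k.+1 * halfM M k.+1 * (1 + a i ^+ 2)^-1 *
  (C ^+ d.-1 * \prod_(l | l != i) (1 + a l ^+ 2)^-1)); last by ring.
apply: ler_pM.
- by rewrite mulr_ge0 ?cabs_ge0 ?exprn_ge0.
- by apply: prodr_ge0 => *; exact: cabs_ge0.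
- by rewrite ler_pdivlMr// mulrAC; exact: HC.
- have -> : C ^+ d.-1 = \prod_(l | l != i) C.
    by rewrite prodr_const; congr (_ ^+ _); have := cardC1 i; rewrite card_ord => <-.
  by rewrite -big_split/=; apply: ler_prod => l _; rewrite cabs_ge0 H0.
Qed.

Lemma window_prod_le N (s : 'I_d -> R) : (forall i, 0 <= s i <= 1) ->
  \sum_(n : {ffun 'I_d -> 'I_N.*2.+1}) \prod_i (1 + (s i + freq (n i)) ^+ 2)^-1 <= 20 ^+ d.
Proof.
move=> s01.
rewrite -(bigA_distr_bigA (fun i (n : 'I_N.*2.+1) => (1 + (s i + freq n) ^+ 2)^-1))/=.
rewrite -[in leRHS](card_ord d) -prodr_const; apply: ler_prod => i _.
apply/andP; split; last exact: window_weight_le.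
by apply: sumr_ge0 => n _; rewrite invr_ge0 addr_ge0// sqr_ge0.
Qed.

Hypothesis M_3' : (\sum_(1 <= p <oo) (M p.-1 / M p)%:E < +oo)%E.

Lemma Bump_E Omega : open Omega -> E_space M Omega Bump.
Proof.
move=> oO; have [C C0 HC] := bump_fun_le ltr01.
apply: (E_spaceP M_gt0).
  have [sm _] := graded_bnd graded_bump (ltW C0) ler01 (fun be x (_ : box x) => HC be x).
  by move=> s x _; exact: sm.
move=> K h _ h0; have op0 : 0 < opnorm B + 1 by rewrite ltr_wpDl ?opnorm_ge0.
have [C' C'0 HC'] := bump_fun_le (divr_gt0 h0 op0).
exists C' => //.
have [_ H] := graded_bnd graded_bump (ltW C'0) (ltW (divr_gt0 h0 op0)) (fun be x (_ : K x) => HC' be x).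
apply: (bnd_leh M_gt0 _ _ (ltW C'0) H).
  by rewrite mulr_ge0 ?opnorm_ge0// divr_ge0// ltW.
by rewrite mulrA ler_pdivrMr// mulrC ler_pM2l// lerDl.
Qed.

Lemma linear_on_sum Omega F (I : Type) (l : seq I) (a : I -> R[i]) (phi : I -> E -> R[i]) :
  open Omega -> linear_on (E_space M Omega) F -> (forall i, E_space M Omega (phi i)) ->
  E_space M Omega (fun x => \sum_(i <- l) a i * phi i x) /\
  F (fun x => \sum_(i <- l) a i * phi i x) = \sum_(i <- l) a i * F (phi i).
Proof.
move=> oO lF Ephi; have E0 := @E_space_cst0 R d M M_gt0 Omega.
elim: l => [|i l [IHE IH]].
  under [X in F X]eq_fun do rewrite big_nil.
  under [X in E_space _ _ X]eq_fun do rewrite big_nil.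
  by rewrite big_nil (linear_on0 lF E0).
under [X in F X]eq_fun do rewrite big_cons.
under [X in E_space _ _ X]eq_fun do rewrite big_cons.
rewrite big_cons lF// IH; split => //; exact: E_space_lin.
Qed.

(** The remainder is [F] applied to [echar xi] times the approximation error of the bump. Continuity
    of [F] involves only [K], where every point is good; the parameter [h] is shared equally between
    the two factors. *)
Lemma remainder_small Omega K F h C0 xi (s : 'I_d -> R) e : open Omega -> compact_in K Omega ->
  (forall x, K x -> good x) -> linear_on (E_space M Omega) F ->
  0 < h -> 0 <= C0 -> E_cont M Omega F K h C0 -> (forall i, 0 <= s i <= 1) -> 0 < e ->
  exists N, cabs (F (fun x => echar xi x * Bump x) -
    \sum_(n : {ffun 'I_d -> 'I_N.*2.+1})
    ((\prod_i c (s i + freq (n i))) * cexp (- dot ((\row_i (s i + freq (n i))) *m B) x0)) *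
    F (echar (xi - (\row_i (s i + freq (n i))) *m B))) <= e.
Proof.
move=> oO cK Kgood lF h0 C00 HF s01 e0.
have h20 : 0 < h / 2 by rewrite divr_gt0.
have Ee zeta := @echar_E_space R d M M_gt0 M_0 M_1 M_3' Omega zeta.
have [Ax Ax0 HAx] := E_space_bnd M_gt0 (Ee xi) cK h20.
have op0 : 0 < opnorm B + 1 by rewrite ltr_wpDl ?opnorm_ge0.
have h10 : 0 < h / 2 / (opnorm B + 1) by rewrite divr_gt0.
pose e1 := e / (C0 * Ax + 1).
have CA0 : 0 < C0 * Ax + 1 by rewrite ltr_wpDl// mulr_ge0// ltW.
have e10 : 0 < e1 by rewrite divr_gt0.
have [N HN] := bump_trig_sub h10 e10 s01.
exists N; pose v x := Bump x - trig_fun N s (fun=> 0%N) x.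
have [vsm vb] := graded_bnd (graded_sub graded_bump (graded_trig N s)) (ltW e10) (ltW h10)
  (fun be x Kx => HN be x (Kgood x Kx)).
have vb2 : bnd M K (h / 2) e1 v.
  apply: (bnd_leh M_gt0 _ _ (ltW e10) vb).
    by rewrite mulr_ge0 ?opnorm_ge0// ltW.
  by rewrite mulrA ler_pdivrMr// mulrC ler_pM2l// lerDl.
have vO : smooth_on Omega v by move=> l x _; exact: vsm.
set S := \sum_n _.
pose T x := \sum_(n : {ffun 'I_d -> 'I_N.*2.+1})
    ((\prod_i c (s i + freq (n i))) * cexp (- dot ((\row_i (s i + freq (n i))) *m B) x0)) *
    echar (xi - (\row_i (s i + freq (n i))) *m B) x.
have [ET FT] := @linear_on_sum Omega F _ (index_enum {ffun 'I_d -> 'I_N.*2.+1})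
  (fun n => (\prod_i c (s i + freq (n i))) * cexp (- dot ((\row_i (s i + freq (n i))) *m B) x0))
  (fun n => echar (xi - (\row_i (s i + freq (n i))) *m B)) oO lF (fun n => Ee _).
have Exv : (fun x => echar xi x * v x) = fun x => -1 * T x + echar xi x * Bump x.
  by apply/funext => x; rewrite /v mulrBr trig_expansion mulN1r addrC.
have EB : E_space M Omega (fun x => echar xi x * Bump x).
  by apply: E_space_mul => //; exact: Bump_E.
have Ev : E_space M Omega (fun x => echar xi x * v x).
  by rewrite Exv; exact: E_space_lin.
have -> : F (fun x => echar xi x * Bump x) - S = F (fun x => echar xi x * v x).
  by rewrite Exv lF// FT mulN1r addrC.
have := HF _ (Ax * e1) Ev (mulr_ge0 (ltW Ax0) (ltW e10)).
have := bnd_mul M_gt0 M_0 M_1 oO cK.2 (ltW h20) (ltW h20) (ltW Ax0) (ltW e10)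
  (@smooth_echar R d Omega xi) vO HAx vb2.
rewrite -splitr => H1 /(_ H1) /le_trans; apply.
by rewrite mulrA /e1 mulrA ler_pdivrMr// mulrC ler_pM2l// lerDl.
Qed.

(** Here both [xi] and [xi - eta] are bounded by a multiple of the norm of [a]. Decay of the
    coefficients of order [p + q], for every [q], bounds the seminorm of the exponential after
    multiplication by the coefficients and by the [p]-th power of the norm of [xi]. *)
Lemma far_term (kappa h h' : R) : 0 < kappa -> kappa <= 1 / 2 -> 0 < h -> 0 < h' ->
  exists2 Q, 0 < Q & forall Omega K F C0, E_cont M Omega F K h C0 -> 0 <= C0 ->
  forall (a : 'I_d -> R) xi p, kappa * `|xi| < `|(\row_i a i) *m B| ->
  (\prod_i cabs (c (a i))) * cabs (F (echar (xi - (\row_i a i) *m B))) * `|xi| ^+ p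
  <= C0 * Q * h' ^+ p * M p * \prod_i (1 + a i ^+ 2)^-1.
Proof.
move=> k0 k12 h0 h'0; have pi0 := pi_gt0 R.
have op0 : 0 < opnorm B + 1 by rewrite ltr_wpDl ?opnorm_ge0.
(* The first bound on [h1] turns the factor of order [p] into at most [h' ^+ p]; the second makes
   the factor of order [q] at most 1. *)
pose op := opnorm B + 1; pose h1 := Num.min (kappa * h' / op) (kappa * h / (4 * pi * op)).
have h10 : 0 < h1 by rewrite lt_min !divr_gt0 ?mulr_gt0.
have h1a : h1 * op / kappa <= h'.
  by rewrite ler_pdivrMr// -ler_pdivlMr// [h' * _]mulrC ge_min lexx.
have h1b : h1 * (4 * pi * op / (kappa * h)) <= 1.
  have : h1 <= kappa * h / (4 * pi * op) by rewrite ge_min lexx orbT.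
  by move=> H; rewrite mulrA ler_pdivrMr ?mulr_gt0// mul1r -ler_pdivlMr ?mulr_gt0.
have [Q Q0 HQ] := coef_prod_le h10.
exists Q => // Omega K F C0 HF C00 a xi p far.
set w := \prod_i (1 + a i ^+ 2)^-1.
have w0 : 0 <= w by apply: prodr_ge0 => i _; rewrite invr_ge0 addr_ge0// sqr_ge0.
set eta := _ *m B; set Pc := \prod_i _; pose na := `|\row_i a i|.
have Pc0 : 0 <= Pc by apply: prodr_ge0 => *; exact: cabs_ge0.
have na0 : 0 <= na by exact: normr_ge0.
have eta_le : `|eta| <= op * na.
  by apply: (le_trans (norm_mulmx_le _ _)); rewrite ler_wpM2r// lerDl.
have xi_le : `|xi| <= op / kappa * na.
  rewrite mulrAC ler_pdivlMr// mulrC; exact: le_trans (ltW far) eta_le.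
have zeta_le : 2 * pi * `|xi - eta| / h <= 4 * pi * op / (kappa * h) * na.
  have : `|xi - eta| <= 2 * (op / kappa * na).
    apply: (le_trans (ler_normB _ _)); rewrite mulr_natl mulr2n; apply: lerD => //.
    apply: (le_trans eta_le); rewrite ler_wpM2r// ler_pdivlMr// ger_pMr//; lra.
  move=> H; rewrite ler_pdivrMr//.
  have -> : 4 * pi * op / (kappa * h) * na * h = 2 * pi * (2 * (op / kappa * na)).
    by field; rewrite !lt0r_neq0.
  by rewrite ler_pM2l// mulr_gt0.
pose X := Q * h' ^+ p * M p * w.
have X0 : 0 <= X by rewrite !mulr_ge0 ?exprn_ge0// ltW.
have key q : Pc * `|xi| ^+ p * (2 * pi * `|xi - eta| / h) ^+ q <= X * M q.
  apply: (@le_trans _ _ (Pc * (op / kappa * na) ^+ p * (4 * pi * op / (kappa * h) * na) ^+ q)).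
    apply: ler_pM => //.
    - by rewrite mulr_ge0 ?exprn_ge0.
    - by rewrite exprn_ge0// divr_ge0 ?mulr_ge0// ltW.
    - apply: ler_wpM2l => //; apply: lerXn2r; rewrite ?nnegrE//.
      by rewrite mulr_ge0// divr_ge0// ltW.
    - apply: lerXn2r; rewrite ?nnegrE//.
        by rewrite divr_ge0 ?mulr_ge0// ltW.
      by rewrite mulr_ge0// divr_ge0 ?mulr_ge0// ltW.
  rewrite !exprMn [leLHS](_ : _ = (op / kappa) ^+ p * (4 * pi * op / (kappa * h)) ^+ q *
    (Pc * na ^+ (p + q))); last by rewrite !exprMn exprD; ring.
  have u0 : 0 <= (op / kappa) ^+ p * (4 * pi * op / (kappa * h)) ^+ q.
    by rewrite mulr_ge0 ?exprn_ge0// divr_ge0 ?mulr_ge0// ltW.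
  apply: (le_trans (ler_wpM2l u0 (HQ a (p + q)%N))).
  rewrite -/w [leLHS](_ : _ = Q * w * ((h1 * op / kappa) ^+ p *
    (h1 * (4 * pi * op / (kappa * h))) ^+ q * halfM M (p + q))); last first.
    by rewrite !exprMn exprD; ring.
  rewrite /X [leRHS](_ : _ = Q * w * (h' ^+ p * 1 * (M p * M q))); last by ring.
  apply: ler_wpM2l; first by rewrite mulr_ge0// ltW.
  have v1 : 0 <= h1 * op / kappa by rewrite divr_ge0 ?mulr_ge0// ltW.
  have v2 : 0 <= h1 * (4 * pi * op / (kappa * h)).
    by rewrite mulr_ge0 ?divr_ge0 ?mulr_ge0// ltW.
  apply: ler_pM; [by rewrite mulr_ge0 ?exprn_ge0|exact/ltW/halfM_gt0| |exact: halfM_le].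
  apply: ler_pM; rewrite ?exprn_ge0//; last exact: exprn_ile1.
  by apply: lerXn2r; rewrite ?nnegrE// ltW.
have [y0|y0] := eqVneq (Pc * `|xi| ^+ p) 0.
  by rewrite mulrAC y0 mul0r -!mulrA mulr_ge0// !mulrA.
have {}y0 : 0 < Pc * `|xi| ^+ p by rewrite lt_neqAle eq_sym y0 mulr_ge0 ?exprn_ge0.
have HE : cabs (F (echar (xi - eta))) <= C0 * (X / (Pc * `|xi| ^+ p)).
  apply: HF; first exact: echar_E_space.
    by rewrite divr_ge0// ltW.
  apply: bnd_echar => // q.
  by rewrite [leRHS]mulrAC ler_pdivlMr// [leLHS]mulrC; exact: key.
rewrite mulrAC mulrC; apply: (le_trans (ler_wpM2r (ltW y0) HE)).
have -> : C0 * Q * h' ^+ p * M p * w = C0 * (X / (Pc * `|xi| ^+ p)) * (Pc * `|xi| ^+ p).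
  by rewrite -[RHS]mulrA divfK ?gt_eqF// /X !mulrA.
by [].
Qed.

(** For [kappa <= 1 / 2] the norm of [xi] is at most twice that of [xi - eta]; this is the origin of
    [2 ^+ p]. *)
Lemma near_term (kappa : R) : 0 < kappa -> kappa <= 1 / 2 ->
  exists2 W, 0 < W & forall (F : (E -> R[i]) -> R[i]) (a : 'I_d -> R) xi p A, 0 <= A ->
  `|(\row_i a i) *m B| <= kappa * `|xi| ->
  cabs (F (echar (xi - (\row_i a i) *m B))) * `|xi - (\row_i a i) *m B| ^+ p <= A ->
  (\prod_i cabs (c (a i))) * cabs (F (echar (xi - (\row_i a i) *m B))) * `|xi| ^+ p
  <= W * 2 ^+ p * A * \prod_i (1 + a i ^+ 2)^-1.
Proof.
move=> k0 k12; have [W W0 HW] := coef_prod_le ltr01.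
exists W => // F a xi p A A0 near HA; move: near HA.
set eta := _ *m B; set Pc := \prod_i _ => near HA.
have HPc : Pc <= W * \prod_i (1 + a i ^+ 2)^-1.
  by have := HW a 0%N; rewrite !expr0 !mulr1 /halfM big_ord0 mulr1.
have Pc0 : 0 <= Pc by apply: prodr_ge0 => *; exact: cabs_ge0.
have xi2 : `|xi| <= 2 * `|xi - eta|.
  have := ler_normD (xi - eta) eta; rewrite subrK.
  have := ler_wpM2r (normr_ge0 xi) k12; lra.
rewrite -mulrA [leRHS](_ : _ = W * \prod_i (1 + a i ^+ 2)^-1 * (2 ^+ p * A)); last by ring.
apply: ler_pM => //; first by rewrite mulr_ge0 ?cabs_ge0 ?exprn_ge0.
apply: (@le_trans _ _ (cabs (F (echar (xi - eta))) * (2 * `|xi - eta|) ^+ p)).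
  apply: ler_wpM2l; first exact: cabs_ge0.
  by apply: lerXn2r; rewrite ?nnegrE// mulr_ge0.
by rewrite exprMn mulrCA ler_wpM2l// exprn_ge0.
Qed.

Lemma core_estimate (Gam Gam' : set E) (kappa : R) : 0 < kappa -> kappa <= 1 / 2 ->
  (forall xi zeta, Gam' xi -> `|xi - zeta| <= kappa * `|xi| -> Gam zeta) ->
  exists2 W, 0 < W & forall h C0 h', 0 < h -> 0 <= C0 -> 0 < h' -> exists2 Q, 0 <= Q &
  forall Omega K F p A, open Omega -> compact_in K Omega -> (forall x, K x -> good x) ->
  linear_on (E_space M Omega) F -> E_cont M Omega F K h C0 -> 0 <= A ->
  (forall zeta, Gam zeta -> (exists n : 'rV[int]_d, zeta = map_mx intr n *m B) ->
     cabs (F (echar zeta)) * `|zeta| ^+ p <= A) ->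
  forall xi, Gam' xi -> cabs (F (fun x => echar xi x * Bump x)) * `|xi| ^+ p
    <= W * 2 ^+ p * A + Q * h' ^+ p * M p.
Proof.
move=> k0 k12 HG; have [W W0 HW] := near_term k0 k12.
exists (20 ^+ d * W) => [|h C0 h' h0 C00 h'0]; first by rewrite mulr_gt0 ?exprn_gt0.
have [Q Q0 HQ] := far_term k0 k12 h0 h'0.
exists (20 ^+ d * (C0 * Q)); first by rewrite !mulr_ge0 ?exprn_ge0// ltW.
move=> Omega K F p A oO cK Kgood lF HF A0 HA xi Gxi.
apply/ler_addgt0Pr => e e0.
pose t := xi *m invmx B.
have xit : xi = t *m B by rewrite /t mulmxKV.
clearbody t.
(* With the fractional parts of the coordinates of [xi] as offsets, every
   [xi - (\row_i (s i + freq (n i))) *m B] is an integer combination of rows of [B]. *)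
pose s i := t 0 i - (Num.floor (t 0 i))%:~R.
have s01 i : 0 <= s i <= 1 by have := floor_itv (t 0 i); rewrite intrD /s; lra.
pose e1 := e / (`|xi| ^+ p + 1).
have xip : 0 <= `|xi| ^+ p by rewrite exprn_ge0.
have e10 : 0 < e1 by rewrite divr_gt0// ltr_wpDl.
have [N HN] := remainder_small xi oO cK Kgood lF h0 C00 HF s01 e10.
pose a (n : {ffun 'I_d -> 'I_N.*2.+1}) i := s i + freq (n i).
pose X := W * 2 ^+ p * A + C0 * Q * h' ^+ p * M p.
have X1 : 0 <= W * 2 ^+ p * A by rewrite !mulr_ge0 ?exprn_ge0// ltW.
have X2 : 0 <= C0 * Q * h' ^+ p * M p by rewrite !mulr_ge0 ?exprn_ge0// ltW.
have w0 n : 0 <= \prod_i (1 + a n i ^+ 2)^-1.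
  by apply: prodr_ge0 => i _; rewrite invr_ge0 addr_ge0// sqr_ge0.
have term n : cabs ((\prod_i c (a n i)) * cexp (- dot ((\row_i a n i) *m B) x0) *
    F (echar (xi - (\row_i a n i) *m B))) * `|xi| ^+ p <= X * \prod_i (1 + a n i ^+ 2)^-1.
  rewrite !cabsM cabs_cexp mulr1 cabs_prod /X mulrDl.
  have [far|near] := ltP (kappa * `|xi|) `|(\row_i a n i) *m B|.
    apply: (le_trans (HQ _ _ _ _ HF C00 (a n) xi p far)).
    by rewrite lerDr mulr_ge0.
  apply: (@le_trans _ _ (W * 2 ^+ p * A * \prod_i (1 + a n i ^+ 2)^-1)).
    apply: HW => //; apply: HA.
      apply: (HG xi) => //; by rewrite opprB addrC subrK.
    exists (\row_i (Num.floor (t 0 i) - ((n i)%:Z - N%:Z))).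
    rewrite xit -mulmxBl; congr (_ *m _); apply/rowP => i; rewrite !mxE /a /s /freq.
    by rewrite !intrB; ring.
  by rewrite lerDl mulr_ge0.
set S := \sum_n _ in HN.
have HS : cabs S * `|xi| ^+ p <= X * 20 ^+ d.
  apply: (le_trans (ler_wpM2r xip (cabs_sum _ _))); rewrite mulr_suml.
  apply: (@le_trans _ _ (\sum_n X * \prod_i (1 + a n i ^+ 2)^-1)).
    by apply: ler_sum => n _; exact: term.
  rewrite -mulr_sumr; apply: ler_wpM2l; first exact: addr_ge0.
  exact: window_prod_le.
set Fx := F _ in HN *.
have HF1 : cabs Fx <= cabs S + e1.
  by rewrite -[Fx](subrK S) addrC; apply: (le_trans (cabsD _ _)); rewrite lerD2l.
apply: (le_trans (ler_wpM2r xip HF1)); rewrite mulrDl.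
have -> : 20 ^+ d * W * 2 ^+ p * A + 20 ^+ d * (C0 * Q) * h' ^+ p * M p = X * 20 ^+ d.
  by rewrite /X; ring.
apply: lerD => //.
rewrite /e1 mulrAC ler_pdivrMr ?ltr_wpDl// ler_pM2l// lerDl//.
Qed.

End TensorBump.

(** * Decay in cones *)

Section Cones.
Variables (R : realType) (d : nat).
Local Notation E := 'rV[R]_d.
Implicit Types (x xi zeta : E) (G : set E).

Lemma norm_le_enorm x : `|x| <= enorm x.
Proof.
apply: norm_le_coord => [|i]; first exact: sqrtr_ge0.
rewrite /enorm -sqrtr_sqr ler_sqrt; last by apply: sumr_ge0 => j _; rewrite -expr2 sqr_ge0.
by rewrite /dot (bigD1 i)//= expr2 lerDl sumr_ge0// => j _; rewrite -expr2 sqr_ge0.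
Qed.

Lemma enorm_le_norm x : enorm x <= d.+1%:R * `|x|.
Proof.
rewrite -[leRHS]ger0_norm ?mulr_ge0// -sqrtr_sqr /enorm ler_sqrt ?sqr_ge0//.
apply: (@le_trans _ _ (\sum_(i < d) `|x| ^+ 2)).
  apply: ler_sum => i _; rewrite -expr2 -real_normK ?num_real//.
  by apply: lerXn2r; rewrite ?nnegrE//; exact: coord_le_norm.
rewrite sumr_const card_ord -[leLHS]mulr_natl exprMn ler_wpM2r ?sqr_ge0//.
by rewrite -natrX ler_nat; nia.
Qed.

Lemma enorm_ge0 x : 0 <= enorm x.
Proof. exact: sqrtr_ge0. Qed.

Lemma enorm_gt0 x : x != 0 -> 0 < enorm x.
Proof. by move=> x0; apply: lt_le_trans (norm_le_enorm x); rewrite normr_gt0. Qed.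

(** [G'] is the union of the dilates of a ball around [xi] of half the available radius. After
    rescaling to that ball, a relative error [kappa] moves points by at most a quarter of the full
    radius. *)
Lemma conic_shrink xi G : conic_nbhd xi G -> exists G' (kappa : R),
  [/\ conic_nbhd xi G', 0 < kappa, kappa <= 1 / 2 &
    forall eta zeta, G' eta -> `|eta - zeta| <= kappa * `|eta| -> G zeta].
Proof.
move=> [oG Gxi G0 Gcone].
have /nbhs_ballP[e /= e0 He] : nbhs xi G by exact: open_nbhs_nbhs.
have He' zeta : `|xi - zeta| < e -> G zeta.
  by move=> h; apply: He; rewrite -ball_normE.
pose rho := e / 2.
have rho0 : 0 < rho by rewrite divr_gt0.
pose m := `|xi| + rho.
have m0 : 0 < m by rewrite ltr_wpDl.
pose kappa := Num.min (1 / 2) (e / (4 * m)).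
have k0 : 0 < kappa by rewrite lt_min !divr_gt0// mulr_gt0.
have km : kappa * m <= e / 4.
  have : kappa <= e / (4 * m) by rewrite ge_min lexx orbT.
  rewrite ler_pdivlMr ?mulr_gt0// mulrCA => h; lra.
pose G' : set E := \bigcup_(t in [set t : R | 0 < t]) [set x | `|t *: xi - x| < t * rho].
exists G', kappa; split => //; last first.
- move=> eta zeta [t /= t0 Ht] Hz.
  have tn0 : t != 0 by rewrite gt_eqF.
  have ti0 : 0 < t^-1 by rewrite invr_gt0.
  rewrite -[zeta]scale1r -(divff tn0) -scalerA; apply: (Gcone) => //; apply: He'.
  have h1 : `|xi - t^-1 *: eta| < rho.
    rewrite -(ltr_pM2l t0) -[X in X * `|_|](gtr0_norm t0) -normrZ scalerBr.
    by rewrite scalerA divff// scale1r.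
  have h2 : `|t^-1 *: eta - t^-1 *: zeta| <= kappa * `|t^-1 *: eta|.
    by rewrite -scalerBr !normrZ mulrCA ler_wpM2l.
  have h3 : `|t^-1 *: eta| <= m.
    have := ler_normB xi (xi - t^-1 *: eta); rewrite subKr /m; lra.
  have := ler_normD (xi - t^-1 *: eta) (t^-1 *: eta - t^-1 *: zeta).
  have := ler_wpM2l (ltW k0) h3; rewrite subrKA; move: h1 h2 km; rewrite /rho; lra.
- by rewrite ge_min lexx.
split.
- apply: bigcup_open => t _.
  rewrite (_ : [set x | _] = ball (t *: xi) (t * rho)); last by rewrite -ball_normE.
  exact: ball_open.
- by exists 1 => //=; rewrite scale1r subrr normr0 mul1r.
- move=> x [t /= t0 Ht]; apply: G0.
  have tn0 : t != 0 by rewrite gt_eqF.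
  have ti0 : 0 < t^-1 by rewrite invr_gt0.
  rewrite -[x]scale1r -(divff tn0) -scalerA; apply: Gcone => //; apply: He'.
  rewrite -(ltr_pM2l t0) -[X in X * `|_|](gtr0_norm t0) -normrZ scalerBr.
  rewrite scalerA divff// scale1r; apply: (lt_le_trans Ht).
  by rewrite ler_pM2l// /rho; lra.
- move=> t x t0 [u /= u0 Hu]; exists (t * u) => /=; first exact: mulr_gt0.
  by rewrite -scalerA -scalerBr normrZ gtr0_norm// -mulrA ltr_pM2l.
Qed.

End Cones.

Section DecayReformulation.
Variables (R : realType) (d : nat) (M : nat -> R).
Hypothesis M_gt0 : forall p, 0 < M p.
Hypothesis M_0 : M 0%N = 1.
Local Notation E := 'rV[R]_d.
Implicit Types (L G : set E) (g : (E -> R[i]) -> R[i]).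

Lemma ereal_sup_lty_ex (T : Type) (A : set T) (F : T -> \bar R) :
  (ereal_sup [set F x | x in A] < +oo)%E ->
  exists2 C : R, 0 < C & forall x, A x -> (F x <= C%:E)%E.
Proof.
set s := ereal_sup _ => sfin.
have Hs x : A x -> (F x <= s)%E by move=> Ax; apply: ereal_sup_ubound; exists x.
case: s sfin Hs => [c| |]// _ Hs.
  exists (`|c| + 1) => [|x /Hs h]; first by rewrite ltr_wpDl.
  by apply: (le_trans h); rewrite lee_fin ler_wpDr// ler_norm.
by exists 1 => // x /Hs h; apply: (le_trans h); rewrite leNye.
Qed.

Lemma lattice_decay_pow L G g r : 0 < r -> G `<=` [set~ 0] -> lattice_decay M L G g r ->
  exists2 C, 0 < C & forall mu p, G mu -> L mu ->
    cabs (fourier g mu) * (r * enorm mu) ^+ p <= C * M p.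
Proof.
move=> r0 G0 /ereal_sup_lty_ex[C C0 HC]; exists C => // mu p Gmu Lmu.
have t0 : 0 < r * enorm mu.
  by rewrite mulr_gt0// enorm_gt0//; apply/eqP; exact: G0.
rewrite -ler_pdivrMr// -mulrA -lee_fin EFinM.
apply: le_trans (HC mu (conj Gmu Lmu)); apply: lee_wpmul2l.
  by rewrite lee_fin cabs_ge0.
have tM0 : 0 < (r * enorm mu) ^+ p / M p by rewrite divr_gt0// exprn_gt0.
rewrite -[X in (X%:E <= _)%E](lnK tM0) -[leLHS]/(expeR (ln ((r * enorm mu) ^+ p / M p))%:E).
by rewrite lee_expeR; apply: ereal_sup_ubound; exists p.
Qed.

Lemma pow_lattice_decay L G g r C : 0 < r -> G `<=` [set~ 0] -> 0 < C ->
  (forall mu p, G mu -> cabs (fourier g mu) * (r * enorm mu) ^+ p <= C * M p) ->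
  lattice_decay M L G g r.
Proof.
move=> r0 G0 C0 H; rewrite /lattice_decay.
apply: (@le_lt_trans _ _ C%:E); last exact: ltry.
apply: ge_ereal_sup => _ [mu [Gmu _] <-].
have t0 : 0 < r * enorm mu.
  by rewrite mulr_gt0// enorm_gt0//; apply/eqP; exact: G0.
set c := cabs _.
(* A vanishing transform is treated apart, because [C / c] would be meaningless; the product is then
   0 even if the exponential is infinite. *)
have [->|cn0] := eqVneq c 0; first by rewrite mul0e lee_fin ltW.
have c0 : 0 < c by rewrite lt_neqAle eq_sym cn0 cabs_ge0.
have Cc0 : 0 < C / c by rewrite divr_gt0.
apply: (@le_trans _ _ (c%:E * expeR (ln (C / c))%:E)%E).
  apply: lee_wpmul2l; first by rewrite lee_fin ltW.
  rewrite lee_expeR; apply: ge_ereal_sup => _ [p _ <-].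
  have tM0 : 0 < (r * enorm mu) ^+ p / M p by rewrite divr_gt0// exprn_gt0.
  rewrite lee_fin ler_ln ?posrE// ler_pdivrMr// mulrAC ler_pdivlMr// mulrC.
  exact: H.
by rewrite /= lnK// -EFinM mulrC divfK// gt_eqF.
Qed.

(** Enlarging the constant pays for the strict inequality on the supremum in [decay_estimate]. *)
Lemma decay_estimate_of G (g : nat -> (E -> R[i]) -> R[i]) (A C : R) :
  0 < C -> (forall p xi, G xi -> cabs (fourier (g p) xi) * enorm xi ^+ p <= A * C ^+ p * M p) ->
  decay_estimate M G g (`|A| + 1) C.
Proof.
move=> C0 H p; apply: (@le_lt_trans _ _ (`|A| * C ^+ p * M p)%:E).
  apply: ge_ereal_sup => _ [xi Gxi <-]; rewrite lee_fin.
  apply: (le_trans (H p xi Gxi)); rewrite -!mulrA ler_wpM2r ?ler_norm//.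
  by rewrite mulr_ge0 ?exprn_ge0// ltW.
by rewrite lte_fin -!mulrA ltr_pM2r ?ltrDl// mulr_gt0 ?exprn_gt0.
Qed.

Lemma decay_estimate_pow G (g : nat -> (E -> R[i]) -> R[i]) (A C : R) p xi :
  decay_estimate M G g A C -> G xi ->
  cabs (fourier (g p) xi) * enorm xi ^+ p <= A * C ^+ p * M p.
Proof.
move=> /(_ p) H Gxi; rewrite -lee_fin; apply: le_trans (ltW H).
by apply: ereal_sup_ubound; exists xi.
Qed.

End DecayReformulation.

(** * Boxes and the dual lattice *)

Section BoxGeometry.
Variables (R : realType) (d : nat).
Local Notation E := 'rV[R]_d.
Variables (B : 'M[R]_d) (x0 : E).
Hypothesis unitB : B \in unitmx.
Local Notation lc := (lcoord B x0).

Lemma good_mono r r' x : r <= r' -> good B x0 r' x -> good B x0 r x.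
Proof.
move=> rr [g|[i g]]; [by left|right; exists i => m].
exact: le_trans rr (g m).
Qed.

Lemma lcoord0 i : lc i x0 = 0.
Proof. by rewrite lcoordE subrr; rewrite /dot big1// => j _; rewrite !mxE mulr0. Qed.

Lemma box_sub_nbhs (V : set E) : nbhs x0 V ->
  exists2 r2, 0 < r2 & forall r, 0 <= r -> r <= r2 -> box B x0 r `<=` V.
Proof.
move=> /nbhs_ballP[e /= e0 He].
have op0 : 0 < opnorm (invmx B^T) + 1 by rewrite ltr_wpDl ?opnorm_ge0.
exists (e / (2 * (opnorm (invmx B^T) + 1))); first by rewrite divr_gt0// mulr_gt0.
move=> r r0 rr x Hx; apply: He; rewrite -ball_normE/= distrC.
apply: le_lt_trans (box_norm unitB r0 Hx) _.
move: rr; rewrite ler_pdivlMr ?mulr_gt0// => rr.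
have := opnorm_ge0 (invmx B^T); nra.
Qed.

Definition obox (r : R) : set E := [set x | forall i, `|lc i x| < r].

Lemma obox_open r : open (obox r).
Proof.
rewrite (_ : obox r = \bigcap_(i in [set` enum 'I_d]) [set x | `|lc i x| < r]); last first.
  by apply/seteqP; split => x H i; [move=> _; exact: H|apply: H; rewrite /= mem_enum].
rewrite bigcap_seq; apply: big_ind => [|A C|i _]; [exact: openT|exact: openI|].
rewrite (_ : [set x | _] = (fun x => `|lc i x|) @^-1` [set y | y < r])//.
apply: open_comp; last exact: open_lt.
move=> x _; apply: continuous_comp; [exact: lcoord_continuous|exact: norm_continuous].
Qed.

Lemma obox_center r : 0 < r -> obox r x0.
Proof. by move=> r0 i; rewrite lcoord0 normr0. Qed.

(** If all coordinates of a point of [K] are integers, its displacement from [x0] lies in [U] and in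
    the dual lattice, so the point is [x0], and nearby points are in the central cell. Otherwise
    some coordinate keeps a positive distance from the integers nearby. Compactness makes the radius
    uniform. *)
Lemma good_lattice (L U K : set E) :
  (forall v, L v <-> exists n : 'rV[int]_d, v = map_mx intr n *m B) ->
  U `&` dual_lattice L = [set 0] -> compact K -> K `<=` [set x0 + u | u in U] ->
  exists2 r1, 0 < r1 & forall x, K x -> good B x0 r1 x.
Proof.
move=> HL UL cK KU; have /compact_near_coveringP cov := cK.
have := cov nat \oo (fun n x => good B x0 n.+1%:R^-1 x) _.
move=> /(_ _)[]; last first.
  move=> N _ HN; exists N.+1%:R^-1; first by rewrite invr_gt0 ltr0n.
  by move=> x Kx; exact: (HN N (leqnn N) x Kx).
move=> x Kx; have [u Uu ux] := KU x Kx.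
have [int|/existsNP[i /negP nint]] := pselect (forall i, lc i x \is a Num.int).
  have u0 : u = 0.
    suff : (U `&` dual_lattice L) u by rewrite UL.
    split => // v /HL[n ->].
    have -> : dot (map_mx intr n *m B) u = \sum_i (n 0 i)%:~R * lc i x.
      rewrite /dot; under eq_bigr do rewrite mxE mulr_suml.
      rewrite exchange_big/=; apply: eq_bigr => i _.
      rewrite lcoordE -ux addrC addKr /dot mulr_sumr; apply: eq_bigr => j _.
      by rewrite !mxE mulrA.
    by apply: rpred_sum => i _; apply: rpredM; [exact: intr_int|exact: int].
  exists (obox (1 / 2), setT); last by move=> [y n] /= [Hy _]; left => i; exact/ltW/Hy.
  split; last exact: filterT.
  apply: open_nbhs_nbhs; split; first exact: obox_open.
  by rewrite -ux u0 addr0; apply: obox_center.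
pose de := Num.min (lc i x - (Num.floor (lc i x))%:~R) ((Num.floor (lc i x))%:~R + 1 - lc i x).
have fl := floor_itv (lc i x); rewrite intrD in fl.
have de0 : 0 < de.
  rewrite lt_min !subr_gt0; apply/andP; split; last lra.
  rewrite lt_neqAle (andP fl).1 andbT; apply: contraNneq nint => <-.
  exact: intr_int.
have Hde (m : int) : de <= `|lc i x - m%:~R|.
  have [mf|mf] := leP m (Num.floor (lc i x)).
    have : m%:~R <= (Num.floor (lc i x))%:~R :> R by rewrite ler_int.
    by move=> H; rewrite ger0_norm /de ?ge_min; [apply/orP; left; lra|lra].
  have : (Num.floor (lc i x) + 1)%:~R <= m%:~R :> R by rewrite ler_int; lia.
  rewrite intrD => H; rewrite distrC ger0_norm /de ?ge_min; [apply/orP; right; lra|lra].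
have de20 : 0 < de / 2 by rewrite divr_gt0.
have [N _ HN] : \forall n \near \oo, (n.+1%:R^-1 : R) < de / 2.
  by apply: near_infty_natSinv_lt (PosNum de20).
exists ([set y | `|lc i x - lc i y| < de / 2], [set n | (N <= n)%N]).
  split; last by exists N.
  have /cvgrPdist_lt := @lcoord_continuous R d B x0 i x.
  exact.
move=> [y n] /= [Hy Nn]; right; exists i => m.
have := HN n Nn; have := Hde m; have := ler_normD (lc i x - lc i y) (lc i y - m%:~R).
rewrite subrKA /=; move: (n.+1%:R^-1 : R) => w; lra.
Qed.

End BoxGeometry.

(** * Transfer of decay between a lattice and a cone *)

Section MicrolocalBump.
Variables (R : realType) (d : nat) (M : nat -> R).
Hypothesis M_gt0 : forall p, 0 < M p.
Hypothesis M_0 : M 0%N = 1.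
Hypothesis M_1 : forall p, (1 <= p)%N -> M p ^+ 2 <= M p.-1 * M p.+1.
Hypothesis M_3' : (\sum_(1 <= p <oo) (M p.-1 / M p)%:E < +oo)%E.
Local Notation E := 'rV[R]_d.
Implicit Types (G K Omega : set E) (F : (E -> R[i]) -> R[i]).

(* [W * A] bounds the contribution of the lattice points near [xi], and [Q] that of the
   distant ones, for which only the continuity of [F] is available. *)
Definition transfers (B : 'M[R]_d) (x0 : E) (r : R) (phi : E -> R[i]) G G' (W : R) :=
  forall h C0 h', 0 < h -> 0 <= C0 -> 0 < h' -> exists2 Q, 0 <= Q &
  forall Omega K F p A C, open Omega -> compact_in K Omega ->
  (forall x, K x -> good B x0 r x) -> linear_on (E_space M Omega) F ->
  E_cont M Omega F K h C0 -> 0 <= A -> 0 < C ->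
  (forall zeta, G zeta -> (exists n : 'rV[int]_d, zeta = map_mx intr n *m B) ->
     cabs (F (echar zeta)) * `|zeta| ^+ p <= A * C ^+ p * M p) ->
  forall xi, G' xi -> cabs (F (fun x => echar xi x * phi x)) * enorm xi ^+ p
    <= (W * A + Q) * (d.+1%:R * Num.max (2 * C) h') ^+ p * M p.

Lemma microlocal_bump (B : 'M[R]_d) (x0 : E) (r : R) :
  B \in unitmx -> 0 < r -> r <= 1 / 8 -> exists phi,
  [/\ forall Omega, box B x0 r `<=` Omega -> D_K M Omega (box B x0 r) phi,
      forall x, obox B x0 (r / 4) x -> phi x = 1 &
      forall xi G, conic_nbhd xi G -> exists G' W,
        [/\ conic_nbhd xi G', 0 <= W & transfers B x0 r phi G G' W]].
Proof.
move=> uB r0 r8; have [psi [c [pder pone poff pbound papprox]]] := bump_fourier M_gt0 M_3' r0 r8.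
exists (Bump B x0 psi); split.
- exact: (Bump_D M_gt0 M_0 M_1 uB r0 pder poff pbound).
- move=> x Hx; rewrite /Bump /bump_fun /tensor big1// => i _.
  by rewrite pone//; exact/ltW/Hx.
move=> xi G /conic_shrink[G' [kappa [G'c k0 k12 GG']]]; exists G'.
have [W W0 HW] := core_estimate M_gt0 M_0 M_1 x0 uB pder poff pbound papprox M_3' k0 k12 GG'.
exists W; split => //; first exact: ltW.
move=> h C0 h' h0 C00 h'0; have [Q Q0 HQ] := HW h C0 h' h0 C00 h'0; exists Q => //.
move=> Omega K F p A C oO cK Kg lF HF A0 C1 HA eta G'eta.
have ACM0 : 0 <= A * C ^+ p * M p by rewrite !mulr_ge0 ?exprn_ge0// ltW.
have H := HQ Omega K F p _ oO cK Kg lF HF ACM0 HA eta G'eta.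
(* The lattice sums use the sup norm; passing to the Euclidean length costs a factor [d.+1] for each
   power. *)
apply: (@le_trans _ _ (cabs (F (fun x => echar eta x * Bump B x0 psi x)) *
    (d.+1%:R * `|eta|) ^+ p)).
  apply: ler_wpM2l; first exact: cabs_ge0.
  by apply: lerXn2r; rewrite ?nnegrE ?enorm_ge0 ?mulr_ge0//; exact: enorm_le_norm.
rewrite exprMn mulrCA; have dp0 : 0 <= d.+1%:R ^+ p :> R by rewrite exprn_ge0.
apply: (le_trans (ler_wpM2l dp0 H)).
set mx := Num.max _ _.
have C20 : 0 <= 2 * C by rewrite mulr_ge0// ltW.
have h'00 : 0 <= h' by exact: ltW.
have mx0 : 0 <= mx by rewrite le_max C20.
have mx1 : (2 * C) ^+ p <= mx ^+ p.
  by apply: lerXn2r; rewrite ?nnegrE//; rewrite le_max lexx.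
have mx2 : h' ^+ p <= mx ^+ p.
  by apply: lerXn2r; rewrite ?nnegrE//; rewrite le_max lexx orbT.
have -> : W * 2 ^+ p * (A * C ^+ p * M p) + Q * h' ^+ p * M p =
    (W * A * (2 * C) ^+ p + Q * h' ^+ p) * M p by rewrite exprMn; ring.
rewrite [leRHS](_ : _ = d.+1%:R ^+ p * ((W * A * mx ^+ p + Q * mx ^+ p) * M p)); last first.
  by rewrite exprMn; ring.
apply: ler_wpM2l => //; apply: ler_wpM2r; first exact: ltW.
by apply: lerD; apply: ler_wpM2l => //; rewrite mulr_ge0// ltW.
Qed.

End MicrolocalBump.

Section Microlocalization.
Variables (R : realType) (d : nat) (M : nat -> R).
Hypothesis M_gt0 : forall p, 0 < M p.
Hypothesis M_0 : M 0%N = 1.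
Hypothesis M_1 : forall p, (1 <= p)%N -> M p ^+ 2 <= M p.-1 * M p.+1.
Hypothesis M_3' : (\sum_(1 <= p <oo) (M p.-1 / M p)%:E < +oo)%E.
Local Notation E := 'rV[R]_d.
Variables (U : set E) (openU : open U) (U0 : U 0).
Variables (Omega : set E) (openOmega : open Omega).
Variables (f : (E -> R[i]) -> R[i]) (Hf : D_dual M Omega f).

Lemma ler_pow_enorm (z : R[i]) (x : E) p :
  cabs z * `|x| ^+ p <= cabs z * enorm x ^+ p.
Proof.
apply: ler_wpM2l; first exact: cabs_ge0.
by apply: lerXn2r; rewrite ?nnegrE ?enorm_ge0// norm_le_enorm.
Qed.

(** The transfer is applied to [F = phi f], with [chi] supported where [phi] is 1. Then
    [chi phi f = chi f], and this one functional serves as the whole sequence. *)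
Lemma regular_of_lattice_decay (L G : set E) x0 xi phi : lattice L ->
  U `&` dual_lattice L = [set 0] -> Omega x0 -> conic_nbhd xi G ->
  cutoff_at M (Omega `&` [set x0 + u | u in U]) x0 phi -> exists G' V g,
  [/\ conic_nbhd xi G', [/\ open V, V x0 & V `<=` Omega],
      E_dual_bounded_seq M Omega g, (forall p, agree_on M V (g p) f) &
      forall r, 0 < r -> lattice_decay M L G (mul_ultradist phi f) r ->
        exists2 A, 0 < A & decay_estimate M G' g A (d.+1%:R * (2 / r))].
Proof.
move=> Llat UL Ox0 cG [[K [cK KW] Dphi'] phi1].
have [B uB HB] := lattice_basis Llat.
have KO : K `<=` Omega by move=> x /KW[].
have KU : K `<=` [set x0 + u | u in U] by move=> x /KW[].
have Dphi : D_K M Omega K phi := D_K_mono M_gt0 Omega KW Dphi'.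
have cKO : compact_in K Omega by [].
have [r1 r10 Hgood] := good_lattice uB HB UL cK KU.
have [r2 r20 Hbox] : exists2 r2, 0 < r2 & forall r, 0 <= r -> r <= r2 ->
    box B x0 r `<=` [set x | Omega x /\ phi x = 1].
  apply: box_sub_nbhs => //; apply: filterI phi1.
  exact: open_nbhs_nbhs.
(* [r1] makes all points of [K] good, [r2] keeps the box where [phi] is 1, and [1 / 8] is the size
   allowed by the Fourier expansion. *)
pose r := Num.min r1 (Num.min r2 (1 / 8)).
have r0 : 0 < r by rewrite !lt_min r10 r20 divr_gt0.
have rr1 : r <= r1 by rewrite ge_min lexx.
have rr2 : r <= r2 by rewrite !ge_min lexx orbT.
have r8 : r <= 1 / 8 by rewrite !ge_min lexx !orbT.
have {}Hbox := Hbox r (ltW r0) rr2.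
have [chi [chiD chi1 chiG]] := microlocal_bump M_gt0 M_0 M_1 M_3' x0 uB r0 r8.
have [G' [W [cG' W0 HW]]] := chiG xi G cG.
have boxO : box B x0 r `<=` Omega by move=> x /Hbox[].
have cbox : compact_in (box B x0 r) Omega by split => //; exact: box_compact.
have Dchi := chiD Omega boxO.
have r40 : 0 < r / 4 by rewrite divr_gt0.
have Vbox : obox B x0 (r / 4) `<=` box B x0 r.
  by move=> x Hx i; apply: le_trans (ltW (Hx i)) _; lra.
exists G', (obox B x0 (r / 4)), (fun=> mul_ultradist chi f); split => //.
- split; [exact: obox_open|exact: obox_center|exact: subset_trans Vbox boxO].
- have [h [C [h0 C0 HC]]] := mul_cont M_gt0 M_0 M_1 openOmega Hf cbox Dchi.
  apply: E_dual_bounded_cst HC => //.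
  exact: mul_linear cbox Dchi.
- move=> _ ka [K' [_ K'V] Dka]; congr f; apply/funext => x.
  have [Vx|nVx] := pselect (obox B x0 (r / 4) x); first by rewrite chi1// mul1r.
  rewrite (csupport_notin (_ : ~ csupport ka x)) ?mulr0//.
  by move=> /(D_K_support Dka)/K'V.
move=> t t0 /(lattice_decay_pow M_gt0 t0 (let: And4 _ _ h _ := cG in h))[C C0 HC].
have [h [C1 [h0 C10 Hcont]]] := mul_cont M_gt0 M_0 M_1 openOmega Hf cKO Dphi.
have t20 : 0 < 2 / t by rewrite divr_gt0.
(* Decay with parameter [t] means the constant [t^-1] in the power estimates; the far contribution
   is adjusted to twice that constant. *)
have [Q Q0 HQ] := HW h C1 (2 / t) h0 C10 t20.
exists (`|W * C + Q| + 1); first by rewrite ltr_wpDl.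
apply: decay_estimate_of => //; first by rewrite mulr_gt0.
move=> p eta G'eta.
have {1}-> : 2 / t = Num.max (2 * t^-1) (2 / t) by rewrite maxxx.
have -> : fourier (mul_ultradist chi f) eta =
    mul_ultradist phi f (fun x => echar eta x * chi x).
  congr f; apply/funext => x.
  have [/Hbox[_ ->]|nx] := pselect (box B x0 r x); first by rewrite mul1r mulrC.
  rewrite (csupport_notin (_ : ~ csupport chi x)) ?mul0r ?mulr0//.
  by move=> /(D_K_support Dchi).
apply: (HQ Omega K) => //.
- by move=> x /Hgood; exact: good_mono.
- exact: mul_linear cKO Dphi.
- exact: ltW.
- by rewrite invr_gt0.
move=> zeta Gz /HB Lz; apply: le_trans (ler_pow_enorm _ _ _) _.
have tp0 : 0 < t ^+ p by rewrite exprn_gt0.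
have := HC zeta p Gz Lz; rewrite exprMn exprVn mulrCA mulrAC.
by rewrite ler_pdivlMr// mulrC.
Qed.

(** Decay is known on the whole cone, so any lattice may serve in the expansion. It is chosen so
    that the compact set carrying all the [g p] lies in the central cell, whatever the given [L]
    is. *)
Lemma lattice_decay_of_regular (L G V : set E) x0 xi g : Omega x0 ->
  conic_nbhd xi G -> open V -> V x0 -> E_dual_bounded_seq M Omega g ->
  (forall p, agree_on M V (g p) f) -> exists G' phi,
  [/\ conic_nbhd xi G', cutoff_at M (Omega `&` [set x0 + u | u in U]) x0 phi &
      forall A C, 0 < A -> 0 < C -> decay_estimate M G g A C ->
        lattice_decay M L G' (mul_ultradist phi f) (d.+1%:R * (2 * C))^-1].
Proof.
move=> Ox0 cG oV Vx0 gb gV.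
have [K [h [C0 [h0 C00 cK HK]]]] : exists K h C, [/\ 0 < h, 0 <= C,
    compact_in K Omega & forall p, E_cont M Omega (g p) K h C].
  by have [K [h [C [? ? ? ?]]]] := E_dual_bounded_equicontinuous M_gt0 openOmega gb; exists K, h, C.
have [b b0 Hb] : exists2 b, 0 <= b & forall x, K x -> `|x| <= b.
  have [b [_ Hb]] := compact_bounded cK.1.
  by exists (`|b| + 1) => // x Kx; apply: Hb Kx; rewrite (le_lt_trans (ler_norm b))// ltrDl.
(* Points of [K] differ from [x0] by at most [b + |x0|] in each coordinate, so scaling by [l] brings
   them within [1 / 2]. *)
pose l := (2 * (b + `|x0| + 1))^-1.
have den0 : 0 < b + `|x0| + 1 by rewrite ltr_wpDl// addr_ge0.
have l0 : 0 < l by rewrite invr_gt0 mulr_gt0.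
pose B : 'M[R]_d := l%:M.
have uB : B \in unitmx.
  by rewrite unitmxE det_scalar unitfE expf_neq0// gt_eqF.
have Kgood r x : K x -> good B x0 r x.
  move=> Kx; left => i; rewrite lcoordE.
  have -> : dot (row i B) (x - x0) = l * (x - x0) 0 i.
    rewrite /dot (bigD1 i)//= big1 ?addr0 => [|j ji]; rewrite !mxE ?eqxx//.
    by rewrite eq_sym (negbTE ji) mulr0n mul0r.
  rewrite normrM gtr0_norm// /l mulrC ler_pdivrMr ?mulr_gt0//.
  have := coord_le_norm (x - x0) i; have := ler_normB x x0; have := Hb x Kx; lra.
have nW : nbhs x0 [set x | V x /\ (Omega `&` [set x0 + u | u in U]) x].
  apply: filterI; first exact: open_nbhs_nbhs.
  apply: filterI; first exact: open_nbhs_nbhs.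
  have /nbhs_ballP[e /= e0 He] : nbhs (0 : E) U by exact: open_nbhs_nbhs.
  apply/nbhs_ballP; exists e => //= y; rewrite -ball_normE/= => yx.
  exists (y - x0); last by rewrite addrC subrK.
  by apply: He; rewrite -ball_normE/= sub0r opprB.
have [r2 r20 Hbox] := box_sub_nbhs uB nW.
pose r := Num.min r2 (1 / 8).
have r0 : 0 < r by rewrite lt_min r20 divr_gt0.
have rr2 : r <= r2 by rewrite ge_min lexx.
have r8 : r <= 1 / 8 by rewrite ge_min lexx orbT.
have {}Hbox := Hbox r (ltW r0) rr2.
have [chi [chiD chi1 chiG]] := microlocal_bump M_gt0 M_0 M_1 M_3' x0 uB r0 r8.
have [G' [W [cG' W0 HW]]] := chiG xi G cG.
have boxV : box B x0 r `<=` V by move=> x /Hbox[].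
have boxW : box B x0 r `<=` Omega `&` [set x0 + u | u in U] by move=> x /Hbox[].
have cbox : compact (box B x0 r) := box_compact uB r0.
exists G', chi; split => //.
  split; first by exists (box B x0 r); [split|exact: chiD].
  have r40 : 0 < r / 4 by rewrite divr_gt0.
  have : nbhs x0 (obox B x0 (r / 4)).
    by apply: open_nbhs_nbhs; split; [exact: obox_open|exact: obox_center].
  by apply: filterS => x; exact: chi1.
move=> A C A0 C1 Hdec.
have C20 : 0 < 2 * C by rewrite mulr_gt0.
have [Q Q0 HQ] := HW h C0 (2 * C) h0 C00 C20.
have WAQ : 0 < W * A + Q + 1 by rewrite ltr_wpDl// addr_ge0// mulr_ge0// ltW.
have dC0 : 0 < d.+1%:R * (2 * C) by rewrite mulr_gt0.
apply: (pow_lattice_decay M_gt0 _ _ _ WAQ) => //.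
- by rewrite invr_gt0.
- by case: cG'.
move=> eta p G'eta; rewrite exprMn exprVn mulrCA mulrC ler_pdivrMr ?exprn_gt0//.
(* [chi] is supported in [V], where every [g p] equals [f]; for the power [p] the functional [g p]
   is the one with the right bound. *)
have -> : fourier (mul_ultradist chi f) eta = g p (fun x => echar eta x * chi x).
  rewrite /fourier /mul_ultradist -(gV p); last first.
    exists (box B x0 r); first by [].
    apply: D_K_mul => //; first exact: chiD.
    exact: echar_E_space.
  by congr (g p); apply/funext => x; rewrite mulrC.
apply: (@le_trans _ _ ((W * A + Q) * (d.+1%:R * Num.max (2 * C) (2 * C)) ^+ p * M p)).
  apply: (HQ Omega K) => //.
  - by move=> x; exact: Kgood.
  - by have [/(_ p)[]] := gb.
  - exact: ltW.
  move=> zeta Gz _; apply: le_trans (ler_pow_enorm _ _ _) _.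
  exact: decay_estimate_pow Hdec Gz.
rewrite maxxx mulrAC ler_pM2r ?exprn_gt0// ler_pM2r// lerDl//.
Qed.

End Microlocalization.

Theorem theorem1p1 (R : realType) (d : nat) (M : nat -> R)
  (M_gt0 : forall p, 0 < M p)
  (M_0 : M 0%N = 1)
  (M_1 : forall p, (1 <= p)%N -> M p ^+ 2 <= M p.-1 * M p.+1)
  (M_2' : exists A H : R,
    [/\ 0 < A, 0 < H & forall p, M p.+1 <= A * H ^+ p * M p])
  (M_3' : (\sum_(1 <= p <oo) (M p.-1 / M p)%:E < +oo)%E)
  (Lambda : set 'rV[R]_d) (HLambda : lattice Lambda)
  (U : set 'rV[R]_d) (openU : open U) (convexU : convex_set U) (U0 : U 0)
  (U_dual : U `&` dual_lattice Lambda = [set 0])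
  (Omega : set 'rV[R]_d) (openOmega : open Omega)
  (f : ('rV[R]_d -> R[i]) -> R[i]) (Hf : D_dual M Omega f) :
  Roumieu_WF M Omega f =
    (Omega `*` [set~ 0]) `\`
    [set z : 'rV[R]_d * 'rV[R]_d | exists G phi,
      [/\ conic_nbhd z.2 G,
          cutoff_at M (Omega `&` [set z.1 + u | u in U]) z.1 phi &
          exists2 r : R, 0 < r &
            lattice_decay M Lambda G (mul_ultradist phi f) r]]
  /\
  Beurling_WF M Omega f =
    (Omega `*` [set~ 0]) `\`
    [set z : 'rV[R]_d * 'rV[R]_d | exists G phi,
      [/\ conic_nbhd z.2 G,
          cutoff_at M (Omega `&` [set z.1 + u | u in U]) z.1 phi &
          forall r : R, 0 < r ->
            lattice_decay M Lambda G (mul_ultradist phi f) r]].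
Proof.
have WF_eq (P Q : 'rV[R]_d * 'rV[R]_d -> Prop) :
    (forall z, (Omega `*` [set~ 0]) z -> P z <-> Q z) ->
    [set z | (Omega `*` [set~ 0]) z /\ ~ P z] = (Omega `*` [set~ 0]) `\` [set z | Q z].
  by move=> PQ; apply/seteqP; split => z [Oz nz]; split => //; apply: contra_not nz => /PQ; apply.
have d0 : 0 < d.+1%:R :> R by rewrite ltr0n.
split; apply: WF_eq => -[x0 xi] [/= Ox0 _]; split.
- move=> [G [V [g [cG [oV Vx0 _] gb gV [A [C [A0 C0 Hdec]]]]]]].
  have [G' [phi [cG' cut H]]] := lattice_decay_of_regular M_gt0 M_0 M_1 M_3'
    openU U0 openOmega Lambda Ox0 cG oV Vx0 gb gV.
  exists G', phi; split => //; exists (d.+1%:R * (2 * C))^-1.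
    by rewrite invr_gt0 !mulr_gt0.
  exact: H Hdec.
- move=> [G [phi [cG cut [r r0 Hr]]]].
  have [G' [V [g [cG' HV gb gV H]]]] := regular_of_lattice_decay M_gt0 M_0 M_1 M_3'
    openOmega Hf HLambda U_dual Ox0 cG cut.
  have [A A0 HA] := H r r0 Hr.
  exists G', V, g; split => //; exists A, (d.+1%:R * (2 / r)); split => //.
  by rewrite mulr_gt0// divr_gt0.
- move=> [G [V [g [cG [oV Vx0 _] gb gV Hdec]]]].
  have [G' [phi [cG' cut H]]] := lattice_decay_of_regular M_gt0 M_0 M_1 M_3'
    openU U0 openOmega Lambda Ox0 cG oV Vx0 gb gV.
  exists G', phi; split => // r r0.
  (* The constant for which the transferred lattice estimate has parameter exactly [r]. *)
  have C0 : 0 < (2 * d.+1%:R * r)^-1 by rewrite invr_gt0 !mulr_gt0.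
  have [A A0 HA] := Hdec _ C0.
  have := H A _ A0 C0 HA.
  suff -> : (d.+1%:R * (2 * (2 * d.+1%:R * r)^-1))^-1 = r by [].
  by move: (d.+1%:R : R) d0 => D D0; field; rewrite !gt_eqF.
- move=> [G [phi [cG cut Hr]]].
  have [G' [V [g [cG' HV gb gV H]]]] := regular_of_lattice_decay M_gt0 M_0 M_1 M_3'
    openOmega Hf HLambda U_dual Ox0 cG cut.
  exists G', V, g; split => // C C0.
  (* The parameter for which the transferred cone estimate has constant exactly [C]. *)
  have r0 : 0 < 2 * d.+1%:R / C by rewrite divr_gt0// mulr_gt0.
  have [A A0 HA] := H _ r0 (Hr _ r0).
  exists A => //; move: HA.
  suff -> : d.+1%:R * (2 / (2 * d.+1%:R / C)) = C by [].
  by move: (d.+1%:R : R) d0 => D D0; field; rewrite !gt_eqF.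
Qed.
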